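(* Assume that $\mathrm{char}(K)=0$, let $\lambda$ be a dominant integral weight of $GL(m|n)$, let $(I|J)=(i_1\ldots i_k|j_1\ldots j_k)$ be admissible, let $\lambda$ be $(I|J)$-robust, put $\sigma=\lambda_{I|J}$, and assume that its $m$-th entry satisfies $\sigma_m\geq n$. Then the set of all vectors $\pi_{K|L}$, for admissible $(K|L)$ such that $\mathrm{cont}(K|L)=\mathrm{cont}(I|J)$, forms a basis of the space of $G_{ev}$-primitive vectors of weight $\sigma$ in $F_k$.
   Context: $K$ is an algebraically closed field (here of characteristic $0$); $m,n\geq 1$. (In multi-indices $(K|L)$ the letter $K$ denotes a multi-index, not the field.) Put $|i|=0$ for $1\le i\le m$ and $|i|=1$ for $m+1\le i\le m+n$ (mod 2). $A(m|n)$ is the free supercommutative superalgebra over the field on generators $c_{ij}$ ($1\le i,j\le m+n$) of parity $|i|+|j|$. Write $C=(c_{ij})$ in blocks $C_{11}$ ($m\times m$), $C_{12}$, $C_{21}$, $C_{22}$ ($n\times n$). $K[G]$, the coordinate ring of $G=GL(m|n)$, is the localization of $A(m|n)$ at $\det(C_{11})\det(C_{22})$. $G$ acts on $K[G]$ by $C\mapsto Cg$. $G_{ev}\cong GL(m)\times GL(n)$ is the even subgroup of block diagonal matrices. Let $(A_{ij})$ be the adjugate of $C_{11}$. For $1\le i\le m<j\le m+n$ put $y_{ij}=\det(C_{11})^{-1}\sum_{a=1}^m A_{ia}c_{aj}$ (odd elements). For $m+1\le k,l\le m+n$ put $\phi(c_{kl})=c_{kl}-\sum_{a=1}^m c_{ka}y_{al}$.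 For $1\le i_1,\dots,i_s\le m$, $D^+(i_1,\dots,i_s)=\det(c_{a,i_b})_{1\le a,b\le s}$; for $m+1\le j_1,\dots,j_s\le m+n$, $D^-(j_1,\dots,j_s)=\det(\phi(c_{m+a,j_b}))_{1\le a,b\le s}$; empty determinants equal $1$; a hat means omission. A weight $\lambda=(\lambda^+|\lambda^-)\in\mathbb Z^{m+n}$ is dominant if $\lambda^+_1\ge\dots\ge\lambda^+_m$ and $\lambda^-_1\ge\dots\ge\lambda^-_n$. $H^0_{G_{ev}}(\lambda)$ (the $G_{ev}$-module induced from the lower triangular Borel, of highest weight $\lambda$) is identified with the subspace of $K[G]$ spanned by all products $D^+(1,\dots,m)^{\lambda^+_m}\,b^+\,D^-(m+1,\dots,m+n)^{\lambda^-_n}\,b^-$, where $b^+$ is a product, over the columns of the Young diagram of $\lambda^+-\lambda^+_m(1,\dots,1)$, of determinants $D^+(\cdot)$ of size the column length with arguments in $\{1,\dots,m\}$, and $b^-$ is likewise for $\lambda^--\lambda^-_n(1,\dots,1)$, with $D^-(\cdot)$ and arguments in $\{m+1,\dots,m+n\}$. Its highest weight vector is $v=\prod_{a=1}^m D^+(1,\ldots,a)^{\lambda^+_a-\lambda^+_{a+1}}\prod_{b=1}^n D^-(m+1,\ldots,m+b)^{\lambda^-_b-\lambda^-_{b+1}}$, with $\lambda^+_{m+1}=\lambda^-_{n+1}=0$. With $Y$ the $G_{ev}$-module spanned by the $y_{ij}$, the $k$-th floor $F_k=H^0_{G_{ev}}(\lambda)\otimes\wedge^kY$ is identified with the $G_{ev}$-submodule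 of $K[G]$ spanned by products $w\,y_{a_1,b_1}\cdots y_{a_k,b_k}$ with $w\in H^0_{G_{ev}}(\lambda)$ and pairwise distinct $y_{a_t,b_t}$. Let $(I|J)=(i_1\ldots i_k|j_1\ldots j_k)$ with $1\le i_s\le m$, $1\le j_s\le n$. Let $\delta^+_i$ (resp. $\delta^-_j$) be the weight with a single nonzero entry $1$ at position $i$ (resp. $m+j$). Put $\lambda_{I|J}=\lambda-\sum_s\delta^+_{i_s}+\sum_s\delta^-_{j_s}$. The content $\mathrm{cont}(I|J)=(x^+_1,\dots,x^+_m|x^-_1,\dots,x^-_n)$ has $x^+_s=-\#\{t: i_t=s\}$ and $x^-_s=\#\{t: j_t=s\}$. $(I|J)$ is admissible if $\lambda_{I|J}$ is dominant, $i_1\le\dots\le i_k$, and $i_r=i_{r+1}$ implies $j_r<j_{r+1}$. $\lambda$ is $(I|J)$-robust if each symbol $s<m$ appears at most $\lambda^+_s-\lambda^+_{s+1}$ times in $I$, the symbol $m$ appears at most $\lambda^+_m$ times in $I$, and each symbol $t>1$ appears at most $\lambda^-_{t-1}-\lambda^-_t$ times in $J$. Put \[\rho_{i|j}=\sum_{r=i}^m D^+(1,\ldots,i-1,r)\sum_{s=1}^{j}(-1)^{s+j}D^-(m+1,\ldots,\widehat{m+s},\ldots,m+j)\,y_{r,m+s},\] \[\pi_{I|J}=\frac{v}{\prod_{s=1}^kD^+(1,\ldots,i_s)\prod_{s=1}^kD^-(m+1,\ldots,m+j_s-1)}\;\rho_{i_1|j_1}\rho_{i_2|j_2}\cdots\rho_{i_k|j_k}.\]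 If $\lambda$ is $(I|J)$-robust then $\pi_{K|L}\in F_k$ for all admissible $(K|L)$ with $\mathrm{cont}(K|L)=\mathrm{cont}(I|J)$. A nonzero vector is $G_{ev}$-primitive if the line it spans is stabilized by the upper triangular Borel subgroup of $G_{ev}$; the space of $G_{ev}$-primitive vectors of weight $\sigma$ consists of these vectors of weight $\sigma$ together with $0$. *)

(* Defs.v *)
From HB Require Import structures.
From mathcomp Require Import all_boot all_order all_algebra.
From mathcomp Require Import mpoly.

Set Implicit Arguments.
Unset Strict Implicit.
Unset Printing Implicit Defensive.

Import Order.TTheory GRing.Theory Num.Theory.
Local Open Scope ring_scope.

(* The exterior algebra of R^p: the element x is the sum over S of            *)
(* ecoef x S *: (theta_s1 /\ ... /\ theta_sr), with S = {s1 < ... < sr}.      *)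
Definition extalg (R : Type) (p : nat) : Type := {ffun {set 'I_p} -> R}.

Section ExtAlg.
Variables (R : comNzRingType) (p : nat).
Local Notation E := (extalg R p).
Implicit Types (x y z : E) (S T U V : {set 'I_p}) (a b : R).

HB.instance Definition _ := GRing.Zmodule.copy E {ffun {set 'I_p} -> R}.

Definition ecoef (x : E) S : R := (x : {ffun {set 'I_p} -> R}) S.
Definition ext_of (f : {set 'I_p} -> R) : E := [ffun S => f S].

Lemma ecoefE f S : ecoef (ext_of f) S = f S. Proof. exact: ffunE. Qed.
Lemma ecoefP x y : ecoef x =1 ecoef y -> x = y. Proof. by move/ffunP. Qed.
Lemma ecoefD x y S : ecoef (x + y) S = ecoef x S + ecoef y S.
Proof. exact: ffunE. Qed.
Lemma ecoef0 S : ecoef 0 S = 0. Proof. exact: ffunE. Qed.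

Definition inversions T U : nat := \sum_(i in T) \sum_(j in U) (j < i)%N.

(* theta_T /\ theta_U = extsign T U *: theta_(T :|: U). *)
Definition extsign T U : R :=
  if [disjoint T & U] then (-1) ^+ inversions T U else 0.

Definition ext_mul x y : E := ext_of (fun S =>
  \sum_T \sum_U (extsign T U * (ecoef x T * ecoef y U)) *+ (T :|: U == S)).

Definition extC a : E := ext_of (fun S => a *+ (S == set0)).
Definition extX (i : 'I_p) : E := ext_of (fun S => (S == [set i])%:R).

Lemma disjointsU1 T U V :
  [disjoint T :|: U & V] = [disjoint T & V] && [disjoint U & V].
Proof.
by rewrite -disjointU; apply: eq_disjoint => i; rewrite !inE.
Qed.

Lemma disjointsU2 T U V :
  [disjoint T & U :|: V] = [disjoint T & U] && [disjoint T & V].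
Proof. by rewrite !(disjoint_sym T) disjointsU1. Qed.

Lemma inversionsU1 T U V : [disjoint T & U] ->
  inversions (T :|: U) V = (inversions T V + inversions U V)%N.
Proof.
move=> dTU; rewrite /inversions -bigU //.
by apply: eq_bigl => i; rewrite !inE.
Qed.

Lemma inversionsU2 T U V : [disjoint U & V] ->
  inversions T (U :|: V) = (inversions T U + inversions T V)%N.
Proof.
move=> dUV; rewrite /inversions -big_split /=; apply: eq_bigr => i _.
by rewrite -bigU //; apply: eq_bigl => j; rewrite !inE.
Qed.

Lemma extsignA T U V :
  extsign T U * extsign (T :|: U) V = extsign U V * extsign T (U :|: V).
Proof.
rewrite /extsign disjointsU1 disjointsU2.
case dTU: [disjoint T & U]; case dUV: [disjoint U & V];
  rewrite ?andbF ?mulr0 ?mul0r //=.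
rewrite andbT; case: ifP => _; rewrite ?mulr0 //.
by rewrite -!exprD inversionsU1 // inversionsU2 // addnA [in RHS]addnC.
Qed.

Lemma extsign01 U : extsign set0 U = 1.
Proof. by rewrite /extsign disjoints_subset sub0set /inversions big_set0. Qed.

Lemma extsign10 T : extsign T set0 = 1.
Proof.
rewrite /extsign disjoint_sym disjoints_subset sub0set /inversions big1 //.
by move=> i _; rewrite big_set0.
Qed.

Lemma ecoefM x y S : ecoef (ext_mul x y) S =
  \sum_T \sum_U (extsign T U * (ecoef x T * ecoef y U)) *+ (T :|: U == S).
Proof. exact: ecoefE. Qed.

Lemma sum_eq_nat (W : {set 'I_p}) (F : {set 'I_p} -> R) :
  \sum_A F A *+ (W == A) = F W.
Proof.
rewrite (bigD1 W) //= eqxx mulr1n big1 ?addr0 // => A.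
by rewrite eq_sym => /negbTE->.
Qed.

Lemma ext_mulA : associative ext_mul.
Proof.
move=> x y z; apply: ecoefP => S; rewrite !ecoefM.
pose G T U V := extsign T U * extsign (T :|: U) V *
   (ecoef x T * ecoef y U * ecoef z V) *+ (T :|: U :|: V == S).
transitivity (\sum_T \sum_U \sum_V G T U V).
  apply: eq_bigr => T _.
  transitivity (\sum_A \sum_U \sum_V
     (extsign U V * extsign T A * (ecoef x T * ecoef y U * ecoef z V)
        *+ (T :|: A == S)) *+ (U :|: V == A)).
    apply: eq_bigr => A _; rewrite ecoefM !mulr_sumr -sumrMnl.
    apply: eq_bigr => U _; rewrite !mulr_sumr -sumrMnl.
    apply: eq_bigr => V _; rewrite !mulrnAr mulrnAC; congr (_ *+ _ *+ _).
    by rewrite (mulrCA (ecoef x T)) [LHS]mulrCA -!mulrA.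
  rewrite exchange_big; apply: eq_bigr => U _ /=.
  rewrite exchange_big; apply: eq_bigr => V _ /=.
  by rewrite sum_eq_nat /G extsignA setUA.
symmetry.
transitivity (\sum_A \sum_T \sum_U \sum_V
   (extsign T U * extsign A V * (ecoef x T * ecoef y U * ecoef z V)
      *+ (A :|: V == S)) *+ (T :|: U == A)).
  apply: eq_bigr => A _.
  under eq_bigr do rewrite ecoefM mulr_suml mulr_sumr -sumrMnl.
  rewrite exchange_big; apply: eq_bigr => T _ /=.
  under eq_bigr do rewrite mulr_suml mulr_sumr -sumrMnl.
  rewrite exchange_big; apply: eq_bigr => U _ /=.
  apply: eq_bigr => V _; rewrite mulrnAl mulrnAr mulrnAC; congr (_ *+ _ *+ _).
  by rewrite -!mulrA [LHS]mulrCA.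
rewrite exchange_big; apply: eq_bigr => T _ /=.
rewrite exchange_big; apply: eq_bigr => U _ /=.
rewrite exchange_big; apply: eq_bigr => V _ /=.
by rewrite sum_eq_nat.
Qed.

Lemma ecoef_extCM a x S : ecoef (ext_mul (extC a) x) S = a * ecoef x S.
Proof.
rewrite ecoefM (bigD1 set0) //= [X in _ + X]big1 ?addr0 => [|T /negbTE nT]; last first.
  by apply: big1 => U _; rewrite ecoefE nT mulr0n mul0r mulr0 mul0rn.
under eq_bigr do rewrite set0U extsign01 mul1r ecoefE eqxx mulr1n eq_sym.
by rewrite (sum_eq_nat S (fun A => a * ecoef x A)).
Qed.

Lemma ecoef_extMC x a S : ecoef (ext_mul x (extC a)) S = ecoef x S * a.
Proof.
rewrite ecoefM exchange_big (bigD1 set0) //=.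
rewrite [X in _ + X]big1 ?addr0 => [|T /negbTE nT].
  under eq_bigr do rewrite setU0 extsign10 mul1r ecoefE eqxx mulr1n eq_sym.
  by rewrite (sum_eq_nat S (fun A => ecoef x A * a)).
by apply: big1 => U _; rewrite ecoefE nT mulr0n !mulr0 mul0rn.
Qed.

Lemma ext_mul1l : left_id (extC 1) ext_mul.
Proof. by move=> x; apply: ecoefP => S; rewrite ecoef_extCM mul1r. Qed.

Lemma ext_mul1r : right_id (extC 1) ext_mul.
Proof. by move=> x; apply: ecoefP => S; rewrite ecoef_extMC mulr1. Qed.

Lemma ext_mulDl : left_distributive ext_mul +%R.
Proof.
move=> x y z; apply: ecoefP => S; rewrite ecoefD !ecoefM -big_split.
apply: eq_bigr => T _; rewrite -big_split; apply: eq_bigr => U _ /=.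
by rewrite ecoefD mulrDl mulrDr mulrnDl.
Qed.

Lemma ext_mulDr : right_distributive ext_mul +%R.
Proof.
move=> x y z; apply: ecoefP => S; rewrite ecoefD !ecoefM -big_split.
apply: eq_bigr => T _; rewrite -big_split; apply: eq_bigr => U _ /=.
by rewrite ecoefD mulrDr mulrDr mulrnDl.
Qed.

Lemma extC1_neq0 : extC 1 != 0 :> E.
Proof.
apply/eqP => /(congr1 (fun x => ecoef x set0)).
by rewrite ecoefE eqxx ecoef0 => /eqP; rewrite oner_eq0.
Qed.

HB.instance Definition _ := GRing.Zmodule_isNzRing.Build E
  ext_mulA ext_mul1l ext_mul1r ext_mulDl ext_mulDr extC1_neq0.

End ExtAlg.

Section ExtInv.
Variables (R : comUnitRingType) (p : nat).
Local Notation E := (extalg R p).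
Implicit Types (x y : E) (S T U : {set 'I_p}) (a b : R).

Lemma ecoef_mulE x y S : ecoef (x * y) S =
  \sum_T \sum_U (extsign R T U * (ecoef x T * ecoef y U)) *+ (T :|: U == S).
Proof. exact: ecoefM. Qed.

Lemma ecoefCM a x S : ecoef (extC p a * x) S = a * ecoef x S.
Proof. exact: ecoef_extCM. Qed.

Lemma extC_comm a x : extC p a * x = x * extC p a.
Proof.
by apply: ecoefP => S; rewrite ecoefCM [RHS]ecoef_extMC mulrC.
Qed.

Lemma extC_is_zmod_morphism : zmod_morphism (@extC R p).
Proof.
move=> a b; apply: ecoefP => S; rewrite ecoefD ecoefE.
by rewrite mulrnBl; congr (_ + _); rewrite ?ecoefE // -ecoefE /ecoef /extC !ffunE.
Qed.

Lemma extC_is_monoid_morphism : monoid_morphism (@extC R p).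
Proof.
by split=> // a b; apply: ecoefP => S; rewrite ecoefCM !ecoefE mulrnAr.
Qed.

HB.instance Definition _ := GRing.isZmodMorphism.Build R E (@extC R p)
  extC_is_zmod_morphism.
HB.instance Definition _ := GRing.isMonoidMorphism.Build R E (@extC R p)
  extC_is_monoid_morphism.

Lemma ecoef0M x y : ecoef (x * y) set0 = ecoef x set0 * ecoef y set0.
Proof.
rewrite ecoef_mulE (bigD1 set0) //= [X in _ + X]big1 ?addr0 => [|T nT].
  rewrite (bigD1 set0) //= [X in _ + X]big1 ?addr0 => [|U nU].
    by rewrite setU0 eqxx extsign01 mul1r.
  by rewrite set0U (negbTE nU).
apply: big1 => U _; case: eqP => // eTU; case/eqP: nT.
by apply/eqP; rewrite -subset0 -eTU subsetUl.
Qed.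

Lemma ecoef_nilp x k S : ecoef x set0 = 0 -> (#|S| < k)%N -> ecoef (x ^+ k) S = 0.
Proof.
move=> x0; elim: k S => // k IHk S; rewrite ltnS => leSk.
rewrite exprS ecoef_mulE big1 // => T _; rewrite big1 // => U _.
case: eqP => // eS; rewrite mulr1n /extsign; case: ifP => [dTU|]; last first.
  by rewrite mul0r.
have [->|nT] := eqVneq T set0; first by rewrite x0 mul0r mulr0.
rewrite IHk ?mulr0 //; apply: leq_trans leSk.
move: dTU; rewrite -eS cardsU => /disjoint_setI0->; rewrite cards0 subn0.
by rewrite -[ltnLHS]add0n ltn_add2r card_gt0.
Qed.

Lemma ext_nilp x : ecoef x set0 = 0 -> x ^+ p.+1 = 0.
Proof.
move=> x0; apply: ecoefP => S; rewrite ecoef0 ecoef_nilp //.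
by rewrite ltnS -[leqRHS]card_ord max_card.
Qed.

(* An element is a unit iff its constant term a is; then, with                *)
(* x = a * (1 - nu), its inverse is the finite geometric series in nu.        *)
Definition ext_unit : pred E := fun x => ecoef x set0 \is a GRing.unit.
Definition ext_inv x : E :=
  if ext_unit x then
    let c := extC p (ecoef x set0)^-1 in
    (\sum_(i < p.+1) (1 - c * x) ^+ i) * c
  else x.

Lemma ext_mulVx : {in ext_unit, left_inverse 1 ext_inv *%R}.
Proof.
move=> x ux; rewrite /ext_inv [ext_unit x]ux /=.
set c := extC p _; set nu := 1 - c * x.
have nil0: nu ^+ p.+1 = 0.
  apply: ext_nilp; rewrite /nu ecoefD -mulN1r -(rmorph1 (@extC R p)) -rmorphN.
  by rewrite ecoefCM ecoefCM mulVr // ecoefE eqxx mulN1r subrr.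
have cx: c * x = 1 - nu by rewrite subKr.
have comm_nu: GRing.comm (1 - nu) (\sum_(i < p.+1) nu ^+ i).
  apply: commr_sum => i _; apply: commrX; apply: commr_sym.
  by apply: commrB; [exact: commr1|].
rewrite -mulrA cx -comm_nu -[X in X * _]opprK opprB mulNr -subrX1.
by rewrite nil0 sub0r opprK.
Qed.

Lemma ext_mulxV : {in ext_unit, right_inverse 1 ext_inv *%R}.
Proof.
move=> x ux; rewrite /ext_inv [ext_unit x]ux /=.
set c := extC p _; set nu := 1 - c * x.
have nil0: nu ^+ p.+1 = 0.
  apply: ext_nilp; rewrite /nu ecoefD -mulN1r -(rmorph1 (@extC R p)) -rmorphN.
  by rewrite ecoefCM ecoefCM mulVr // ecoefE eqxx mulN1r subrr.
have cx: c * x = 1 - nu by rewrite subKr.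
rewrite mulrA -extC_comm mulrA cx -[X in X * _]opprK opprB mulNr -subrX1.
by rewrite nil0 sub0r opprK.
Qed.

Lemma ext_unitP x y : y * x = 1 /\ x * y = 1 -> ext_unit x.
Proof.
case=> yx xy; apply/unitrP; exists (ecoef y set0).
by split; rewrite -ecoef0M ?yx ?xy -(rmorph1 (@extC R p)) ecoefE eqxx.
Qed.

Lemma ext_inv_out : {in [predC ext_unit], ext_inv =1 id}.
Proof. by move=> x /negbTE nux; rewrite /ext_inv [ext_unit x]nux. Qed.

HB.instance Definition _ := GRing.NzRing_hasMulInverse.Build E
  ext_mulVx ext_mulxV ext_unitP ext_inv_out.

End ExtInv.

Section Gmn.
Variables (K : fieldType) (m n : nat).

(* A(m|n) is the exterior algebra on the odd generators over the polynomial   *)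
(* ring Pev in the even generators, and K[G] is the exterior algebra over the  *)
(* localization of Pev at det(C_11)det(C_22).  As Pev is a domain, K[G] embeds *)
(* in the exterior algebra QG over the field of fractions of Pev.  We compute  *)
(* in QG, where the quotient by minors that defines pi_{I|J} exists.           *)
Local Notation Pev := {mpoly K[m * m + n * n]}.

Definition QG : Type := extalg {fraction Pev} (m * n + n * m).
HB.instance Definition _ := GRing.UnitRing.on QG.

Definition ofP (f : Pev) : QG := extC _ (FracField.tofrac f).
Definition ofK (c : K) : QG := ofP (mpolyC _ c).

Lemma ofP_is_zmod_morphism : zmod_morphism ofP.
Proof. by move=> f g; rewrite /ofP !rmorphB. Qed.
Lemma ofP_is_monoid_morphism : monoid_morphism ofP.
Proof. by split=> [|f g]; rewrite /ofP ?rmorph1 // !rmorphM. Qed.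
HB.instance Definition _ := GRing.isZmodMorphism.Build Pev QG ofP
  ofP_is_zmod_morphism.
HB.instance Definition _ := GRing.isMonoidMorphism.Build Pev QG ofP
  ofP_is_monoid_morphism.

Definition QG_scale (c : K) (x : QG) : QG := ofK c * x.

Lemma QG_scaleA c d x : QG_scale c (QG_scale d x) = QG_scale (c * d) x.
Proof. by rewrite /QG_scale /ofK mpolyCM rmorphM mulrA. Qed.
Lemma QG_scale1 : left_id 1 QG_scale.
Proof. by move=> x; rewrite /QG_scale /ofK rmorph1 mul1r. Qed.
Lemma QG_scaleDr : right_distributive QG_scale +%R.
Proof. by move=> c x y; rewrite /QG_scale mulrDr. Qed.
Lemma QG_scaleDl x : {morph QG_scale^~ x : c d / c + d}.
Proof. by move=> c d; rewrite /QG_scale /ofK mpolyCD rmorphD mulrDl. Qed.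
HB.instance Definition _ := GRing.Zmodule_isLmodule.Build K QG
  QG_scaleA QG_scale1 QG_scaleDr QG_scaleDl.

Lemma QG_scaleAl (c : K) (x y : QG) : c *: (x * y) = (c *: x) * y.
Proof. exact: mulrA. Qed.
HB.instance Definition _ := GRing.Lmodule_isLalgebra.Build K QG QG_scaleAl.

Lemma QG_scaleAr (c : K) (x y : QG) : c *: (x * y) = x * (c *: y).
Proof. by rewrite /GRing.scale /= /QG_scale mulrA extC_comm -mulrA. Qed.
HB.instance Definition _ := GRing.Lalgebra_isAlgebra.Build K QG QG_scaleAr.

(* The generic matrix C.  In the off-diagonal blocks and in Ymx, phiC, the    *)
(* index j : 'I_n stands for the row or column number m + j.                  *)
Definition X11 : 'M[Pev]_m := \matrix_(i, j) 'X_(lshift _ (mxvec_index i j)).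
Definition X22 : 'M[Pev]_n := \matrix_(i, j) 'X_(rshift _ (mxvec_index i j)).
Definition C11 : 'M[QG]_m := map_mx ofP X11.
Definition C12 : 'M[QG]_(m, n) :=
  \matrix_(i, j) extX _ (lshift _ (mxvec_index i j)).
Definition C21 : 'M[QG]_(n, m) :=
  \matrix_(i, j) extX _ (rshift _ (mxvec_index i j)).
Definition C22 : 'M[QG]_n := map_mx ofP X22.
Definition Cgen : 'M[QG]_(m + n) := block_mx C11 C12 C21 C22.

Definition Ymx : 'M[QG]_(m, n) :=
  \matrix_(i, j) ((\det C11)^-1 * \sum_(a < m) (\adj C11) i a * C12 a j).
Definition phiC : 'M[QG]_n :=
  \matrix_(k, l) (C22 k l - \sum_(a < m) C21 k a * Ymx a l).

(* The action of g = diag(g.1, g.2) in G_ev by C |-> C g: first on Pev (rows of*)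
(* images of the even generators), then on its fraction field, and finally on *)
(* QG, where the product over S is taken in increasing order, as in extalg.   *)
Definition Gev : Type := ('M[K]_m * 'M[K]_n)%type.

Definition even_img (g : Gev) : 'rV[Pev]_(m * m + n * n) :=
  row_mx (mxvec (X11 *m map_mx (@mpolyC _ K) g.1))
         (mxvec (X22 *m map_mx (@mpolyC _ K) g.2)).
Definition actP (g : Gev) (f : Pev) : Pev :=
  f \mPo [tuple even_img g 0 i | i < m * m + n * n].
Definition actF (g : Gev) (q : {fraction Pev}) : {fraction Pev} :=
  FracField.tofrac (actP g \n_(repr q)) / FracField.tofrac (actP g \d_(repr q)).
Definition odd_img (g : Gev) : 'rV[QG]_(m * n + n * m) :=
  row_mx (mxvec (C12 *m map_mx (in_alg QG) g.2))
         (mxvec (C21 *m map_mx (in_alg QG) g.1)).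
Definition act (g : Gev) (x : QG) : QG :=
  \sum_S extC _ (actF g (ecoef x S)) * \prod_(i in S) odd_img g 0 i.

(* D^+ and D^-: the minor on the first s rows and on the columns c_1,...,c_s, *)
(* in this order; rows and columns are numbered from 0, and the columns of    *)
(* phiC are numbered without the offset m.                                    *)
Definition entry (r : nat) (M : 'M[QG]_r) (a b : nat) : QG :=
  if insub a is Some i then if insub b is Some j then M i j else 0 else 0.
Definition minor (r : nat) (M : 'M[QG]_r) (c : seq nat) : QG :=
  \det (\matrix_(a < size c, b < size c) entry M a (nth 0%N c b)).
Definition Dplus := minor C11.
Definition Dminus := minor phiC.

End Gmn.

Section ActionTheory.
Variables (K : fieldType) (m n : nat).
Local Notation Pev := {mpoly K[m * m + n * n]}.
Local Notation QG := (QG K m n).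
Local Notation X11 := (X11 K m n).
Local Notation X22 := (X22 K m n).
Implicit Types (g h : Gev K m n).

Definition in_Gev g : bool := (g.1 \in unitmx) && (g.2 \in unitmx).

HB.instance Definition _ g := GRing.RMorphism.copy (@actP K m n g)
  (comp_mpoly [tuple even_img g 0 i | i < m * m + n * n]).

Lemma actP_C g (c : K) : actP g (mpolyC _ c) = mpolyC _ c.
Proof. exact: comp_mpolyC. Qed.

Lemma actP_X g i : actP g 'X_i = even_img g 0 i.
Proof. by rewrite /actP comp_mpolyXU -tnth_nth tnth_mktuple. Qed.

Lemma actP_X11 g :
  map_mx (actP g) X11 = X11 *m map_mx (@mpolyC _ K) g.1.
Proof.
by apply/matrixP => i j; rewrite !mxE actP_X row_mxEl mxvecE mxE.
Qed.

Lemma actP_X22 g :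
  map_mx (actP g) X22 = X22 *m map_mx (@mpolyC _ K) g.2.
Proof.
by apply/matrixP => i j; rewrite !mxE actP_X row_mxEr mxvecE mxE.
Qed.

Lemma actP_const g r s (A : 'M[K]_(r, s)) :
  map_mx (actP g) (map_mx (@mpolyC _ K) A) = map_mx (@mpolyC _ K) A.
Proof. by apply/matrixP => i j; rewrite !mxE actP_C. Qed.

Lemma actPK g : in_Gev g -> cancel (actP g) (actP (invmx g.1, invmx g.2)).
Proof.
case/andP=> u1 u2; set h := (_, _) => f.
pose F : {rmorphism Pev -> Pev} := actP h \o actP g.
have FX11 : map_mx F X11 = X11.
  rewrite [LHS]map_mx_comp [X in map_mx _ X = _]actP_X11.
  rewrite [LHS]map_mxM [X in X *m _]actP_X11 actP_const -mulmxA -map_mxM /=.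
  by rewrite mulVmx // map_mx1 mulmx1.
have FX22 : map_mx F X22 = X22.
  rewrite [LHS]map_mx_comp [X in map_mx _ X = _]actP_X22.
  rewrite [LHS]map_mxM [X in X *m _]actP_X22 actP_const -mulmxA -map_mxM /=.
  by rewrite mulVmx // map_mx1 mulmx1.
have FX i : F 'X_i = 'X_i.
  rewrite -(splitK i); case: (split i) => k; case/mxvec_indexP: k => a b.
    by have /matrixP/(_ a b) := FX11; rewrite !mxE.
  by have /matrixP/(_ a b) := FX22; rewrite !mxE.
have -> : actP h (actP g f) = F f by [].
elim/mpolyind: f => [|c mm q _ _ IH]; first exact: rmorph0.
rewrite rmorphD IH -mul_mpolyC rmorphM mpolyXE_id rmorph_prod.
congr (_ * _ + _); first by rewrite /F /= !actP_C.
by apply: eq_bigr => i _; rewrite rmorphXn FX.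
Qed.

Lemma actF_tofrac g f : in_Gev g ->
  actF g (FracField.tofrac f) = FracField.tofrac (actP g f).
Proof.
move=> ug; rewrite /actF.
set r := repr _.
have fr : \n_r = f * \d_r.
  rewrite /r; unlock FracField.tofrac.
  have := FracField.equivf_l (Ratio f 1).
  by rewrite !numden_Ratio ?oner_eq0 // mulr1 => ->; rewrite mulrC.
have d0 : FracField.tofrac (actP g \d_r) != 0.
  rewrite tofrac_eq0 -(rmorph0 (@actP K m n g)) (can_eq (actPK ug)).
  exact: denom_ratioP.
apply: (canLR (mulfK d0)); rewrite -rmorphM -rmorphM /=.
by rewrite fr.
Qed.

Lemma actF0 g : in_Gev g -> actF g 0 = 0.
Proof. by move=> ug; rewrite -tofrac0 actF_tofrac // rmorph0. Qed.

Lemma actF1 g : in_Gev g -> actF g 1 = 1.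
Proof. by move=> ug; rewrite -tofrac1 actF_tofrac // rmorph1. Qed.

Lemma act_extC g q : in_Gev g -> act g (extC _ q) = extC _ (actF g q).
Proof.
move=> ug; rewrite /act (bigD1 set0) //= [X in _ + X]big1 ?addr0.
  by rewrite big_set0 mulr1 [ecoef _ _]ecoefE eqxx.
move=> S /negbTE nS; rewrite [ecoef _ _]ecoefE nS mulr0n actF0 //.
by rewrite rmorph0 mul0r.
Qed.

Lemma act_extX g i : in_Gev g -> act g (extX _ i) = odd_img g 0 i.
Proof.
move=> ug; rewrite /act (bigD1 [set i]) //= [X in _ + X]big1 ?addr0.
  by rewrite big_set1 [ecoef _ _]ecoefE eqxx actF1 // rmorph1 mul1r.
move=> S /negbTE nS; rewrite [ecoef _ _]ecoefE nS actF0 //.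
by rewrite rmorph0 mul0r.
Qed.

Lemma map_ofP_const r s (A : 'M[K]_(r, s)) :
  map_mx (@ofP K m n) (map_mx (@mpolyC _ K) A) = map_mx (in_alg QG) A.
Proof. by apply/matrixP => i j; rewrite !mxE; exact/esym/mulr1. Qed.

(* The action indeed maps C to C g. *)
Lemma act_Cgen g : in_Gev g ->
  map_mx (act g) (Cgen K m n) =
  Cgen K m n *m map_mx (in_alg QG) (block_mx g.1 0 0 g.2).
Proof.
move=> ug; rewrite /Cgen !map_block_mx !map_mx0 mulmx_block.
rewrite !mulmx0 !addr0 !add0r; congr block_mx.
- rewrite -map_ofP_const -map_mxM -actP_X11; apply/matrixP => i j.
  by rewrite !mxE act_extC // actF_tofrac.
- by apply/matrixP => i j; rewrite !mxE act_extX // row_mxEl mxvecE mxE.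
- by apply/matrixP => i j; rewrite !mxE act_extX // row_mxEr mxvecE mxE.
- rewrite -map_ofP_const -map_mxM -actP_X22; apply/matrixP => i j.
  by rewrite !mxE act_extC // actF_tofrac.
Qed.

End ActionTheory.

Section LinearAlgebra.
Variables (K : fieldType) (V : lmodType K).

Definition in_span (B : V -> Prop) (x : V) : Prop :=
  exists s : seq (K * V),
    (forall p, p \in s -> B p.2) /\ x = \sum_(p <- s) p.1 *: p.2.

Definition is_basis (I : finType) (A : pred I) (f : I -> V) (W : V -> Prop) :=
  (forall c : I -> K, \sum_(i | A i) c i *: f i = 0 -> forall i, A i -> c i = 0)
  /\ (forall x, W x <-> exists c : I -> K, x = \sum_(i | A i) c i *: f i).

End LinearAlgebra.

(* (lambda^+ | lambda^-), numbered from 0; as nth returns 0 past the end, the *)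
(* conventions lambda^+_{m+1} = lambda^-_{n+1} = 0 hold automatically.        *)
Definition weight (m n : nat) : Type := (m.-tuple int * n.-tuple int)%type.
HB.instance Definition _ m n := Equality.on (weight m n).

Section Combinatorics.
Variables (m n : nat).
Implicit Types (lam : weight m n) (IJ : seq ('I_m * 'I_n)).

Definition dominant lam : bool :=
  sorted (fun x y => y <= x) lam.1 && sorted (fun x y => y <= x) lam.2.

Definition shift lam IJ : weight m n :=
  ([tuple lam.1`_s - \sum_(p <- IJ) (p.1 == s)%:Z | s < m],
   [tuple lam.2`_t + \sum_(p <- IJ) (p.2 == t)%:Z | t < n]).

Definition content IJ : weight m n :=
  ([tuple - (count (fun p => p.1 == s) IJ)%:Z | s < m],
   [tuple (count (fun p => p.2 == t) IJ)%:Z | t < n]).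

Definition admissible lam IJ : bool :=
  dominant (shift lam IJ) &&
  sorted (fun p q : 'I_m * 'I_n =>
            (p.1 <= q.1)%N && ((p.1 == q.1) ==> (p.2 < q.2)%N)) IJ.

(* For s = m - 1 the bound on the left is lambda^+_m, by the above convention.*)
Definition robust lam IJ : Prop :=
  (forall s : 'I_m,
     (count (fun p => p.1 == s) IJ)%:Z <= lam.1`_s - lam.1`_s.+1) /\
  (forall t : 'I_n, (0 < t)%N ->
     (count (fun p => p.2 == t) IJ)%:Z <= lam.2`_t.-1 - lam.2`_t).

End Combinatorics.

(* Column lengths of the Young diagram of mu - mu_r (1,...,1).                *)
Definition ncols (r : nat) (mu : r.-tuple int) : nat :=
  absz (mu`_0 - mu`_r.-1)%R.
Definition collen (r : nat) (mu : r.-tuple int) (c : nat) : nat :=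
  count (fun x => c%:Z < x - mu`_r.-1) mu.

Section Floors.
Variables (K : fieldType) (m n : nat).
Local Notation QG := (QG K m n).
Local Notation Dplus := (@Dplus K m n).
Local Notation Dminus := (@Dminus K m n).
Local Notation Ymx := (@Ymx K m n).
Implicit Types (lam sigma : weight m n) (x w : QG).

Definition col_product (r : nat) (D : seq nat -> QG) (mu : r.-tuple int)
    (b : QG) : Prop :=
  exists t : nat -> seq nat,
    (forall c, (c < ncols mu)%N ->
       size (t c) = collen mu c /\ all (fun a => a < r)%N (t c))
    /\ b = \prod_(c < ncols mu) D (t c).

Definition H0 lam : QG -> Prop := in_span (fun w =>
  exists bp bm : QG, col_product Dplus lam.1 bp /\ col_product Dminus lam.2 bm
  /\ w = Dplus (iota 0 m) ^ (lam.1`_m.-1) * bp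
         * Dminus (iota 0 n) ^ (lam.2`_n.-1) * bm).

Definition floorH0 lam (k : nat) : QG -> Prop := in_span (fun x =>
  exists w (ab : k.-tuple ('I_m * 'I_n)),
    [/\ H0 lam w, uniq ab & x = w * \prod_(p <- ab) Ymx p.1 p.2]).

(* is_trig_mx means lower triangular. *)
Definition in_Borel (g : Gev K m n) : bool :=
  [&& in_Gev g, is_trig_mx g.1^T & is_trig_mx g.2^T].

Definition primitive x : Prop :=
  x <> 0 /\ forall g, in_Borel g -> exists c : K, act g x = c *: x.

Definition has_weight sigma x : Prop :=
  forall (t1 : 'rV[K]_m) (t2 : 'rV[K]_n),
    in_Gev (diag_mx t1, diag_mx t2) ->
    act (diag_mx t1, diag_mx t2) x =
      ((\prod_(i < m) t1 0 i ^ (sigma.1`_i))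
       * (\prod_(j < n) t2 0 j ^ (sigma.2`_j))) *: x.

Definition primitive_space lam (k : nat) sigma x : Prop :=
  floorH0 lam k x /\ (x = 0 \/ primitive x /\ has_weight sigma x).

Definition vhigh lam : QG :=
  (\prod_(a < m) Dplus (iota 0 a.+1) ^ (lam.1`_a - lam.1`_a.+1))
  * (\prod_(b < n) Dminus (iota 0 b.+1) ^ (lam.2`_b - lam.2`_b.+1)).

(* With i, j counted from 0, rho i j is rho_{i+1|j+1}. *)
Definition rho (i : 'I_m) (j : 'I_n) : QG :=
  \sum_(r < m | (i <= r)%N) Dplus (rcons (iota 0 i) r)
    * \sum_(s < n | (s <= j)%N) (-1) ^+ (s + j)
        * Dminus [seq t <- iota 0 j.+1 | t != s :> nat] * Ymx r s.

Definition piv lam (IJ : seq ('I_m * 'I_n)) : QG :=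
  vhigh lam / ((\prod_(p <- IJ) Dplus (iota 0 p.1.+1))
               * \prod_(p <- IJ) Dminus (iota 0 p.2))
  * \prod_(p <- IJ) rho p.1 p.2.

End Floors.

(* Main.v *)
Require Import Defs.
From HB Require Import structures.
From mathcomp Require Import all_boot all_order all_algebra.
From mathcomp Require Import mpoly generic_quotient zify ring.

Set Implicit Arguments.
Unset Strict Implicit.
Unset Printing Implicit Defensive.

Import Order.TTheory GRing.Theory Num.Theory.
Local Open Scope ring_scope.

(** A function of a floor depends only on C11, phi(C22) and Y, and these three
    matrices are independent: the specialization C21 = 0, C12 = C11 Theta sends
    them to C11, C22 and a matrix Theta of free odd variables.  Hence a vector
    of the floor F_k can be written Delta * Psi Q for exactly one Q, where
    Delta is a monomial in det C11 and det phi(C22), where Q is a combination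
    of products of k odd variables Theta_ij and of minors of two generic
    matrices X11 and X22, on their first rows and of sizes prescribed by
    lambda, and where Psi substitutes (C11, phi(C22), Y) for (X11, X22, Theta)
    ([floorH0P], [Psi_inj]).  In these terms G_ev acts by X11 -> X11 g1,
    X22 -> X22 g2 and Theta -> g1^-1 Theta g2 ([act_Psi]).

    A Borel eigenvector is determined by its value at the identity.  The minors
    in Q involve first rows only, so that Q is also semi-invariant when X11 and
    X22 are multiplied on the left by lower triangular matrices
    ([floor_lower]).  As products of a lower and an upper triangular matrix
    are dense, an eigenvector Q of the upper triangular Borel subgroup vanishes
    as soon as its value at X11 = 1, X22 = 1 does ([eigen_vanish]).

    The vectors pi are Borel eigenvectors with a simple value at the identity.
    Gaussian elimination without denominators gives matrices N(X11) and W(X22),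
    with minors as entries, such that N(X11) is upper triangular and of the
    form V X11 with V lower triangular, and such that W(X22) is upper and
    X22 W(X22) lower triangular.  The rho_{i|j} are the images of the entries
    of N Theta W.  If g is upper triangular, N becomes D N g1 and g2 W becomes
    W D' with diagonal D and D', so that each entry of N Theta W is an
    eigenvector ([H_rhoF]).  Thus pi_{K|L} is one, of weight lambda_{K|L}
    ([semi_piv]); by robustness the quotient that defines it is a polynomial in
    minors of the right sizes, so that it lies in the floor ([floor_Qpi]); and
    since N(1) = W(1) = 1, its value at the identity is the product of the
    variables Theta_{k_s l_s} ([ev1_Qpi]).

    For admissible (K|L) these products are, up to sign, distinct monomials of
    an exterior algebra, hence the pi_{K|L} are linearly independent.
    Conversely let x in F_k be primitive of weight sigma.  Its value at the
    identity is homogeneous of degree k, and the torus acts on it by the same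
    character as on the value of pi_{I|J}, so that only monomials with the
    content of (I|J) occur ([support_ev1]).  Each of them is up to sign the
    value of an admissible pi_{K|L}; subtracting the corresponding combination
    of the pi_{K|L} leaves an eigenvector that vanishes at the identity, that
    is, zero.  This uses that x and the pi_{K|L} have the same Borel character,
    not only the same weight: characters of the Borel subgroup are trivial on
    unipotent elements ([borel_char]). *)

(** * Evaluation of exterior algebras *)

Section FiniteSets.
Variable p : nat.
Implicit Types (i j : 'I_p) (S T U : {set 'I_p}).

Lemma enum_setU1_min i S : (forall j, j \in S -> (i < j)%N) ->
  enum (i |: S) = i :: enum S.
Proof.
move=> min_i; pose lto := (fun a b : 'I_p => (a < b)%N).
have tr : transitive lto by move=> ? ? ?; apply: ltn_trans.
have sE (A : {set 'I_p}) : sorted lto (enum A).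
  rewrite {1}/enum_mem -enumT; apply: sorted_filter => //.
  by have := iota_ltn_sorted 0 p; rewrite -val_enum_ord sorted_map.
apply: (irr_sorted_eq tr) => [x|||x]; first exact: ltnn.
- exact: sE.
- rewrite /= (path_sortedE tr) sE andbT; apply/allP => j.
  by rewrite mem_enum; exact: min_i.
- by rewrite !inE !mem_enum !inE.
Qed.

(** Adding elements in decreasing order makes the ordered products over a
    set grow on the left only. *)
Lemma set_min_ind (P : {set 'I_p} -> Prop) : P set0 ->
  (forall i S, (forall j, j \in S -> (i < j)%N) -> P S -> P (i |: S)) ->
  forall S, P S.
Proof.
move=> P0 PS S; have [k] := ubnP #|S|; elim: k S => // k IH S; rewrite ltnS => leSk.
have [->//|/set0Pn[i0 Si0]] := eqVneq S set0.
case: (@arg_minnP _ i0 (mem S) val Si0) => i Si min_i; have {}Si : i \in S := Si.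
rewrite -(setD1K Si); apply: PS => [j|].
  rewrite !inE => /andP[ne_ji Sj]; rewrite ltn_neqAle eq_sym [(_ <= _)%N]min_i //.
  by rewrite andbT; apply: contra ne_ji => /eqP/val_inj->.
by apply: IH; rewrite (leq_trans _ leSk) // (cardsD1 i S) Si.
Qed.

Lemma extsign1_lt i S : (forall j, j \in S -> (i < j)%N) ->
  extsign int [set i] S = 1.
Proof.
move=> min_i; rewrite /extsign disjoints1 (introN idP); last first.
  by move/min_i; rewrite ltnn.
rewrite /inversions big_set1 big1 // => j /min_i lt_ij.
by rewrite ltnNge ltnW.
Qed.

Lemma extsign1_gt i j S : (j < i)%N -> (forall l, l \in S -> (j < l)%N) ->
  extsign int [set i] (j |: S) = - extsign int [set i] S.
Proof.
move=> lt_ji min_j.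
have sji : extsign int [set j] [set i] = 1.
  by apply: extsign1_lt => l; rewrite inE => /eqP->.
have sij : extsign int [set i] [set j] = -1.
  rewrite /extsign disjoints1 !inE -val_eqE /= gtn_eqF //= /inversions !big_set1.
  by rewrite lt_ji.
have := extsignA int [set i] [set j] S; rewrite sij extsign1_lt // mul1r => <-.
have := extsignA int [set j] [set i] S; rewrite sji (setUC [set j]) mul1r => ->.
rewrite (@extsign1_lt j) ?mulr1 ?mulN1r // => l.
by rewrite !inE => /orP[/eqP->//|/min_j].
Qed.

End FiniteSets.

Section OrderedProducts.
Variables (p : nat) (E : nzRingType) (o : 'I_p -> E).
Hypothesis o_anti : forall i j, o i * o j = - (o j * o i).
Hypothesis o_sq : forall i, o i * o i = 0.
Implicit Types (i : 'I_p) (S T U : {set 'I_p}).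

Local Notation oprod S := (\prod_(i in S) o i).

Lemma oprod_enum S : oprod S = \prod_(i <- enum S) o i.
Proof. by rewrite -big_filter /index_enum unlock. Qed.

Lemma oprod_min i S : (forall j, j \in S -> (i < j)%N) ->
  oprod (i |: S) = o i * oprod S.
Proof. by move=> min_i; rewrite !oprod_enum enum_setU1_min // big_cons. Qed.

Lemma mul_oprod1 i S : o i * oprod S = oprod (i |: S) *~ extsign int [set i] S.
Proof.
elim/set_min_ind: S => [|j S min_j IH].
  by rewrite setU0 big_set0 extsign10 big_set1 mulr1.
have [lt_ij|lt_ji|/val_inj eij] := ltngtP i j.
- have min_i l : l \in j |: S -> (i < l)%N.
    by rewrite !inE => /orP[/eqP->//|/min_j]; apply: ltn_trans.
  by rewrite extsign1_lt // (oprod_min min_i).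
- rewrite (oprod_min min_j) mulrA o_anti mulNr -mulrA IH extsign1_gt //.
  rewrite setUCA [in RHS](@oprod_min j); last first.
    by move=> l; rewrite !inE => /orP[/eqP->//|/min_j].
  by rewrite mulrNz mulrzAr.
- rewrite (oprod_min min_j) mulrA -eij o_sq mul0r /extsign disjoints1.
  by rewrite !inE eqxx.
Qed.

(** Anticommuting elements of square zero have the structure constants of
    the exterior algebra, which is why evaluation at them is
    multiplicative. *)
Lemma mul_oprod T U :
  oprod T * oprod U = oprod (T :|: U) *~ extsign int T U.
Proof.
elim/set_min_ind: T => [|i T min_i IH].
  by rewrite big_set0 mul1r set0U extsign01.
rewrite (oprod_min min_i) -mulrA IH mulrzAr mul_oprod1 setUA.
by rewrite -mulrzA mulrC -extsignA extsign1_lt // mul1r.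
Qed.

End OrderedProducts.

(** The universal property of the exterior algebra over R, as data: each
    such record gives a ring morphism osubst from extalg R p to E. The
    action of G_ev, the embedding Psi, its retraction and evaluation at
    points are all obtained in this way. *)
Record odd_subst (R : comNzRingType) (p : nat) (E : nzRingType) := OddSubst {
  osub_coef : {rmorphism R -> E};
  osub_gen : 'I_p -> E;
  osub_anti : forall i j, osub_gen i * osub_gen j = - (osub_gen j * osub_gen i);
  osub_sq : forall i, osub_gen i * osub_gen i = 0;
  osub_comm : forall a i, osub_coef a * osub_gen i = osub_gen i * osub_coef a }.

Definition osubst R p E (s : @odd_subst R p E) (x : extalg R p) : E :=
  \sum_S osub_coef s (ecoef x S) * \prod_(i in S) osub_gen s i.

Section OddSubst.
Variables (R : comNzRingType) (p : nat) (E : nzRingType) (s : odd_subst R p E).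
Local Notation f := (osub_coef s).
Local Notation o := (osub_gen s).
Implicit Types (x y : extalg R p).

Lemma osub_comm_prod a (S : {set 'I_p}) :
  f a * \prod_(i in S) o i = (\prod_(i in S) o i) * f a.
Proof.
elim/big_ind: _ => [|u v Hu Hv|i _]; first by rewrite mulr1 mul1r.
  by rewrite mulrA Hu -mulrA Hv mulrA.
exact: osub_comm.
Qed.

Lemma osubst_zmod : zmod_morphism (osubst s).
Proof.
move=> x y; rewrite /osubst -sumrB; apply: eq_bigr => S _.
rewrite -mulrBl -rmorphB; congr (f _ * _).
by rewrite ecoefD; congr (_ + _); rewrite [LHS]ffunE.
Qed.

Lemma osub_sign (T U : {set 'I_p}) : f (extsign R T U) = (extsign int T U)%:~R.
Proof.
by rewrite /extsign; case: ifP => _; rewrite ?rmorph0 // !rmorph_sign.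
Qed.

Lemma osubst_monoid : monoid_morphism (osubst s).
Proof.
split=> [|x y].
  rewrite /osubst (bigD1 set0) //= [X in _ + X]big1 => [|S /negbTE nS].
    by rewrite big_set0 mulr1 [ecoef _ _]ecoefE eqxx rmorph1 addr0.
  by rewrite [ecoef _ _]ecoefE nS rmorph0 mul0r.
rewrite /osubst.
transitivity (\sum_S \sum_T \sum_U
   (f (ecoef x T) * \prod_(i in T) o i * (f (ecoef y U) * \prod_(i in U) o i))
     *+ (T :|: U == S)).
  apply: eq_bigr => S _; rewrite [ecoef _ _]ecoefM rmorph_sum mulr_suml.
  apply: eq_bigr => T _; rewrite rmorph_sum mulr_suml; apply: eq_bigr => U _.
  case: eqP => [<-|_]; last by rewrite !mulr0n rmorph0 mul0r.
  rewrite !mulr1n !rmorphM osub_sign -mulrA -[in RHS]mulrA.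
  rewrite [X in _ = _ * X]mulrA -osub_comm_prod -[X in _ = _ * X]mulrA.
  rewrite mul_oprod; [|exact: osub_anti|exact: osub_sq].
  by rewrite mulrzl !mulrzAr !mulrA.
rewrite exchange_big mulr_suml; apply: eq_bigr => T _ /=.
rewrite exchange_big mulr_sumr; apply: eq_bigr => U _ /=.
rewrite (bigD1 (T :|: U)) //= eqxx [X in _ + X]big1 ?addr0 // => S /negbTE.
by rewrite eq_sym => ->.
Qed.

HB.instance Definition _ :=
  GRing.isZmodMorphism.Build (extalg R p) E (osubst s) osubst_zmod.
HB.instance Definition _ :=
  GRing.isMonoidMorphism.Build (extalg R p) E (osubst s) osubst_monoid.

Lemma osubstC a : osubst s (extC p a) = f a.
Proof.
rewrite /osubst (bigD1 set0) //= [X in _ + X]big1 => [|S /negbTE nS].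
  by rewrite big_set0 mulr1 [ecoef _ _]ecoefE eqxx addr0.
by rewrite [ecoef _ _]ecoefE nS rmorph0 mul0r.
Qed.

Lemma osubstX i : osubst s (extX R i) = o i.
Proof.
rewrite /osubst (bigD1 [set i]) //= [X in _ + X]big1 => [|S /negbTE nS].
  by rewrite big_set1 [ecoef _ _]ecoefE eqxx rmorph1 mul1r addr0.
by rewrite [ecoef _ _]ecoefE nS rmorph0 mul0r.
Qed.

End OddSubst.

(** * Parity and supercommutativity *)

Section Parity.
Variables (R : comNzRingType) (p : nat).
Local Notation E := (extalg R p).
Implicit Types (x y : E) (a b : bool) (S T U : {set 'I_p}).

Definition has_parity a x := forall S, odd #|S| != a -> ecoef x S = 0.

(** Each pair of T * U is an inversion of (T, U) or of (U, T), but not of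
    both. *)
Lemma extsign_swap T U :
  extsign R T U = (-1) ^+ (odd #|T| && odd #|U|) * extsign R U T.
Proof.
rewrite /extsign disjoint_sym; case: ifP => [dUT|]; last by rewrite mulr0.
rewrite -oddM signr_odd.
have -> : (#|T| * #|U| = inversions T U + inversions U T)%N.
  rewrite /inversions [X in (_ + X)%N]exchange_big -big_split /=.
  rewrite -sum_nat_const; apply: eq_bigr => i Ti.
  rewrite -big_split -sum1_card; apply: eq_bigr => j Uj /=.
  case: ltngtP => // /val_inj eij.
  by have := disjointFr dUT Uj; rewrite eij Ti.
by rewrite exprD -mulrA -expr2 sqrr_sign mulr1.
Qed.

Lemma ecoefB x y S : ecoef (x - y) S = ecoef x S - ecoef y S.
Proof. by rewrite ecoefD; congr (_ + _); rewrite [LHS]ffunE. Qed.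

Lemma ecoefN x S : ecoef (- x) S = - ecoef x S.
Proof. by rewrite [LHS]ffunE. Qed.

Lemma ecoef_sum (I : Type) (r : seq I) (P : pred I) (F : I -> E) S :
  ecoef (\sum_(i <- r | P i) F i) S = \sum_(i <- r | P i) ecoef (F i) S.
Proof.
by elim/big_rec2: _ => [|i y x _ <-]; rewrite ?ecoef0 ?ecoefD.
Qed.

Lemma parity0 a : has_parity a 0. Proof. by move=> S _; rewrite ecoef0. Qed.

Lemma parityD a x y : has_parity a x -> has_parity a y -> has_parity a (x + y).
Proof. by move=> hx hy S hS; rewrite ecoefD hx // hy // addr0. Qed.

Lemma parityN a x : has_parity a x -> has_parity a (- x).
Proof. by move=> hx S hS; rewrite ecoefN hx // oppr0. Qed.

Lemma parity_sum a (I : Type) (r : seq I) (P : pred I) (F : I -> E) :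
  (forall i, P i -> has_parity a (F i)) -> has_parity a (\sum_(i <- r | P i) F i).
Proof.
by move=> h; elim/big_ind: _ => //; [exact: parity0|move=> x y; exact: parityD].
Qed.

Lemma parityC c : has_parity false (extC p c).
Proof.
move=> S hS; rewrite [ecoef _ _]ecoefE; case: (S =P set0) hS => [->|//].
by rewrite cards0.
Qed.

Lemma parityX i : has_parity true (extX R i).
Proof.
move=> S hS; rewrite [ecoef _ _]ecoefE; case: (S =P [set i]) hS => [->|//].
by rewrite cards1.
Qed.

Lemma parityM a b x y :
  has_parity a x -> has_parity b y -> has_parity (a (+) b) (x * y).
Proof.
move=> hx hy S hS; rewrite [ecoef _ _]ecoefM big1 // => T _; rewrite big1 // => U _.
case: eqP => // eS; rewrite mulr1n /extsign; case: ifP => dTU; last by rewrite mul0r.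
have [oT|/hx->] := eqVneq (odd #|T|) a; last by rewrite mul0r mulr0.
have [oU|/hy->] := eqVneq (odd #|U|) b; last by rewrite !mulr0.
case/eqP: hS; rewrite -eS cardsU (disjoint_setI0 dTU) cards0 subn0 oddD.
by rewrite oT oU.
Qed.

(** The sign rule of superalgebras, read off from extsign_swap on the
    homogeneous components. *)
Lemma parity_comm a b x y : has_parity a x -> has_parity b y ->
  x * y = (-1) ^+ (a && b) * (y * x).
Proof.
move=> hx hy; apply: ecoefP => S.
have -> : (-1) ^+ (a && b) * (y * x) = extC p ((-1) ^+ (a && b)) * (y * x) :> E.
  case: (a && b) => //; apply: ecoefP => S'.
  by rewrite [RHS]ecoef_extCM !expr1 mulN1r ecoefN mulN1r.
rewrite [RHS]ecoef_extCM !ecoefM exchange_big mulr_sumr.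
apply: eq_bigr => U _; rewrite mulr_sumr; apply: eq_bigr => T _ /=.
rewrite setUC mulrnAr; congr (_ *+ _).
have [oT|/hx->] := eqVneq (odd #|T|) a; last by rewrite !(mulr0, mul0r).
have [oU|/hy->] := eqVneq (odd #|U|) b; last by rewrite !(mulr0, mul0r).
by rewrite extsign_swap oT oU -mulrA (mulrC (ecoef x _)).
Qed.

Lemma even_comm b x y : has_parity false x -> has_parity b y -> x * y = y * x.
Proof. by move=> hx hy; rewrite (parity_comm hx hy) mul1r. Qed.

Lemma parity_split y :
  exists y0 y1, [/\ has_parity false y0, has_parity true y1 & y = y0 + y1].
Proof.
exists (ext_of (fun S => if odd #|S| then 0 else ecoef y S)).
exists (ext_of (fun S => if odd #|S| then ecoef y S else 0)); split.
- by move=> S; rewrite ecoefE; case: ifP.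
- by move=> S; rewrite ecoefE; case: ifP.
- by apply: ecoefP => S; rewrite ecoefD !ecoefE; case: ifP; rewrite ?addr0 ?add0r.
Qed.

(** Supercommutativity gives this for the even and the odd part of y. *)
Lemma even_central x y : has_parity false x -> x * y = y * x.
Proof.
move=> hx; have [y0 [y1 [h0 h1 ->]]] := parity_split y.
by rewrite mulrDr mulrDl (even_comm hx h0) (even_comm hx h1).
Qed.

Lemma odd_anti x y : has_parity true x -> has_parity true y -> x * y = - (y * x).
Proof. by move=> hx hy; rewrite (parity_comm hx hy) mulN1r. Qed.

(** The sign rule gives x * x = - (x * x), and 2 can be cancelled. *)
Lemma odd_sq x : (forall c : R, c + c = 0 -> c = 0) ->
  has_parity true x -> x * x = 0.
Proof.
move=> reg2 hx; apply: ecoefP => S; rewrite ecoef0; apply: reg2.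
by rewrite -ecoefD {2}(odd_anti hx hx) subrr ecoef0.
Qed.

End Parity.

(** * Initial minors and triangularization *)

Section InitialMinors.
Variable R : pzRingType.

(** The conventions of entry and minor, over any ring: minors can then be
    moved along the morphisms between K, the polynomial ring and the
    superalgebra. *)
Definition natent (r : nat) (M : 'M[R]_r) (a b : nat) : R :=
  if insub a is Some i then if insub b is Some j then M i j else 0 else 0.
Definition rminor (r : nat) (M : 'M[R]_r) (c : seq nat) : R :=
  \det (\matrix_(a < size c, b < size c) natent M a (nth 0%N c b)).
Definition leadmx (r : nat) (M : 'M[R]_r) (s : nat) : 'M[R]_s :=
  \matrix_(a < s, b < s) natent M a b.

Variable r : nat.
Implicit Types (A B : 'M[R]_r).

Lemma natentE A (i j : 'I_r) : natent A i j = A i j.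
Proof. by rewrite /natent !valK. Qed.

Lemma natent_ge1 A a b : (r <= a)%N -> natent A a b = 0.
Proof. by move=> le_ra; rewrite /natent insubF // ltnNge le_ra. Qed.

Lemma natent_ge2 A a b : (r <= b)%N -> natent A a b = 0.
Proof.
by move=> le_rb; rewrite /natent; case: insub => // i; rewrite insubF // ltnNge le_rb.
Qed.

Lemma natent_mul A B a b :
  natent (A *m B) a b = \sum_(l < r) natent A a l * natent B l b.
Proof.
have [lt_ar|le_ra] := ltnP a r; last first.
  by rewrite natent_ge1 // big1 // => l _; rewrite natent_ge1 // mul0r.
have [lt_br|le_rb] := ltnP b r; last first.
  by rewrite natent_ge2 // big1 // => l _; rewrite [X in _ * X]natent_ge2 // mulr0.
rewrite -[a]/(val (Ordinal lt_ar)) -[b]/(val (Ordinal lt_br)) natentE mxE.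
by apply: eq_bigr => l _; rewrite !natentE.
Qed.

Lemma rminorE A c s : size c = s ->
  rminor A c = \det (\matrix_(a < s, b < s) natent A a (nth 0%N c b)).
Proof. by move=> <-. Qed.

Lemma rminor_iota A s : rminor A (iota 0 s) = \det (leadmx A s).
Proof.
rewrite (rminorE _ (size_iota 0 s)); congr (\det _).
by apply/matrixP => a b; rewrite !mxE nth_iota.
Qed.

Lemma sum_trunc (F : nat -> R) s : (s <= r)%N ->
  (forall l : nat, (s <= l < r)%N -> F l = 0) -> \sum_(l < r) F l = \sum_(l < s) F l.
Proof.
move=> le_sr F0; rewrite [RHS](big_ord_widen _ _ le_sr) [LHS](bigID (fun l : 'I_r => (l < s)%N)) /=.
rewrite [X in _ + X]big1 ?addr0 // => l.
by rewrite -leqNgt => le_sl; rewrite F0 // le_sl ltn_ord.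
Qed.

End InitialMinors.

Lemma natent_map (R S : pzRingType) (f : {rmorphism R -> S}) r (A : 'M[R]_r) a b :
  natent (map_mx f A) a b = f (natent A a b).
Proof.
rewrite /natent; case: insub => [i|]; last by rewrite rmorph0.
by case: insub => [j|]; rewrite ?mxE ?rmorph0.
Qed.

Lemma rminor_map (R S : pzRingType) (f : {rmorphism R -> S}) r (A : 'M[R]_r) c :
  rminor (map_mx f A) c = f (rminor A c).
Proof.
rewrite /rminor -det_map_mx; congr (\det _).
by apply/matrixP => a b; rewrite !mxE natent_map.
Qed.

Section Triangular.
Variables (R : comPzRingType) (r : nat).
Implicit Types (A B g : 'M[R]_r).

Lemma rminor_nil A : rminor A [::] = 1.
Proof. exact: det_mx00. Qed.

Lemma trig_natent (b : 'M[R]_r) a c : is_trig_mx b -> (a < c)%N -> natent b a c = 0.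
Proof.
move=> /is_trig_mxP tb lt_ac.
have [lt_ar|le_ra] := ltnP a r; last by rewrite natent_ge1.
have [lt_cr|le_rc] := ltnP c r; last by rewrite natent_ge2.
by rewrite -[a]/(val (Ordinal lt_ar)) -[c]/(val (Ordinal lt_cr)) natentE tb.
Qed.

Lemma natent_tr A a c : natent A^T a c = natent A c a.
Proof.
have [lt_ar|le_ra] := ltnP a r; last by rewrite natent_ge1 // natent_ge2.
have [lt_cr|le_rc] := ltnP c r; last by rewrite natent_ge2 // natent_ge1.
by rewrite -[a]/(val (Ordinal lt_ar)) -[c]/(val (Ordinal lt_cr)) !natentE mxE.
Qed.

Lemma utrig_natent g a c : is_trig_mx g^T -> (c < a)%N -> natent g a c = 0.
Proof. by move=> tg lt_ca; rewrite -natent_tr (trig_natent tg). Qed.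

Lemma leadmx_upper A g s : is_trig_mx g^T -> (s <= r)%N ->
  leadmx (A *m g) s = leadmx A s *m leadmx g s.
Proof.
move=> tg le_sr; apply/matrixP => i j; rewrite !mxE natent_mul.
rewrite (sum_trunc (F := fun l => natent A i l * natent g l j) le_sr).
  by apply: eq_bigr => l _; rewrite !mxE.
move=> l /andP[le_sl _]; rewrite (utrig_natent tg) ?mulr0 //.
exact: leq_trans (ltn_ord j) le_sl.
Qed.

(** Row a of b *m A is a combination of the rows of A up to a, so the first
    rows of the product are those of A multiplied by a triangular block of
    b. *)
Lemma rminor_lower (b : 'M[R]_r) A c : is_trig_mx b -> (size c <= r)%N ->
  rminor (b *m A) c = (\prod_(a < size c) natent b a a) * rminor A c.
Proof.
move=> tb le_cr.
have -> : rminor (b *m A) c = \det (leadmx b (size c) *m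
    \matrix_(i, j) natent A i (nth 0%N c j)).
  congr (\det _); apply/matrixP => i j; rewrite !mxE natent_mul.
  rewrite (sum_trunc (F := fun l => natent b i l * natent A l (nth 0%N c j)) le_cr).
    by apply: eq_bigr => l _; rewrite !mxE.
  move=> l /andP[le_cl _]; rewrite (trig_natent tb) ?mul0r //.
  exact: leq_trans (ltn_ord i) le_cl.
rewrite det_mulmx det_trig; first by congr (_ * _); apply: eq_bigr => a _; rewrite mxE.
by apply/is_trig_mxP => i j lt_ij; rewrite mxE (trig_natent tb).
Qed.

Lemma det_leadmx_upper g s : is_trig_mx g^T ->
  \det (leadmx g s) = \prod_(l < s) natent g l l.
Proof.
move=> tg; rewrite -det_tr det_trig; first by apply: eq_bigr => l _; rewrite !mxE.
by apply/is_trig_mxP => i j lt_ij; rewrite !mxE (utrig_natent tg).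
Qed.

Lemma rminor_iota_upper A g s : is_trig_mx g^T -> (s <= r)%N ->
  rminor (A *m g) (iota 0 s) = rminor A (iota 0 s) * \prod_(l < s) natent g l l.
Proof.
move=> tg le_sr; rewrite !rminor_iota leadmx_upper // det_mulmx.
by rewrite (det_leadmx_upper _ tg).
Qed.

Lemma rminor_iota1 s : (s <= r)%N -> rminor (1%:M : 'M[R]_r) (iota 0 s) = 1.
Proof.
move=> le_sr; rewrite rminor_iota det_leadmx_upper; last first.
  by rewrite trmx1; apply/is_trig_mxP => i j lt_ij; rewrite mxE -val_eqE ltn_eqF.
apply: big1 => l _; have lt_lr := leq_trans (ltn_ord l) le_sr.
by rewrite -[nat_of_ord l]/(val (Ordinal lt_lr)) natentE mxE eqxx.
Qed.

(** Gaussian elimination without denominators: Nmx A is upper triangular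
    and is the product of a lower triangular matrix by A, while Wmx A is
    upper triangular and A *m Wmx A is lower triangular. Row i of Nmx and
    column j of Wmx carry the coefficients of rho_{i|j}. *)
Definition Nmx A : 'M[R]_r := \matrix_(i, c) rminor A (rcons (iota 0 i) c).
Definition Wmx A : 'M[R]_r := \matrix_(s, j)
  if (s <= j)%N then (-1) ^+ (s + j) * rminor A [seq t <- iota 0 j.+1 | t != s :> nat]
  else 0.

(** Laplace expansion along the last column: row i of Nmx is the last row
    of an adjugate times A, so multiplicativity of adjugates applies to it. *)
Lemma Nmx_adj A (i c : 'I_r) :
  Nmx A i c = \sum_(a < i.+1) (\adj (leadmx A i.+1)) ord_max a * natent A a c.
Proof.
rewrite mxE (@rminorE _ _ _ _ i.+1) ?size_rcons ?size_iota //.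
rewrite (expand_det_col _ ord_max); apply: eq_bigr => a _.
rewrite mxE nth_rcons size_iota /= ltnn eqxx mulrC; congr (_ * _).
rewrite mxE /cofactor; congr (_ * \det _).
apply/matrixP => x y; rewrite !mxE nth_rcons size_iota lift_max ltn_ord.
by rewrite nth_iota.
Qed.

Lemma filter_iota_neq s j : (s <= j)%N ->
  [seq t <- iota 0 j.+1 | t != s] = iota 0 s ++ iota s.+1 (j - s).
Proof.
move=> le_sj; have -> : j.+1 = (s + (1 + (j - s)))%N by rewrite addnCA subnKC.
rewrite !iotaD !filter_cat /= add0n eqxx /= addn1.
congr (_ ++ _); apply/all_filterP/allP => t; rewrite mem_iota.
  by rewrite add0n => /= lt_ts; rewrite ltn_eqF.
by case/andP => lt_st _; rewrite gtn_eqF.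
Qed.

Lemma nth_iota_neq (s j b : nat) : (s <= j)%N -> (b < j)%N ->
  nth 0%N [seq t <- iota 0 j.+1 | t != s] b = bump s b.
Proof.
move=> le_sj lt_bj; rewrite filter_iota_neq // nth_cat size_iota /bump.
case: ltnP => [lt_bs|le_sb]; first by rewrite nth_iota.
by rewrite nth_iota ?ltn_sub2r // ?(leq_ltn_trans le_sb) // addSn subnKC.
Qed.

(** The counterpart of Nmx_adj: column j of Wmx is the last column of the
    adjugate of the leading block of size j + 1. *)
Lemma Wmx_adj A (s j : 'I_r) (le_sj : (s < j.+1)%N) :
  Wmx A s j = (\adj (leadmx A j.+1)) (Ordinal le_sj) ord_max.
Proof.
rewrite !mxE -ltnS le_sj /cofactor addnC; congr (_ * _).
rewrite (@rminorE _ _ _ _ j); last first.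
  by rewrite filter_iota_neq // size_cat !size_iota subnKC.
congr (\det _); apply/matrixP => x y.
by rewrite !mxE nth_iota_neq // lift_max.
Qed.

Lemma Wmx_lower0 A (s j : 'I_r) : (j < s)%N -> Wmx A s j = 0.
Proof. by move=> lt_js; rewrite mxE leqNgt lt_js. Qed.

Lemma Wmx_diag A (j : 'I_r) : Wmx A j j = rminor A (iota 0 j).
Proof.
rewrite mxE leqnn addnn -signr_odd odd_double expr0 mul1r.
by rewrite filter_iota_neq // subnn cats0.
Qed.

Lemma iota_rcons i : rcons (iota 0 i) i = iota 0 i.+1.
Proof. by rewrite -cats1 -addn1 iotaD. Qed.

Lemma Nmx_diag A (i : 'I_r) : Nmx A i i = rminor A (iota 0 i.+1).
Proof. by rewrite mxE iota_rcons. Qed.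

(** The minor has column c twice. *)
Lemma Nmx_upper A (i c : 'I_r) : (c < i)%N -> Nmx A i c = 0.
Proof.
move=> lt_ci; rewrite mxE (@rminorE _ _ _ _ i.+1) ?size_rcons ?size_iota //.
rewrite -det_tr; apply: (@determinant_alternate _ _ _ (inord c) ord_max).
  by rewrite -val_eqE /= inordK ?ltn_eqF // ltnW.
move=> x; rewrite !mxE !nth_rcons size_iota /= inordK; last by rewrite ltnW.
by rewrite lt_ci ltnn eqxx nth_iota.
Qed.

Lemma Wmx_utrig A : is_trig_mx (Wmx A)^T.
Proof. by apply/is_trig_mxP => i j lt_ij; rewrite mxE Wmx_lower0. Qed.

(** For i < j, entry (i, j) is an off-diagonal entry of a leading block
    times its adjugate. *)
Lemma mul_Wmx_trig A : is_trig_mx (A *m Wmx A).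
Proof.
apply/is_trig_mxP => i j lt_ij; rewrite mxE.
have := mul_mx_adj (leadmx A j.+1) => /matrixP/(_ (inord i) ord_max).
rewrite [in RHS]mxE -val_eqE /= inordK ?ltnS 1?ltnW // ltn_eqF // mulr0n => adj0.
rewrite mxE in adj0; rewrite -[RHS]adj0 {adj0}.
pose F l := natent A i l * natent (Wmx A) l j.
transitivity (\sum_(l < r) F l); first by apply: eq_bigr => l _; rewrite /F !natentE.
rewrite (sum_trunc (s := j.+1)) //; last first.
  by move=> l /andP[le_jl _]; rewrite /F (utrig_natent (Wmx_utrig A)) ?mulr0.
apply: eq_bigr => l _; rewrite /F mxE inordK ?ltnS 1?ltnW //; congr (_ * _).
have lt_lr : (l < r)%N := leq_trans (ltn_ord l) (ltn_ord j).
rewrite -[nat_of_ord l]/(val (Ordinal lt_lr)) natentE (@Wmx_adj _ (Ordinal lt_lr) _ (ltn_ord l)).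
by congr (_ _ _); apply: val_inj.
Qed.

Lemma Nmx1 : Nmx 1%:M = 1%:M.
Proof.
apply/matrixP => i c; rewrite [RHS]mxE -val_eqE /=.
case: (ltngtP i c) => [lt_ic|lt_ci|/val_inj<-]; last 2 first.
- by rewrite Nmx_upper.
- by rewrite Nmx_diag rminor_iota1.
rewrite Nmx_adj big1 // => a _.
have lt_ar : (a < r)%N := leq_trans (ltn_ord a) (ltn_ord i).
rewrite -[nat_of_ord a]/(val (Ordinal lt_ar)) natentE [X in _ * X]mxE -val_eqE /=.
by rewrite ltn_eqF ?mulr0 // (leq_ltn_trans _ lt_ic) // -ltnS.
Qed.

Lemma Wmx1 : Wmx 1%:M = 1%:M.
Proof.
apply/matrixP => s j; rewrite [RHS]mxE -val_eqE /=.
case: (ltngtP s j) => [lt_sj|lt_js|/val_inj<-].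
- by have /is_trig_mxP := mul_Wmx_trig 1%:M; rewrite mul1mx; apply.
- by rewrite Wmx_lower0.
- by rewrite Wmx_diag rminor_iota1 // ltnW.
Qed.

End Triangular.

Lemma Nmx_map (R S : comPzRingType) (f : {rmorphism R -> S}) r (A : 'M[R]_r) :
  Nmx (map_mx f A) = map_mx f (Nmx A).
Proof. by apply/matrixP => i j; rewrite !mxE rminor_map. Qed.

Lemma Wmx_map (R S : comPzRingType) (f : {rmorphism R -> S}) r (A : 'M[R]_r) :
  Wmx (map_mx f A) = map_mx f (Wmx A).
Proof.
apply/matrixP => i j; rewrite !mxE rminor_map.
by case: ifP => _; rewrite ?rmorph0 // rmorphM /= rmorph_sign.
Qed.

Section Translation.
Variables (R : idomainType) (r : nat).
Implicit Types (A B g : 'M[R]_r).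

Lemma scalar_mulmx_inj s (d : R) (A B : 'M[R]_s) : d != 0 ->
  d%:M *m A = d%:M *m B -> A = B.
Proof.
move=> d0; rewrite !mul_scalar_mx => /matrixP eAB; apply/matrixP => i j.
by apply: (mulfI d0); have := eAB i j; rewrite !mxE.
Qed.

(** Multiplying by adj A *m A, which is the regular scalar det A, completes
    adj (A B) to the product with A B. *)
Lemma mul_adj_mulmx s (A B : 'M[R]_s) : \det A != 0 ->
  B *m \adj (A *m B) = (\det B)%:M *m \adj A.
Proof.
move=> dA; apply: (scalar_mulmx_inj dA).
rewrite -[in LHS]mul_adj_mx -!mulmxA (mulmxA A B) mul_mx_adj det_mulmx.
by rewrite scalar_mxM mulmxA !mul_mx_scalar !mul_scalar_mx scalerA mulrC -scalerA scalerA mulrC.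
Qed.

Lemma adj_mulmx_mul s (A B : 'M[R]_s) : \det B != 0 ->
  \adj (A *m B) *m A = (\det A)%:M *m \adj B.
Proof.
move=> dB; apply: trmx_inj; rewrite !trmx_mul tr_scalar_mx !trmx_adj trmx_mul.
have dBt : \det B^T != 0 by rewrite det_tr.
by rewrite (mul_adj_mulmx _ dBt) det_tr scalar_mxC.
Qed.

(** Equivariance of W: for upper triangular g the leading blocks of A *m g
    are the products of leading blocks, and mul_adj_mulmx applies to them. *)
Lemma Wmx_mul_upper A g (s j : 'I_r) : is_trig_mx g^T ->
  rminor A (iota 0 j.+1) != 0 ->
  (g *m Wmx (A *m g)) s j = (\prod_(l < j.+1) natent g l l) * Wmx A s j.
Proof.
move=> tg; rewrite rminor_iota => dA.
have [lt_js|le_sj] := ltnP j s.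
  rewrite (Wmx_lower0 A lt_js) mulr0 mxE big1 // => l _.
  have [lt_jl|le_lj] := ltnP j l; first by rewrite Wmx_lower0 // mulr0.
  by rewrite -natentE (utrig_natent tg) ?mul0r // (leq_ltn_trans le_lj).
have lt_sj : (s < j.+1)%N by [].
rewrite (Wmx_adj A lt_sj) -det_leadmx_upper //.
have := mul_adj_mulmx (leadmx g j.+1) dA.
rewrite -leadmx_upper // => /matrixP/(_ (Ordinal lt_sj) ord_max).
rewrite mul_scalar_mx [RHS]mxE => <-; rewrite !mxE.
pose F l := natent g s l * natent (Wmx (A *m g)) l j.
transitivity (\sum_(l < r) F l); first by apply: eq_bigr => l _; rewrite /F !natentE.
rewrite (sum_trunc (s := j.+1)) //; last first.
  by move=> l /andP[le_jl _]; rewrite /F (utrig_natent (Wmx_utrig _)) ?mulr0.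
apply: eq_bigr => l _; rewrite /F mxE; congr (_ * _).
have lt_lr : (l < r)%N := leq_trans (ltn_ord l) (ltn_ord j).
rewrite -[nat_of_ord l]/(val (Ordinal lt_lr))
  natentE (@Wmx_adj _ _ _ (Ordinal lt_lr) _ (ltn_ord l)).
by congr (_ _ _); apply: val_inj.
Qed.

(** The last row of the adjugate of an upper triangular matrix has a single
    nonzero entry, the product of the other diagonal entries. *)
Lemma adj_utrig_last g (i : 'I_r) (b : 'I_i.+1) : is_trig_mx g^T ->
  \adj (leadmx g i.+1) ord_max b = (\prod_(l < i) natent g l l) *+ (b == ord_max).
Proof.
move=> tg; rewrite mxE /cofactor.
have -> : row' b (col' ord_max (leadmx g i.+1)) =
   (\matrix_(x, y) natent g (bump b x) y : 'M[R]_i).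
  by apply/matrixP => x y; rewrite !mxE lift_max.
have [->|ne_b] := eqVneq b ord_max.
  rewrite addnn -signr_odd odd_double expr0 mul1r mulr1n -det_tr det_trig.
    by apply: eq_bigr => l _; rewrite !mxE /= /bump leqNgt ltn_ord.
  apply/is_trig_mxP => x y lt_xy; rewrite !mxE /= /bump leqNgt ltn_ord.
  by rewrite (utrig_natent tg).
rewrite mulr0n; apply/eqP; rewrite mulf_eq0 signr_eq0 /=; apply/eqP.
have lt_bi : (b < i)%N.
  by rewrite ltn_neqAle -ltnS ltn_ord andbT; apply: contra ne_b => /eqP e; apply/eqP/val_inj.
rewrite -det_tr det_trig.
  rewrite (bigD1 (Ordinal lt_bi)) //= !mxE /= /bump leqnn.
  by rewrite (utrig_natent tg) ?mul0r // add1n.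
apply/is_trig_mxP => x y lt_xy; rewrite !mxE (utrig_natent tg) //.
by apply: leq_trans lt_xy _; apply: leq_addl.
Qed.

(** Equivariance of N. The last row of adj (A g) is the last row of adj g
    times adj A, and adj_utrig_last reduces it to one term. *)
Lemma Nmx_mul_upper A g (i c : 'I_r) : is_trig_mx g^T ->
  rminor A (iota 0 i.+1) != 0 -> \prod_(l < i.+1) natent g l l != 0 ->
  Nmx (A *m g) i c = (\prod_(l < i) natent g l l) * (Nmx A *m g) i c.
Proof.
move=> tg; rewrite rminor_iota => dA dg; set P := \prod_(l < i) _.
have adjE (a : 'I_i.+1) : \adj (leadmx (A *m g) i.+1) ord_max a
    = P * \adj (leadmx A i.+1) ord_max a.
  have [dAg] : \det (leadmx g i.+1) != 0 by rewrite det_leadmx_upper.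
  have adjM : \adj (leadmx (A *m g) i.+1) =
      \adj (leadmx g i.+1) *m \adj (leadmx A i.+1).
    apply: (scalar_mulmx_inj dA).
    rewrite mulmxA -(adj_mulmx_mul _ dAg) -mulmxA mul_mx_adj -leadmx_upper //.
    by rewrite scalar_mxC.
  rewrite adjM.
  rewrite mxE (bigD1 ord_max) //= adj_utrig_last // eqxx mulr1n [X in _ + X]big1 ?addr0 // => b.
  by move/negbTE => nb; rewrite adj_utrig_last // nb mulr0n mul0r.
rewrite Nmx_adj mxE mulr_sumr.
under eq_bigr do rewrite adjE natent_mul mulr_sumr.
rewrite exchange_big; apply: eq_bigr => l _ /=.
rewrite Nmx_adj mulr_suml mulr_sumr; apply: eq_bigr => a _.
by rewrite !natentE !mulrA.
Qed.

End Translation.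

(** * Polynomials over an infinite field *)

Lemma mpoly_rmorph_eq (n : nat) (R : comNzRingType) (S : nzRingType)
    (f g : {rmorphism {mpoly R[n]} -> S}) :
  (forall c, f (mpolyC n c) = g (mpolyC n c)) ->
  (forall i, f 'X_i = g 'X_i) -> f =1 g.
Proof.
move=> fgC fgX; elim/mpolyind => [|c m p _ _ IH]; first by rewrite !rmorph0.
rewrite !rmorphD IH -mul_mpolyC !rmorphM fgC mpolyXE_id !rmorph_prod.
by congr (_ * _ + _); apply: eq_bigr => i _; rewrite !rmorphXn fgX.
Qed.

Section CharZero.
Variable K : fieldType.
Hypothesis char0 : [pchar K] =i pred0.

Lemma natr_eq0_char0 k : (k%:R == 0 :> K) = (k == 0)%N.
Proof. by move/pcharf0P: char0 => ->. Qed.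

Lemma natr_inj_char0 : injective (fun k : nat => k%:R : K).
Proof.
have le_inj k l : (k <= l)%N -> k%:R = l%:R :> K -> k = l.
  move=> le_kl /esym/eqP; rewrite -subr_eq0 -natrB // natr_eq0_char0 subn_eq0.
  by move=> le_lk; apply/eqP; rewrite eqn_leq le_kl.
move=> k l; case/orP: (leq_total k l) => [|le_lk e]; first exact: le_inj.
by apply/esym; apply: le_inj.
Qed.

Lemma poly_eval0 (P : {poly K}) : (forall x, P.[x] = 0) -> P = 0.
Proof.
move=> P0; apply/eqP; apply: contraT => nzP.
have : (size [seq k%:R : K | k <- iota 0 (size P)] < size P)%N.
  apply: max_poly_roots => //; first by apply/allP => x _; apply/eqP/P0.
  by rewrite map_inj_uniq ?iota_uniq //; apply: natr_inj_char0.
by rewrite size_map size_iota ltnn.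
Qed.

(** Induction on the number of variables: the coefficients in the last one
    vanish at all points because a polynomial in one variable has finitely
    many roots, whereas K contains all natural numbers. *)
Lemma mpoly_eval0 n (p : {mpoly K[n]}) :
  (forall v : 'I_n -> K, p.@[v] = 0) -> p = 0.
Proof.
elim: n p => [|n IH] p p0.
  have := p0 (fun _ => 0); rewrite mevalE => s0.
  apply/mpolyP => m; rewrite mcoeff0.
  case: (boolP (m \in msupp p)) => [mp|]; last by rewrite mcoeff_msupp negbK => /eqP.
  have all_m (m' : 'X_{1..0}) : m' = m by apply/mnmP; case.
  move: s0; rewrite (bigD1_seq m) ?msupp_uniq //= big_ord0 mulr1.
  by rewrite big1 ?addr0 // => m'; rewrite (all_m m') eqxx.
have coef0 k : (muni p)`_k = 0.
  apply: IH => v; rewrite -coef_map; set P := map_poly _ _.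
  have -> : P = 0; last by rewrite coef0.
  apply: poly_eval0 => x.
  rewrite -(p0 (fun i => if unlift ord_max i is Some j then v j else x)).
  rewrite /P muniE rmorph_sum horner_sum mevalE; apply: eq_bigr => m _.
  rewrite -!mul_polyC !rmorphM /= map_polyXn !map_polyC /= mevalZ mevalX.
  rewrite !hornerE -mulrA; congr (_ * _).
  rewrite big_ord_recr /= unlift_none; congr (_ * _); apply: eq_bigr => i _.
  rewrite mnmE; congr (_ ^+ _).
  have -> : widen_ord (leqnSn n) i = lift ord_max i.
    by apply/val_inj/esym/lift_max.
  by rewrite liftK.
apply/mpolyP => m0; rewrite mcoeff0.
case: (boolP (m0 \in msupp p)) => [mp|]; last by rewrite mcoeff_msupp negbK => /eqP.
have := coef0 (m0 ord_max).
move/(congr1 (fun q => q@_[multinom m0 (widen_ord (leqnSn n) i) | i < n])).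
rewrite mcoeff0 muniE coef_sum raddf_sum (bigD1_seq m0) ?msupp_uniq //=.
rewrite coefZ coefXn eqxx mulr1 mcoeffZ mcoeffX eqxx mulr1 big1 ?addr0 // => m ne_m.
rewrite coefZ coefXn; case: eqP => [emax|_]; last by rewrite mulr0 mcoeff0.
rewrite mulr1 mcoeffZ mcoeffX; case: eqP => [eres|_]; last by rewrite mulr0.
case/eqP: ne_m; apply/mnmP => i; case: (unliftP ord_max i) => [j ->|-> //].
have := congr1 (fun q : 'X_{1..n} => q j) eres; rewrite !mnmE.
have -> : widen_ord (leqnSn n) j = lift ord_max j by apply/val_inj/esym/lift_max.
by [].
Qed.

End CharZero.

(** * Exterior algebras as free objects *)

Section ExteriorGeneration.
Variables (R : comNzRingType) (p : nat).
Local Notation E := (extalg R p).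

Lemma extC_zmod : zmod_morphism (@extC R p).
Proof.
move=> a b; apply: ecoefP => S; rewrite ecoefB !ecoefE.
by rewrite mulrnBl.
Qed.

Lemma extC_monoid : monoid_morphism (@extC R p).
Proof.
by split=> // a b; apply: ecoefP => S; rewrite [RHS]ecoef_extCM !ecoefE mulrnAr.
Qed.

(** The inclusion of coefficients as a ring morphism over every commutative
    ring, such as a polynomial ring, where elements need not have inverses. *)
Definition extCr (a : R) : E := extC p a.
HB.instance Definition _ := GRing.isZmodMorphism.Build R E extCr extC_zmod.
HB.instance Definition _ := GRing.isMonoidMorphism.Build R E extCr extC_monoid.

Lemma extX_anti i j : extX R i * extX R j = - (extX R j * extX R i) :> E.
Proof. by apply: odd_anti; apply: parityX. Qed.

Lemma extX_sq i : extX R i * extX R i = 0 :> E.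
Proof.
apply: ecoefP => S; rewrite [LHS]ecoefM ecoef0 big1 // => T _; rewrite big1 // => U _.
rewrite ![ecoef (extX _ _) _]ecoefE /extsign.
case: (T =P [set i]) => [->|_]; last by rewrite mul0r mulr0 mul0rn.
case: (U =P [set i]) => [->|_]; last by rewrite !mulr0 mul0rn.
by rewrite disjoints1 !inE eqxx mul0r mul0rn.
Qed.

Lemma extC_commE a (x : E) : extCr a * x = x * extCr a.
Proof. by apply: even_central; apply: parityC. Qed.

(** Increasing products of generators are the standard basis, without
    signs. *)
Lemma prod_extX (S : {set 'I_p}) :
  \prod_(i in S) extX R i = ext_of (fun T => (T == S)%:R) :> E.
Proof.
elim/set_min_ind: S => [|i S min_i IH].
  by rewrite big_set0; apply: ecoefP => T; rewrite [LHS]ecoefE [RHS]ecoefE.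
have niS : i \notin S by apply/negP => /min_i; rewrite ltnn.
rewrite (oprod_min _ min_i) IH; apply: ecoefP => T.
rewrite [LHS]ecoefM ecoefE (bigD1 [set i]) //= [X in _ + X]big1 ?addr0; last first.
  move=> U /negbTE nU; rewrite big1 // => V _.
  by rewrite [ecoef (extX _ _) _]ecoefE nU mul0r mulr0 mul0rn.
rewrite (bigD1 S) //= [X in _ + X]big1 ?addr0; last first.
  by move=> V /negbTE nV; rewrite [ecoef (ext_of _) _]ecoefE nV !mulr0 mul0rn.
rewrite !ecoefE !eqxx !mulr1 eq_sym.
have -> : extsign R [set i] S = (extsign int [set i] S)%:~R.
  by rewrite /extsign; case: ifP => _; rewrite ?rmorph0 // rmorph_sign.
by rewrite extsign1_lt.
Qed.

Lemma ext_expand (x : E) :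
  x = \sum_S extCr (ecoef x S) * \prod_(i in S) extX R i.
Proof.
apply: ecoefP => T; rewrite ecoef_sum (bigD1 T) //= [X in _ + X]big1 ?addr0.
  by rewrite [RHS]ecoef_extCM prod_extX ecoefE eqxx mulr1.
move=> S nS; rewrite [LHS]ecoef_extCM prod_extX ecoefE eq_sym.
by rewrite (negbTE nS) mulr0.
Qed.

Lemma ext_rmorph_eq (S : nzRingType) (f g : {rmorphism E -> S}) :
  (forall a, f (extC p a) = g (extC p a)) ->
  (forall i, f (extX R i) = g (extX R i)) -> f =1 g.
Proof.
move=> fgC fgX x; rewrite [x]ext_expand !rmorph_sum; apply: eq_bigr => T _.
rewrite !rmorphM fgC !rmorph_prod; congr (_ * _); apply: eq_bigr => i _.
exact: fgX.
Qed.

End ExteriorGeneration.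

Section ParitySubst.
Variables (R R' : comNzRingType) (p p' : nat).
Hypothesis reg2 : forall c : R', c + c = 0 -> c = 0.
Variables (f : {rmorphism R -> extalg R' p'}) (o : 'I_p -> extalg R' p').
Hypothesis f_even : forall a, has_parity false (f a).
Hypothesis o_odd : forall i, has_parity true (o i).

Definition parity_subst : odd_subst R p (extalg R' p') :=
  OddSubst (osub_coef := f) (fun i j => odd_anti (o_odd i) (o_odd j))
    (fun i => odd_sq reg2 (o_odd i)) (fun a i => even_central (o i) (f_even a)).

End ParitySubst.

Section CoefMap.
Variables (R R' : comNzRingType) (p : nat) (f : {rmorphism R -> R'}).

Lemma coefmap_comm a i :
  (@extCr R' p \o f) a * extX R' i = extX R' i * (@extCr R' p \o f) a.
Proof. exact: extC_commE. Qed.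

Definition coefmap_subst : odd_subst R p (extalg R' p) :=
  OddSubst (osub_coef := @extCr R' p \o f) (@extX_anti R' p) (@extX_sq R' p)
    coefmap_comm.

Fact coefmap_sig : {h : {rmorphism extalg R p -> extalg R' p} |
  [/\ forall x S, ecoef (h x) S = f (ecoef x S),
      forall a, h (extC p a) = extC p (f a) & forall i, h (extX R i) = extX R' i]}.
Proof.
exists (osubst coefmap_subst); split=> [x S|a|i]; last 2 first.
- exact: osubstC.
- exact: osubstX.
rewrite /= /osubst ecoef_sum (bigD1 S) //=.
rewrite [X in _ + X]big1 ?addr0 => [|T nT].
  by rewrite [LHS]ecoef_extCM prod_extX ecoefE eqxx mulr1.
by rewrite [LHS]ecoef_extCM prod_extX ecoefE eq_sym (negbTE nT) mulr0.
Qed.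

(** The base change of the exterior algebra along f. *)
Definition coefmap : {rmorphism extalg R p -> extalg R' p} := sval coefmap_sig.

Lemma ecoef_coefmap x S : ecoef (coefmap x) S = f (ecoef x S).
Proof. by case: (svalP coefmap_sig). Qed.

Lemma coefmapC a : coefmap (extC p a) = extC p (f a).
Proof. by case: (svalP coefmap_sig). Qed.

Lemma coefmapX i : coefmap (extX R i) = extX R' i.
Proof. by case: (svalP coefmap_sig). Qed.

End CoefMap.

Section GenericOdd.
Variables (m n : nat).

(** Free odd variables in the place of Y. *)
Definition Theta (R : comNzRingType) : 'M[extalg R (m * n)]_(m, n) :=
  \matrix_(i, j) extX R (mxvec_index i j).

Variable R : comNzRingType.
Local Notation L := (extalg R (m * n)).

Lemma ThetaE i j : Theta R i j = extX R (mxvec_index i j).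
Proof. by rewrite mxE. Qed.

Local Notation CM := (map_mx (@extCr R (m * n))).

Lemma map_Theta (S : pzRingType) (f : {rmorphism L -> S}) i j :
  map_mx f (Theta R) i j = f (extX R (mxvec_index i j)).
Proof. by rewrite !mxE. Qed.

Lemma odd_linear (A : 'M[R]_m) (B : 'M[R]_n) i j :
  has_parity true ((CM A *m Theta R *m CM B) i j).
Proof.
rewrite mxE; apply: parity_sum => l _.
rewrite -[true]/(true (+) false); apply: parityM; last first.
  by rewrite mxE; apply: parityC.
rewrite mxE; apply: parity_sum => k _.
rewrite -[true]/(false (+) true) !mxE; apply: parityM; first exact: parityC.
exact: parityX.
Qed.

End GenericOdd.

(** * The generic matrices X11, X22 and their ring *)

Section Rings.
Variables (K : fieldType) (m n : nat).
Hypothesis char0 : [pchar K] =i pred0.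

Local Notation Pev := {mpoly K[m * m + n * n]}.
Local Notation F := {fraction Pev}.
Local Notation QG := (QG K m n).
Local Notation L R := (extalg R (m * n)).
Local Notation X11 := (X11 K m n).
Local Notation X22 := (X22 K m n).
Local Notation C11 := (C11 K m n).
Local Notation C12 := (C12 K m n).
Local Notation C21 := (C21 K m n).
Local Notation C22 := (C22 K m n).
Local Notation Ymx := (Ymx K m n).
Local Notation phiC := (phiC K m n).
Local Notation KP := (@mpolyC (m * m + n * n) K).

(** Cancelling 2, here and in the next two rings, turns anticommutation of
    odd elements with themselves into x * x = 0. *)
Lemma regK (c : K) : c + c = 0 -> c = 0.
Proof.
move/eqP; rewrite -mulr2n -mulr_natl mulf_eq0 (natr_eq0_char0 char0) /=.
by move/eqP.
Qed.

Lemma regP (c : Pev) : c + c = 0 -> c = 0.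
Proof.
move/eqP; rewrite -mulr2n -mulr_natl mulf_eq0 => /orP[|/eqP//].
by rewrite -(rmorph_nat KP) mpolyC_eq0 (natr_eq0_char0 char0).
Qed.

Lemma regF (c : F) : c + c = 0 -> c = 0.
Proof.
move/eqP; rewrite -mulr2n -mulr_natl mulf_eq0 => /orP[|/eqP//].
rewrite -(rmorph_nat (@FracField.tofrac Pev)) tofrac_eq0.
by rewrite -(rmorph_nat KP) mpolyC_eq0 (natr_eq0_char0 char0).
Qed.

Lemma Pev_gen_ind (P : 'I_(m * m + n * n) -> Prop) :
  (forall i j, P (lshift _ (mxvec_index i j))) ->
  (forall i j, P (rshift _ (mxvec_index i j))) -> forall i, P i.
Proof.
move=> P1 P2 i; rewrite -(splitK i).
by case: (split i) => k; case/mxvec_indexP: k.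
Qed.

Lemma Pev_rmorph_eq (S : nzRingType) (f g : {rmorphism Pev -> S}) :
  (forall c, f (KP c) = g (KP c)) ->
  map_mx f X11 = map_mx g X11 -> map_mx f X22 = map_mx g X22 -> f =1 g.
Proof.
move=> fgC /matrixP fg1 /matrixP fg2; apply: mpoly_rmorph_eq => // i.
elim/Pev_gen_ind: i => i j; [have := fg1 i j | have := fg2 i j];
by rewrite !mxE.
Qed.

Lemma Pev_rmorph_eq_entries (S : nzRingType) (f g : {rmorphism Pev -> S}) :
  (forall c, f (KP c) = g (KP c)) ->
  (forall i j, f (X11 i j) = g (X11 i j)) ->
  (forall i j, f (X22 i j) = g (X22 i j)) -> f =1 g.
Proof.
move=> fgC fg1 fg2; apply: Pev_rmorph_eq => //; apply/matrixP => i j.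
  by rewrite [LHS]mxE [RHS]mxE; apply: fg1.
by rewrite [LHS]mxE [RHS]mxE; apply: fg2.
Qed.

Lemma LPev_rmorph_eq (S : nzRingType) (f g : {rmorphism L Pev -> S}) :
  (forall c, f (extC _ (KP c)) = g (extC _ (KP c))) ->
  (forall i j, f (extC _ (X11 i j)) = g (extC _ (X11 i j))) ->
  (forall i j, f (extC _ (X22 i j)) = g (extC _ (X22 i j))) ->
  (forall i j, f (Theta m n Pev i j) = g (Theta m n Pev i j)) -> f =1 g.
Proof.
move=> fgC fg1 fg2 fgT; apply: ext_rmorph_eq => [a|k].
  exact: (@Pev_rmorph_eq_entries _ (f \o @extCr Pev _) (g \o @extCr Pev _)).
by case/mxvec_indexP: k => i j; rewrite -ThetaE.
Qed.

(** * Evaluation at K-points *)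

Definition evP (A : 'M[K]_m) (B : 'M[K]_n) : Pev -> K :=
  meval (fun i => row_mx (mxvec A) (mxvec B) 0 i).

HB.instance Definition _ A B := GRing.RMorphism.on (evP A B).

Lemma evP_C A B c : evP A B (KP c) = c.
Proof. exact: mevalC. Qed.

Lemma evP_X11 A B : map_mx (evP A B) X11 = A.
Proof. by apply/matrixP => i j; rewrite !mxE /evP mevalXU row_mxEl mxvecE. Qed.

Lemma evP_X22 A B : map_mx (evP A B) X22 = B.
Proof. by apply/matrixP => i j; rewrite !mxE /evP mevalXU row_mxEr mxvecE. Qed.

(** K-points are dense in the space of pairs of matrices. *)
Lemma evP_eq0 p : (forall A B, evP A B p = 0) -> p = 0.
Proof.
move=> p0; apply: (mpoly_eval0 char0) => v.
pose A : 'M[K]_m := \matrix_(i, j) v (lshift _ (mxvec_index i j)).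
pose B : 'M[K]_n := \matrix_(i, j) v (rshift _ (mxvec_index i j)).
rewrite -(p0 A B); apply: meval_eq => i; elim/Pev_gen_ind: i => i j.
  by rewrite row_mxEl mxvecE mxE.
by rewrite row_mxEr mxvecE mxE.
Qed.

Lemma lead_X11_neq0 s : (s <= m)%N -> rminor X11 (iota 0 s) != 0.
Proof.
move=> le_sm; apply/eqP => /(congr1 (evP 1%:M 1%:M)).
by rewrite -rminor_map evP_X11 rminor_iota1 // rmorph0 => /eqP; rewrite oner_eq0.
Qed.

Lemma lead_X22_neq0 s : (s <= n)%N -> rminor X22 (iota 0 s) != 0.
Proof.
move=> le_sn; apply/eqP => /(congr1 (evP 1%:M 1%:M)).
by rewrite -rminor_map evP_X22 rminor_iota1 // rmorph0 => /eqP; rewrite oner_eq0.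
Qed.

Lemma det_X11_neq0 : \det X11 != 0.
Proof.
apply/eqP => /(congr1 (evP 1%:M 1%:M)).
by rewrite -det_map_mx evP_X11 det1 rmorph0 => /eqP; rewrite oner_eq0.
Qed.

Definition ev (A : 'M[K]_m) (B : 'M[K]_n) : {rmorphism L Pev -> L K} :=
  coefmap (m * n) (evP A B).

(** * The fraction field and the coordinates Y *)

Local Notation tf := (@FracField.tofrac Pev).
Definition X11F : 'M[F]_m := map_mx tf X11.
Definition X22F : 'M[F]_n := map_mx tf X22.
Local Notation exC := (@extC F (m * n + n * m)).

Lemma X11F_unit : X11F \in unitmx.
Proof. by rewrite unitmxE /X11F det_map_mx unitfE tofrac_eq0 det_X11_neq0. Qed.

Lemma C11E : C11 = map_mx exC X11F :> 'M[QG]_m.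
Proof. by apply/matrixP => i j; rewrite !mxE. Qed.

Lemma C22E : C22 = map_mx exC X22F :> 'M[QG]_n.
Proof. by apply/matrixP => i j; rewrite !mxE. Qed.

(** Cramer's rule: Y is C11^-1 C12. *)
Lemma YmxE : Ymx = (map_mx exC (invmx X11F) : 'M[QG]_m) *m C12.
Proof.
apply/matrixP => i j; rewrite mxE mulr_sumr [RHS]mxE.
have detC : \det C11 = exC (\det X11F) :> QG by rewrite C11E det_map_mx.
have adjC a : (\adj C11) i a = exC ((\adj X11F) i a) :> QG.
  by rewrite C11E -map_mx_adj mxE.
rewrite detC -(rmorphV exC); last by have := X11F_unit; rewrite unitmxE.
apply: eq_bigr => a _; rewrite adjC mulrA -(rmorphM exC) /= [X in _ = X * _]mxE; congr (exC _ * _).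
by rewrite /invmx X11F_unit [RHS]mxE.
Qed.

Lemma C11_Ymx : C11 *m Ymx = C12.
Proof.
rewrite YmxE mulmxA C11E -(map_mxM exC) mulmxV ?X11F_unit //.
by rewrite (map_mx1 exC) mul1mx.
Qed.

Lemma Ymx_odd i j : has_parity true (Ymx i j).
Proof.
rewrite YmxE mxE; apply: parity_sum => a _.
rewrite -[true]/(false (+) true) !mxE; apply: parityM; first exact: parityC.
exact: parityX.
Qed.

Lemma C21_odd i j : has_parity true (C21 i j).
Proof. by rewrite mxE; apply: parityX. Qed.

Lemma phiC_even i j : has_parity false (phiC i j).
Proof.
rewrite mxE; apply: parityD; first by rewrite C22E mxE; apply: parityC.
apply: parityN; apply: parity_sum => a _.
rewrite -[false]/(true (+) true); apply: parityM; [exact: C21_odd|exact: Ymx_odd].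
Qed.

Lemma C11_even i j : has_parity false (C11 i j).
Proof. by rewrite C11E mxE; apply: parityC. Qed.

Lemma phiCE : phiC = C22 - C21 *m Ymx.
Proof. by apply/matrixP => i j; rewrite !mxE. Qed.

(** * The substitution phi *)

(** The entries of phi(C22) are even, hence central, so they can be
    substituted for the commuting variables X22. *)
Definition iota_img (i : 'I_(m * m + n * n)) : QG :=
  row_mx (mxvec C11) (mxvec phiC) 0 i.

Lemma iota_img_even i : has_parity false (iota_img i).
Proof.
rewrite /iota_img; elim/Pev_gen_ind: i => i j.
  by rewrite row_mxEl mxvecE; apply: C11_even.
by rewrite row_mxEr mxvecE; apply: phiC_even.
Qed.

Definition phiP : Pev -> QG := mmap (@ofP K m n \o KP) iota_img.

Lemma phiP_zmod : zmod_morphism phiP.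
Proof. exact: mmap_is_additive. Qed.

Lemma phiP_monoid : monoid_morphism phiP.
Proof.
case: (@commr_mmap_is_multiplicative _ K QG iota_img (@ofP K m n \o KP)).
- by move=> i x; apply/esym/even_central/iota_img_even.
- by move=> p mm mm'; apply: even_central; apply: parityC.
by move=> hM h1; split.
Qed.

HB.instance Definition _ := GRing.isZmodMorphism.Build Pev QG phiP phiP_zmod.
HB.instance Definition _ := GRing.isMonoidMorphism.Build Pev QG phiP phiP_monoid.

Lemma phiP_C c : phiP (KP c) = ofK m n c.
Proof. exact: mmapC. Qed.

Lemma phiP_X i : phiP 'X_i = iota_img i.
Proof. by rewrite /phiP mmapX mmap1U. Qed.

Lemma phiP_X11 : map_mx phiP X11 = C11.
Proof. by apply/matrixP => i j; rewrite !mxE phiP_X /iota_img row_mxEl mxvecE !mxE. Qed.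

Lemma phiP_X22 : map_mx phiP X22 = phiC.
Proof. by apply/matrixP => i j; rewrite !mxE phiP_X /iota_img row_mxEr mxvecE !mxE. Qed.

Lemma phiP_even p : has_parity false (phiP p).
Proof.
elim/mpolyind: p => [|c mm p _ _ IH]; first by rewrite rmorph0; apply: parity0.
rewrite rmorphD; apply: parityD; last exact: IH.
rewrite -mul_mpolyC rmorphM /= phiP_C.
rewrite -[false]/(false (+) false); apply: parityM; first exact: parityC.
rewrite mpolyXE_id rmorph_prod; elim/big_ind: _ => [|x y hx hy|i _].
- exact: parityC.
- by rewrite -[false]/(false (+) false); apply: parityM; [exact: hx|exact: hy].
- rewrite rmorphXn /= phiP_X; elim: (mm i) => [|k IHk]; first exact: parityC.
  rewrite exprS -[false]/(false (+) false).
  by apply: parityM; [exact: iota_img_even | exact: IHk].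
Qed.

Lemma phiP_central p x : phiP p * x = x * phiP p.
Proof. exact/even_central/phiP_even. Qed.

(** The augmentation that kills the odd generators. *)
Definition eps (x : QG) : F := ecoef x set0.
Lemma eps_zmod : zmod_morphism eps. Proof. by move=> x y; rewrite /eps ecoefB. Qed.
Lemma eps_monoid : monoid_morphism eps.
Proof. by split=> [|x y]; [rewrite /eps [LHS]ecoefE eqxx | apply: ecoef0M]. Qed.
HB.instance Definition _ := GRing.isZmodMorphism.Build QG F eps eps_zmod.
HB.instance Definition _ := GRing.isMonoidMorphism.Build QG F eps eps_monoid.

Lemma epsC q : eps (exC q) = q. Proof. by rewrite /eps [LHS]ecoefE eqxx. Qed.

Lemma eps_odd x : has_parity true x -> eps x = 0.
Proof. by apply; rewrite cards0. Qed.

(** The correction terms in phi(C22) are products of odd elements. *)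
Lemma eps_phiP p : eps (phiP p) = tf p.
Proof.
apply: (@Pev_rmorph_eq _ (eps \o phiP) tf) => [c||].
- by rewrite /= phiP_C epsC.
- by rewrite map_mx_comp phiP_X11 C11E; apply/matrixP => i j; rewrite !mxE /= epsC.
- rewrite map_mx_comp phiP_X22 phiCE (map_mxB eps) (map_mxM eps) C22E.
  have -> : map_mx eps C21 = 0.
    by apply/matrixP => i j; rewrite mxE eps_odd ?mxE //; apply: parityX.
  by rewrite mul0mx subr0; apply/matrixP => i j; rewrite !mxE /= epsC.
Qed.

(** An element is a unit as soon as its augmentation is one. *)
Lemma phiP_unit p : p != 0 -> phiP p \is a GRing.unit.
Proof.
move=> p0; rewrite -topredE /= /ext_unit.
by rewrite [ecoef _ _]eps_phiP unitfE tofrac_eq0.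
Qed.

(** * The embedding of functions of (C11, phi(C22), Y) *)

(** Psi sends polynomials in (X11, X22, Theta) to the corresponding
    functions of (C11, phi(C22), Y). *)
Definition Psi_subst : odd_subst Pev (m * n) QG :=
  @parity_subst Pev F (m * n) _ regF phiP
     (fun k => mxvec Ymx 0 k) phiP_even (fun k =>
       match mxvec_indexP k in is_mxvec_index k return has_parity true (mxvec Ymx 0 k)
       with isMxvecIndex i j => eq_ind_r (has_parity true) (Ymx_odd i j) (mxvecE _ i j) end).

Fact Psi_sig : {f : {rmorphism L Pev -> QG} |
  (forall p, f (extC _ p) = phiP p) /\ map_mx f (Theta m n Pev) = Ymx}.
Proof.
exists (osubst Psi_subst); split=> [p|]; first exact: osubstC.
by apply/matrixP => i j; rewrite map_Theta [LHS]osubstX /= mxvecE.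
Qed.

Definition Psi : {rmorphism L Pev -> QG} := sval Psi_sig.

Lemma PsiC p : Psi (extC _ p) = phiP p.
Proof. by case: (svalP Psi_sig). Qed.

Lemma Psi_Theta : map_mx Psi (Theta m n Pev) = Ymx.
Proof. by case: (svalP Psi_sig). Qed.

End Rings.

Lemma map_mx1E (R S : Type) (f : R -> S) r s (A : 'M[R]_(r, s)) i j :
  map_mx f A i j = f (A i j).
Proof. by rewrite mxE. Qed.

Lemma map_mx2_eq (R S S' T : Type) (f : S -> T) (g : R -> S) (f' : S' -> T)
    (g' : R -> S') r s (A : 'M[R]_(r, s)) :
  map_mx f (map_mx g A) = map_mx f' (map_mx g' A) ->
  forall i j, f (g (A i j)) = f' (g' (A i j)).
Proof. by move/matrixP => e i j; have := e i j; rewrite !mxE. Qed.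

Lemma map_mx21_eq (R S T : Type) (f : S -> T) (g : R -> S) (h : R -> T)
    r s (A : 'M[R]_(r, s)) :
  map_mx f (map_mx g A) = map_mx h A -> forall i j, f (g (A i j)) = h (A i j).
Proof. by move/matrixP => e i j; have := e i j; rewrite !mxE. Qed.

Section Translations.
Variables (K : fieldType) (m n : nat).
Hypothesis char0 : [pchar K] =i pred0.

Local Notation Pev := {mpoly K[m * m + n * n]}.
Local Notation F := {fraction Pev}.
Local Notation QG := (QG K m n).
Local Notation L R := (extalg R (m * n)).
Local Notation X11 := (X11 K m n).
Local Notation X22 := (X22 K m n).
Local Notation C11 := (C11 K m n).
Local Notation C12 := (C12 K m n).
Local Notation C21 := (C21 K m n).
Local Notation C22 := (C22 K m n).
Local Notation Ymx := (Ymx K m n).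
Local Notation phiC := (phiC K m n).
Local Notation Gev := (Gev K m n).
Local Notation KP := (@mpolyC (m * m + n * n) K).
Local Notation tf := (@FracField.tofrac Pev).
Local Notation X11F := (X11F K m n).
Local Notation X22F := (X22F K m n).
Local Notation exC := (@extC F (m * n + n * m)).
Local Notation Psi := (Psi m n char0).
Local Notation CM R := (map_mx (@extCr R (m * n))).
Local Notation Theta R := (Theta m n R).
Local Notation phiP := (@phiP K m n).
Implicit Types (g h : Gev).

(** * Independence of C11, phi(C22) and Y *)

(** The specialization C12 = X11 Theta, C21 = 0: it sends Y back to Theta
    and phi(C22) back to C22. *)
Definition std_img (k : 'I_(m * n + n * m)) : L F :=
  row_mx (mxvec (CM F X11F *m Theta F)) 0 0 k.

Lemma std_img_odd k : has_parity true (std_img k).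
Proof.
rewrite /std_img -(splitK k); case: (split k) => l /=.
  case/mxvec_indexP: l => i j; rewrite row_mxEl mxvecE.
  have := odd_linear X11F (1%:M : 'M[F]_n) i j.
  by rewrite map_mx1 mulmx1.
by rewrite row_mxEr mxE; apply: parity0.
Qed.

Definition std_subst : odd_subst F (m * n + n * m) (L F) :=
  @parity_subst F F (m * n + n * m) (m * n) (@regF K m n char0) (@extCr F (m * n))
    std_img (fun a => @parityC F (m * n) a) std_img_odd.

Fact std_sig : {f : {rmorphism QG -> L F} | [/\ forall q, f (exC q) = extC _ q,
  map_mx f C12 = CM F X11F *m Theta F & map_mx f C21 = 0]}.
Proof.
exists (osubst std_subst); split=> [q||]; first exact: osubstC.
  apply/matrixP => i j; rewrite !mxE [LHS]osubstX /= /std_img row_mxEl mxvecE.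
  by rewrite !mxE.
by apply/matrixP => i j; rewrite !mxE [LHS]osubstX /= /std_img row_mxEr mxE.
Qed.

Definition std : {rmorphism QG -> L F} := sval std_sig.

Lemma stdC q : std (exC q) = extC _ q.
Proof. by case: (svalP std_sig). Qed.

Lemma std_C12 : map_mx std C12 = CM F X11F *m Theta F.
Proof. by case: (svalP std_sig). Qed.

Lemma std_C21 : map_mx std C21 = 0.
Proof. by case: (svalP std_sig). Qed.

Lemma std_exC r s (A : 'M[F]_(r, s)) :
  map_mx std (map_mx exC A : 'M[QG]_(r, s)) = CM F A.
Proof. by apply/matrixP => i j; rewrite !mxE stdC. Qed.

Lemma std_Ymx : map_mx std Ymx = Theta F.
Proof.
rewrite YmxE (map_mxM std) std_exC std_C12 mulmxA -map_mxM.
by rewrite mulVmx ?X11F_unit // map_mx1 mul1mx.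
Qed.

Lemma std_phiC : map_mx std phiC = CM F X22F.
Proof.
by rewrite phiCE (map_mxB std) (map_mxM std) std_C21 mul0mx subr0 C22E std_exC.
Qed.

(** The specialization undoes Psi up to the inclusion of polynomials in
    fractions. *)
Lemma std_Psi Q : std (Psi Q) = coefmap (m * n) tf Q.
Proof.
have stdP : std \o phiP =1 @extCr F (m * n) \o tf.
  apply: Pev_rmorph_eq => [c||].
  - by rewrite /= phiP_C stdC.
  - by rewrite map_mx_comp phiP_X11 C11E std_exC [RHS]map_mx_comp.
  - by rewrite map_mx_comp phiP_X22 std_phiC [RHS]map_mx_comp.
apply: (@ext_rmorph_eq _ _ _ (std \o Psi) (coefmap (m * n) tf)) => [a|k].
  by rewrite /= PsiC coefmapC; apply: stdP.
case/mxvec_indexP: k => i j.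
have /matrixP/(_ i j) := Psi_Theta m n char0; rewrite [LHS]mxE mxE /= => ->.
by rewrite coefmapX; have /matrixP/(_ i j) := std_Ymx; rewrite [LHS]mxE [RHS]mxE.
Qed.

Lemma Psi_inj Q : Psi Q = 0 -> Q = 0.
Proof.
move=> Q0; have := std_Psi Q; rewrite Q0 rmorph0 => c0.
apply: ecoefP => S; apply/eqP; rewrite ecoef0 -tofrac_eq0.
by rewrite -(ecoef_coefmap tf) -c0 ecoef0.
Qed.

(** * The action of G_ev *)

(** The action on fractions is defined through the chosen representative;
    this equation is what makes it independent of the choice. *)
Lemma frac_repr (q : F) : q * tf (\d_(repr q)) = tf (\n_(repr q)).
Proof.
have tE x : tf x = \pi_({fraction Pev})%qT (Ratio x 1) by unlock FracField.tofrac.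
rewrite -[X in X * _]reprK; set r := repr q.
have d0 := denom_ratioP r.
rewrite !tE; apply: etrans (esym (FracField.pi_mul _ _)) _.
apply/eqmodP; rewrite /= /FracField.equivf /FracField.mulf.
by rewrite !numden_Ratio ?mulr1 ?oner_eq0 // mulrC.
Qed.

Lemma frac_ex (q : F) : exists a b, b != 0 /\ q = tf a / tf b.
Proof.
have d0 := denom_ratioP (repr q).
exists (\n_(repr q)), (\d_(repr q)); split=> //.
by rewrite -frac_repr mulfK // tofrac_eq0.
Qed.

Section OneElement.
Variable g : Gev.
Hypothesis g_unit : in_Gev g.

Lemma actP_eq0 x : (actP g x == 0) = (x == 0).
Proof. by rewrite -{1}(rmorph0 (@actP K m n g)) (can_eq (actPK g_unit)). Qed.

Lemma actF_frac a b : b != 0 -> actF g (tf a / tf b) = tf (actP g a) / tf (actP g b).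
Proof.
move=> b0; rewrite [LHS]/actF; set q := tf a / tf b.
have d0 := denom_ratioP (repr q); have qE := frac_repr q.
apply/eqP; rewrite eqr_div ?tofrac_eq0 ?actP_eq0 // -!tofracM tofrac_eq.
rewrite -!(rmorphM (@actP K m n g)) /= (can_eq (actPK g_unit)) -tofrac_eq !tofracM.
by rewrite -qE mulrAC divfK // tofrac_eq0.
Qed.

Lemma actF_zmod : zmod_morphism (actF g).
Proof.
move=> x y; have [a [b [b0 ->]]] := frac_ex x; have [c [d [d0 ->]]] := frac_ex y.
rewrite -mulNr addf_div ?tofrac_eq0 // -tofracN -!tofracM -tofracD.
rewrite !actF_frac ?mulf_neq0 // -mulNr -tofracN addf_div ?tofrac_eq0 ?actP_eq0 //.
by rewrite rmorphD !rmorphM rmorphN /= tofracD !tofracM.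
Qed.

Lemma actF_monoid : monoid_morphism (actF g).
Proof.
split=> [|x y]; first exact: actF1.
have [a [b [b0 ->]]] := frac_ex x; have [c [d [d0 ->]]] := frac_ex y.
rewrite mulf_div -!tofracM !actF_frac ?mulf_neq0 //.
by rewrite mulf_div !rmorphM.
Qed.

Definition actFr : {rmorphism F -> F} :=
  HB.pack (actF g) (GRing.isZmodMorphism.Build F F (actF g) actF_zmod)
    (GRing.isMonoidMorphism.Build F F (actF g) actF_monoid).

Lemma map_in_alg r s (A : 'M[K]_(r, s)) :
  map_mx (in_alg QG) A = map_mx exC (map_mx tf (map_mx KP A)).
Proof. by rewrite -map_ofP_const; apply/matrixP => i j; rewrite !mxE. Qed.

Lemma odd_img_odd k : has_parity true (odd_img g 0 k).
Proof.
have lin r s t (A : 'M[QG]_(r, s)) (B : 'M[K]_(s, t)) i j :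
    (forall i j, has_parity true (A i j)) ->
    has_parity true ((A *m map_mx (in_alg QG) B) i j).
  move=> oA; rewrite mxE; apply: parity_sum => l _.
  rewrite -[true]/(true (+) false); apply: parityM; first exact: oA.
  by rewrite map_in_alg !mxE; apply: parityC.
rewrite /odd_img -(splitK k); case: (split k) => l; case/mxvec_indexP: l => i j /=.
  by rewrite row_mxEl mxvecE; apply: lin => i' j'; rewrite mxE; apply: parityX.
by rewrite row_mxEr mxvecE; apply: lin => i' j'; rewrite mxE; apply: parityX.
Qed.

Definition act_subst : odd_subst F (m * n + n * m) QG :=
  @parity_subst F F (m * n + n * m) (m * n + n * m) (@regF K m n char0)
    (@extCr F (m * n + n * m) \o actFr)
    (odd_img g 0) (fun a => @parityC F (m * n + n * m) (actF g a)) odd_img_odd.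

(** The formula defining act is the evaluation of an exterior algebra at
    odd_img, so act is multiplicative. *)
Fact actr_sig : {f : {rmorphism QG -> QG} | f =1 act g}.
Proof. by exists (osubst act_subst). Qed.

Definition actr : {rmorphism QG -> QG} := sval actr_sig.

Lemma actrE x : actr x = act g x.
Proof. exact: (svalP actr_sig). Qed.

Lemma map_actr r s (A : 'M[QG]_(r, s)) : map_mx actr A = map_mx (act g) A.
Proof. by apply/matrixP => i j; rewrite 2!mxE actrE. Qed.

Lemma actr_C11 : map_mx actr C11 = C11 *m map_mx (in_alg QG) g.1.
Proof.
have := act_Cgen g_unit; rewrite -map_actr /Cgen !map_block_mx !map_mx0 mulmx_block.
by rewrite !mulmx0 !addr0 !add0r => /eq_block_mx[].
Qed.

Lemma actr_C12 : map_mx actr C12 = C12 *m map_mx (in_alg QG) g.2.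
Proof.
have := act_Cgen g_unit; rewrite -map_actr /Cgen !map_block_mx !map_mx0 mulmx_block.
by rewrite !mulmx0 !addr0 !add0r => /eq_block_mx[].
Qed.

Lemma actr_C21 : map_mx actr C21 = C21 *m map_mx (in_alg QG) g.1.
Proof.
have := act_Cgen g_unit; rewrite -map_actr /Cgen !map_block_mx !map_mx0 mulmx_block.
by rewrite !mulmx0 !addr0 !add0r => /eq_block_mx[].
Qed.

Lemma actr_C22 : map_mx actr C22 = C22 *m map_mx (in_alg QG) g.2.
Proof.
have := act_Cgen g_unit; rewrite -map_actr /Cgen !map_block_mx !map_mx0 mulmx_block.
by rewrite !mulmx0 !addr0 !add0r => /eq_block_mx[].
Qed.

Lemma C11_inv : (map_mx exC (invmx X11F) : 'M[QG]_m) *m C11 = 1%:M.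
Proof. by rewrite C11E -(map_mxM exC) mulVmx ?X11F_unit // (map_mx1 exC). Qed.

Lemma C11_inj s (A B : 'M[QG]_(m, s)) : C11 *m A = C11 *m B -> A = B.
Proof.
by move=> eAB; rewrite -[A]mul1mx -[B]mul1mx -C11_inv -!mulmxA eAB.
Qed.

(** From C11 Y = C12, where C11 becomes C11 g1 and C12 becomes C12 g2. *)
Lemma actr_Ymx : map_mx actr Ymx =
  map_mx (in_alg QG) (invmx g.1) *m Ymx *m map_mx (in_alg QG) g.2.
Proof.
have g1u : g.1 \in unitmx by case/andP: g_unit.
have inv2 : map_mx (in_alg QG) (invmx g.1) *m map_mx (in_alg QG) g.1 = 1%:M.
  by rewrite -map_mxM mulVmx // map_mx1.
have e : C11 *m (map_mx (in_alg QG) g.1 *m map_mx actr Ymx)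
    = C11 *m (Ymx *m map_mx (in_alg QG) g.2).
  rewrite [LHS]mulmxA [RHS]mulmxA -actr_C11 C11_Ymx -actr_C12 -(map_mxM actr).
  by rewrite C11_Ymx.
by rewrite -mulmxA -(C11_inj e) mulmxA inv2 mul1mx.
Qed.

(** In C22 - C21 Y the factor g1 of C21 cancels the factor g1^-1 of Y. *)
Lemma actr_phiC : map_mx actr phiC = phiC *m map_mx (in_alg QG) g.2.
Proof.
have g1u : g.1 \in unitmx by case/andP: g_unit.
rewrite phiCE (map_mxB actr) (map_mxM actr) actr_C22 actr_C21 actr_Ymx.
rewrite mulmxBl; congr (_ - _); rewrite -!mulmxA; congr (_ *m _).
by rewrite [LHS]mulmxA -map_mxM mulmxV // map_mx1 mul1mx.
Qed.

End OneElement.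

(** The transform of Theta under g is that of Y. *)
Definition H_mx g : 'M[L Pev]_(m, n) :=
  CM Pev (map_mx KP (invmx g.1)) *m Theta Pev *m CM Pev (map_mx KP g.2).

Lemma H_odd g k : has_parity true (mxvec (H_mx g) 0 k).
Proof. by case/mxvec_indexP: k => i j; rewrite mxvecE; apply: odd_linear. Qed.

Definition H_subst g : odd_subst Pev (m * n) (L Pev) :=
  @parity_subst Pev Pev (m * n) (m * n) (@regP K m n char0)
    (@extCr Pev (m * n) \o @actP K m n g)
    (fun k => mxvec (H_mx g) 0 k)
    (fun a => @parityC Pev (m * n) (actP g a)) (H_odd g).

Fact H_sig g : {f : {rmorphism L Pev -> L Pev} |
  (forall p, f (extC _ p) = extC _ (actP g p)) /\ map_mx f (Theta Pev) = H_mx g}.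
Proof.
exists (osubst (H_subst g)); split=> [p|]; first exact: osubstC.
by apply/matrixP => i j; rewrite map_Theta [LHS]osubstX /= mxvecE.
Qed.

Definition H g : {rmorphism L Pev -> L Pev} := sval (H_sig g).

Lemma HC g p : H g (extC _ p) = extC _ (actP g p).
Proof. by case: (svalP (H_sig g)). Qed.

Lemma H_Theta g : map_mx (H g) (Theta Pev) = H_mx g.
Proof. by case: (svalP (H_sig g)). Qed.

Lemma H_const g r s (A : 'M[K]_(r, s)) :
  map_mx (H g) (CM Pev (map_mx KP A)) = CM Pev (map_mx KP A).
Proof. by apply/matrixP => i j; rewrite !mxE HC actP_C. Qed.

Lemma Psi_const r s (A : 'M[K]_(r, s)) :
  map_mx Psi (CM Pev (map_mx KP A)) = map_mx (in_alg QG) A.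
Proof.
by apply/matrixP => i j; rewrite !mxE PsiC phiP_C; apply/esym/mulr1.
Qed.

Lemma phiP_const r s (A : 'M[K]_(r, s)) :
  map_mx phiP (map_mx KP A) = map_mx (in_alg QG) A.
Proof. by apply/matrixP => i j; rewrite !mxE phiP_C; apply/esym/mulr1. Qed.

(** Both sides are ring morphisms in Q, which agree on X11, X22 and Theta
    by the transformation rules of C11, phi(C22) and Y. *)
Lemma act_Psi g Q : in_Gev g -> act g (Psi Q) = Psi (H g Q).
Proof.
move=> g_unit; rewrite -(actrE g_unit).
have actPhi : actr g_unit \o phiP =1 phiP \o @actP K m n g.
  apply: Pev_rmorph_eq_entries => [c||].
  - rewrite /= actP_C phiP_C actrE [LHS](act_extC _ g_unit) actF_tofrac // actP_C.
    by [].
  - have e : map_mx (actr g_unit) (map_mx phiP X11) = map_mx phiP (map_mx (actP g) X11).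
      rewrite phiP_X11 (actr_C11 g_unit) actP_X11 (map_mxM phiP) phiP_X11.
      by rewrite phiP_const.
    exact: (map_mx2_eq e).
  - have e : map_mx (actr g_unit) (map_mx phiP X22) = map_mx phiP (map_mx (actP g) X22).
      rewrite phiP_X22 (actr_phiC g_unit) actP_X22 (map_mxM phiP) phiP_X22.
      by rewrite phiP_const.
    exact: (map_mx2_eq e).
apply: (@ext_rmorph_eq _ _ _ (actr g_unit \o Psi) (Psi \o H g)) => [a|k].
  by rewrite /= PsiC HC PsiC; apply: actPhi.
case/mxvec_indexP: k => i j.
have : map_mx (actr g_unit) (map_mx Psi (Theta Pev)) = map_mx Psi (map_mx (H g) (Theta Pev)).
  rewrite Psi_Theta actr_Ymx H_Theta /H_mx !(map_mxM Psi) !Psi_const Psi_Theta.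
  by [].
by move/map_mx2_eq/(_ i j); rewrite ThetaE.
Qed.

Lemma CMKP_mul r s t (A : 'M[K]_(r, s)) (B : 'M[K]_(s, t)) :
  CM Pev (map_mx KP (A *m B)) = CM Pev (map_mx KP A) *m CM Pev (map_mx KP B).
Proof. by rewrite map_mxM [LHS]map_mxM. Qed.

Lemma invmx_mul r (A B : 'M[K]_r) : A \in unitmx -> B \in unitmx ->
  invmx (A *m B) = invmx B *m invmx A.
Proof.
move=> uA uB; have uAB : A *m B \in unitmx by rewrite unitmx_mul uA.
apply: (can_inj (mulKmx uAB)); rewrite mulmxV // -!mulmxA (mulmxA B).
by rewrite mulmxV // mul1mx mulmxV.
Qed.

Lemma H_HC g h p : H g (H h (extC _ p)) = extC _ (actP g (actP h p)).
Proof. exact: etrans (congr1 (H g) (HC h p)) (HC g _). Qed.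

Lemma H_mul g h Q : in_Gev g -> in_Gev h ->
  H g (H h Q) = H (g.1 *m h.1, g.2 *m h.2) Q.
Proof.
move=> /andP[g1 g2] /andP[h1 h2].
pose gh : Gev := (g.1 *m h.1, g.2 *m h.2).
suff eH : H g \o H h =1 H gh by apply: eH.
apply: LPev_rmorph_eq => [c|i j|i j|i j].
- by apply: etrans (H_HC _ _ _) (esym (etrans (HC gh _) _)); rewrite !actP_C.
- apply: etrans (H_HC _ _ _) (esym (etrans (HC gh _) _)).
  have e : map_mx (actP g) (map_mx (actP h) X11) = map_mx (actP gh) X11.
    apply: etrans (congr1 (map_mx (actP g)) (actP_X11 h)) _.
    apply: etrans _ (esym (actP_X11 gh)); rewrite (map_mxM (@actP K m n g)).
    by rewrite actP_X11 actP_const -mulmxA -map_mxM.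
  exact: (congr1 (@extC _ (m * n)) (esym (map_mx21_eq e i j))).
- apply: etrans (H_HC _ _ _) (esym (etrans (HC gh _) _)).
  have e : map_mx (actP g) (map_mx (actP h) X22) = map_mx (actP gh) X22.
    apply: etrans (congr1 (map_mx (actP g)) (actP_X22 h)) _.
    apply: etrans _ (esym (actP_X22 gh)); rewrite (map_mxM (@actP K m n g)).
    by rewrite actP_X22 actP_const -mulmxA -map_mxM.
  exact: (congr1 (@extC _ (m * n)) (esym (map_mx21_eq e i j))).
- have e : map_mx (H g) (map_mx (H h) (Theta Pev)) = map_mx (H gh) (Theta Pev).
    apply: etrans (congr1 (map_mx (H g)) (H_Theta h)) _.
    apply: etrans _ (esym (H_Theta gh)).
    rewrite /H_mx 2!(map_mxM (H g)) 2!(H_const g) (H_Theta g) /H_mx /=.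
    by rewrite (invmx_mul g1 h1) !CMKP_mul !mulmxA.
  exact: (map_mx21_eq e).
Qed.

(** * The action and evaluation at K-points *)

(** The same rule over K: once X11 and X22 are evaluated at matrices, g
    still moves the odd variables. *)
Definition sub_mx g : 'M[L K]_(m, n) :=
  CM K (invmx g.1) *m Theta K *m CM K g.2.

Lemma sub_odd g k : has_parity true (mxvec (sub_mx g) 0 k).
Proof. by case/mxvec_indexP: k => i j; rewrite mxvecE; apply: odd_linear. Qed.

Definition sub_subst g : odd_subst K (m * n) (L K) :=
  @parity_subst K K (m * n) (m * n) (@regK K char0) (@extCr K (m * n))
    (fun k => mxvec (sub_mx g) 0 k) (fun a => @parityC K (m * n) a) (sub_odd g).

Fact sub_sig g : {f : {rmorphism L K -> L K} |
  (forall c, f (extC _ c) = extC _ c) /\ map_mx f (Theta K) = sub_mx g}.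
Proof.
exists (osubst (sub_subst g)); split=> [p|]; first exact: osubstC.
by apply/matrixP => i j; rewrite map_Theta [LHS]osubstX /= mxvecE.
Qed.

Definition sub g : {rmorphism L K -> L K} := sval (sub_sig g).

Lemma subC g c : sub g (extC _ c) = extC _ c.
Proof. by case: (svalP (sub_sig g)). Qed.

Lemma sub_Theta g : map_mx (sub g) (Theta K) = sub_mx g.
Proof. by case: (svalP (sub_sig g)). Qed.

Lemma sub_const g r s (A : 'M[K]_(r, s)) : map_mx (sub g) (CM K A) = CM K A.
Proof. by apply/matrixP => i j; rewrite !mxE subC. Qed.

Implicit Types (A : 'M[K]_m) (B : 'M[K]_n).

Lemma evC A B p : ev A B (extC _ p) = extC _ (evP A B p).
Proof. exact: coefmapC. Qed.

Lemma ev_const A B r s (D : 'M[K]_(r, s)) :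
  map_mx (ev A B) (CM Pev (map_mx KP D)) = CM K D.
Proof. by apply/matrixP => i j; rewrite !mxE evC evP_C. Qed.

Lemma ev_Theta A B : map_mx (ev A B) (Theta Pev) = Theta K.
Proof. by apply/matrixP => i j; rewrite !mxE; apply: coefmapX. Qed.

Lemma evP_const A B r s (D : 'M[K]_(r, s)) : map_mx (evP A B) (map_mx KP D) = D.
Proof. by apply/matrixP => i j; rewrite !mxE evP_C. Qed.

Lemma ev_HC A B g p : ev A B (H g (extC _ p)) = extC _ (evP A B (actP g p)).
Proof. exact: etrans (congr1 (ev A B) (HC g p)) (evC A B _). Qed.

Lemma sub_evC A B g p : sub g (ev A B (extC _ p)) = extC _ (evP A B p).
Proof. exact: etrans (congr1 (sub g) (evC A B p)) (subC g _). Qed.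

(** Evaluating at (A, B) after acting by g amounts to evaluating at (A g1,
    B g2) and then moving the odd variables. *)
Lemma ev_H g A B Q : ev A B (H g Q) = sub g (ev (A *m g.1) (B *m g.2) Q).
Proof.
suff eH : ev A B \o H g =1 sub g \o ev (A *m g.1) (B *m g.2) by apply: eH.
apply: LPev_rmorph_eq => [c|i j|i j|i j].
- apply: etrans (ev_HC _ _ _ _) (esym (etrans (sub_evC _ _ _ _) _)).
  by rewrite actP_C !evP_C.
- apply: etrans (ev_HC _ _ _ _) (esym (etrans (sub_evC _ _ _ _) _)).
  have e : map_mx (evP A B) (map_mx (actP g) X11)
      = map_mx (evP (A *m g.1) (B *m g.2)) X11.
    by rewrite actP_X11 (map_mxM (evP A B)) !evP_X11 evP_const.
  exact: (congr1 (@extC _ (m * n)) (esym (map_mx21_eq e i j))).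
- apply: etrans (ev_HC _ _ _ _) (esym (etrans (sub_evC _ _ _ _) _)).
  have e : map_mx (evP A B) (map_mx (actP g) X22)
      = map_mx (evP (A *m g.1) (B *m g.2)) X22.
    by rewrite actP_X22 (map_mxM (evP A B)) !evP_X22 evP_const.
  exact: (congr1 (@extC _ (m * n)) (esym (map_mx21_eq e i j))).
- have e : map_mx (ev A B) (map_mx (H g) (Theta Pev))
      = map_mx (sub g) (map_mx (ev (A *m g.1) (B *m g.2)) (Theta Pev)).
    rewrite H_Theta /H_mx !(map_mxM (ev A B)) !ev_const !ev_Theta.
    by rewrite sub_Theta.
  exact: (map_mx2_eq e).
Qed.

Lemma sub_inj g x : in_Gev g -> sub g x = 0 -> x = 0.
Proof.
move=> /andP[g1 g2] x0; pose h : Gev := (invmx g.1, invmx g.2).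
have subK : sub h \o sub g =1 idfun.
  apply: ext_rmorph_eq => [a|k]; first by rewrite /= !subC.
  case/mxvec_indexP: k => i j.
  have e : map_mx (sub h) (map_mx (sub g) (Theta K)) = map_mx idfun (Theta K).
    rewrite sub_Theta /sub_mx !(map_mxM (sub h)) !sub_const sub_Theta /sub_mx.
    rewrite !mulmxA -!map_mxM -!mulmxA -!map_mxM /= invmxK.
    by rewrite mulVmx // mulVmx // !map_mx1 mul1mx mulmx1 map_mx_id.
  by have := map_mx21_eq e i j; rewrite ThetaE.
by rewrite -[x]subK /= x0 rmorph0.
Qed.

End Translations.

(** * Polynomial models of the floors *)

Section Span.
Variables (K : fieldType) (V : lmodType K) (B : V -> Prop).

Lemma in_span0 : in_span B 0.
Proof. by exists [::]; rewrite big_nil. Qed.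

Lemma in_spanD x y : in_span B x -> in_span B y -> in_span B (x + y).
Proof.
move=> [s [hs ->]] [t [ht ->]]; exists (s ++ t); rewrite big_cat; split=> // p.
by rewrite mem_cat => /orP[/hs|/ht].
Qed.

Lemma in_spanZ_gen c x : B x -> in_span B (c *: x).
Proof.
by move=> Bx; exists [:: (c, x)]; rewrite big_seq1; split=> // p; rewrite inE => /eqP->.
Qed.

Lemma in_span_ind (P : V -> Prop) : P 0 ->
  (forall x y, P x -> P y -> P (x + y)) -> (forall c x, B x -> P (c *: x)) ->
  forall x, in_span B x -> P x.
Proof.
move=> P0 PD PB x [s [hs ->]]; elim: s hs => [|p s IH] hs; first by rewrite big_nil.
rewrite big_cons; apply: PD; first by apply: PB; apply: hs; rewrite mem_head.
by apply: IH => q sq; apply: hs; rewrite inE sq orbT.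
Qed.

End Span.

Lemma perm_map_lift (T U : eqType) (f : T -> U) (s : seq T) (t : seq U) (x0 : T) :
  perm_eq (map f s) t -> exists2 s', perm_eq s s' & map f s' = t.
Proof.
rewrite perm_sym => /(perm_iotaP (f x0))[Is perm_Is ->].
exists (map (nth x0 s) Is); last first.
  rewrite -map_comp; apply/eq_in_map => i; rewrite (perm_mem perm_Is) mem_iota size_map.
  by move=> /= lt_i; rewrite (nth_map x0).
rewrite -{1}(mkseq_nth x0 s) perm_sym; apply: perm_map.
by rewrite size_map in perm_Is.
Qed.

(** This and the next identities rearrange products in which only the
    stated factors commute. *)
Lemma mul4_comm (R : pzRingType) (a x b y : R) :
  x * b = b * x -> a * x * (b * y) = a * b * (x * y).
Proof. by move=> e; rewrite -!mulrA (mulrA x) e !mulrA. Qed.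

Lemma mul4_comm' (R : pzRingType) (a b x y : R) :
  x * b = b * x -> a * b * (x * y) = a * x * b * y.
Proof. by move=> e; rewrite -!mulrA (mulrA x) e !mulrA. Qed.

Lemma mul5_comm (R : pzRingType) (k d p e q : R) :
  k * d = d * k -> k * e = e * k -> p * e = e * p ->
  k * (d * p * e * q) = d * e * (k * (p * q)).
Proof.
move=> ekd eke epe.
by rewrite !mulrA ekd -(mulrA _ p) epe mulrA -(mulrA d) eke !mulrA.
Qed.

Lemma mul3_comm (R : pzRingType) (k d p y : R) :
  k * d = d * k -> k * (d * p * y) = d * (k * (p * y)).
Proof. by move=> ekd; rewrite !mulrA ekd. Qed.

Section WedgeMonomials.
Variables (R : comNzRingType) (p : nat).
Local Notation wedge S := (\prod_(i in S) extX R i).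

(** Sorting a product of distinct generators costs a sign; a repeated
    generator kills it. *)
Lemma prod_extX_seq (s : seq 'I_p) :
  exists b : bool, \prod_(i <- s) extX R i =
     (if uniq s then (-1) ^+ b * wedge [set i in s] else 0).
Proof.
elim: s => [|i s [b IH]].
  by exists false; rewrite big_nil mul1r big_pred0 // => i; rewrite !inE.
rewrite big_cons IH /=; case: (uniq s); last by exists false; rewrite andbF mulr0.
rewrite andbT mulrA commr_sign -mulrA.
rewrite mul_oprod1; [|exact: extX_anti|exact: extX_sq].
have -> : i |: [set i in s] = [set j in i :: s] by apply/setP => j; rewrite !inE.
rewrite /extsign disjoints1 inE; case: (boolP (i \in s)) => is_; last first.
  exists (b (+) odd (inversions [set i] [set i in s])).
  by rewrite signr_addb signr_odd -mulrA -mulrzl rmorph_sign.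
by exists false; rewrite mulr0z mulr0.
Qed.

Lemma ecoef_wedge (S T : {set 'I_p}) : ecoef (wedge S) T = (T == S)%:R.
Proof. by rewrite prod_extX ecoefE. Qed.

Lemma ecoef_signM (b : bool) (x : extalg R p) S :
  ecoef ((-1) ^+ b * x) S = (-1) ^+ b * ecoef x S.
Proof.
by case: b; rewrite ?mul1r // !expr1 !mulN1r ecoefN.
Qed.

Lemma ecoef_prod_extX (s : seq 'I_p) (S : {set 'I_p}) :
  #|S| != size s -> ecoef (\prod_(i <- s) extX R i) S = 0.
Proof.
move=> neS; have [b ->] := prod_extX_seq s; case: ifP => us; last by rewrite ecoef0.
rewrite ecoef_signM ecoef_wedge; case: (S =P _) neS => [->|_ _]; last by rewrite mulr0.
by rewrite cardsE (card_uniqP us) eqxx.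
Qed.

End WedgeMonomials.

Lemma mxvec_index_inj m n :
  injective (fun p : 'I_m * 'I_n => mxvec_index p.1 p.2).
Proof.
case=> i j [i' j'] /= e.
have := congr1 (fun k => (mxvec (\matrix_(i, j) (i, j))) 0 k) e.
by rewrite !mxvecE !mxE.
Qed.

Section Floor.
Variables (K : fieldType) (m n : nat).
Hypothesis char0 : [pchar K] =i pred0.

Local Notation Pev := {mpoly K[m * m + n * n]}.
Local Notation QG := (QG K m n).
Local Notation L R := (extalg R (m * n)).
Local Notation X11 := (X11 K m n).
Local Notation X22 := (X22 K m n).
Local Notation Ymx := (Ymx K m n).
Local Notation KP := (@mpolyC (m * m + n * n) K).
Local Notation Psi := (Psi m n char0).
Local Notation Theta R := (Theta m n R).
Local Notation phiP := (@phiP K m n).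
Local Notation pairs := (seq ('I_m * 'I_n)).

Definition colprod (tp tm : seq (seq nat)) : Pev :=
  (\prod_(c <- tp) rminor X11 c) * \prod_(c <- tm) rminor X22 c.

Definition thetas (R : comNzRingType) (ab : pairs) : L R := \prod_(p <- ab) Theta R p.1 p.2.

(** Polynomial model of a floor: lp and lm are the multisets of sizes of
    the minors of X11 and of X22, and k is the number of odd variables. The
    constant multiples belong to the generators, so closure under addition
    suffices. *)
Inductive floor_poly (lp lm : seq nat) (k : nat) : L Pev -> Prop :=
| FloorZero : floor_poly lp lm k 0
| FloorAdd Q Q' of floor_poly lp lm k Q & floor_poly lp lm k Q' :
    floor_poly lp lm k (Q + Q')
| FloorGen (c : K) tp tm (ab : pairs) of
    perm_eq (map size tp) lp & perm_eq (map size tm) lm &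
    all (all (fun a => a < m)%N) tp & all (all (fun a => a < n)%N) tm & size ab = k :
    floor_poly lp lm k (extC _ (KP c * colprod tp tm) * thetas Pev ab).

Lemma colprod_cat tp tm tp' tm' :
  colprod (tp ++ tp') (tm ++ tm') = colprod tp tm * colprod tp' tm'.
Proof. by rewrite /colprod !big_cat mulrACA. Qed.

Lemma thetas_cat (R : comNzRingType) ab ab' :
  thetas R (ab ++ ab') = thetas R ab * thetas R ab'.
Proof. exact: big_cat. Qed.

Lemma floor_mul lp lm k lp' lm' k' Q Q' :
  floor_poly lp lm k Q -> floor_poly lp' lm' k' Q' ->
  floor_poly (lp ++ lp') (lm ++ lm') (k + k') (Q * Q').
Proof.
move=> hQ hQ'; elim: hQ => [|Q1 Q2 _ IH1 _ IH2|c tp tm ab h1 h2 h3 h4 h5].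
- by rewrite mul0r; apply: FloorZero.
- by rewrite mulrDl; apply: FloorAdd.
elim: hQ' => [|Q1 Q2 _ IH1 _ IH2|c' tp' tm' ab' h1' h2' h3' h4' h5'].
- by rewrite mulr0; apply: FloorZero.
- by rewrite mulrDr; apply: FloorAdd.
have eC : extC (m * n) (KP (c * c') * colprod (tp ++ tp') (tm ++ tm')) =
    extC (m * n) (KP c * colprod tp tm) * extC (m * n) (KP c' * colprod tp' tm').
  rewrite colprod_cat mpolyCM mulrACA; exact: (rmorphM (@extCr Pev (m * n))).
have -> : extC (m * n) (KP c * colprod tp tm) * thetas Pev ab *
    (extC (m * n) (KP c' * colprod tp' tm') * thetas Pev ab') =
    extC _ (KP (c * c') * colprod (tp ++ tp') (tm ++ tm')) * thetas Pev (ab ++ ab').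
  rewrite eC thetas_cat; apply: mul4_comm; exact/esym/extC_commE.
by apply: FloorGen; rewrite ?map_cat ?perm_cat ?all_cat ?h3 ?h4 // size_cat h5 h5'.
Qed.

Lemma floor_perm lp lm lp' lm' k Q : perm_eq lp lp' -> perm_eq lm lm' ->
  floor_poly lp lm k Q -> floor_poly lp' lm' k Q.
Proof.
move=> plp plm; elim=> [|Q1 Q2 _ IH1 _ IH2|c tp tm ab h1 h2 h3 h4 h5].
- exact: FloorZero.
- exact: FloorAdd.
- by apply: FloorGen => //; [apply: perm_trans plp|apply: perm_trans plm].
Qed.

Lemma floor_sum lp lm k (I : Type) (r : seq I) (P : pred I) (G : I -> L Pev) :
  (forall i, P i -> floor_poly lp lm k (G i)) ->
  floor_poly lp lm k (\sum_(i <- r | P i) G i).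
Proof.
move=> h; elim/big_ind: _ => //; [exact: FloorZero | exact: FloorAdd].
Qed.

Lemma floor_scale lp lm k c Q : floor_poly lp lm k Q ->
  floor_poly lp lm k (extC _ (KP c) * Q).
Proof.
elim=> [|Q1 Q2 _ IH1 _ IH2|c' tp tm ab h1 h2 h3 h4 h5].
- by rewrite mulr0; apply: FloorZero.
- by rewrite mulrDr; apply: FloorAdd.
rewrite mulrA -[extC _ (KP c) * _](rmorphM (@extCr Pev (m * n))) mulrA -mpolyCM.
exact: FloorGen.
Qed.

Lemma floor_colprod tp tm : all (all (fun a => a < m)%N) tp ->
  all (all (fun a => a < n)%N) tm ->
  floor_poly (map size tp) (map size tm) 0 (extC _ (colprod tp tm)).
Proof.
move=> h1 h2; have := @FloorGen (map size tp) (map size tm) 0 1 tp tm [::].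
by rewrite mul1r /thetas big_nil mulr1; apply.
Qed.

Lemma floor_thetas ab : floor_poly [::] [::] (size ab) (thetas Pev ab).
Proof.
have := @FloorGen [::] [::] (size ab) 1 [::] [::] ab.
rewrite /colprod !big_nil !mulr1 /=.
by rewrite -[extC _ (KP 1)]/(1 : L Pev) mul1r; apply.
Qed.

(** * Behaviour under the lower triangular Borel subgroup *)

(** The factor by which a product of minors on first rows, of the sizes in
    l, is multiplied when a lower triangular b acts on the left. *)
Definition chi (r : nat) (b : 'M[K]_r) (l : seq nat) : K :=
  \prod_(s <- l) \prod_(a < s) natent b a a.

Lemma evP_rminor11 A B c : evP A B (rminor X11 c) = rminor A c.
Proof. by rewrite -rminor_map evP_X11. Qed.

Lemma evP_rminor22 A B c : evP A B (rminor X22 c) = rminor B c.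
Proof. by rewrite -rminor_map evP_X22. Qed.

Lemma ev_thetas A B ab : ev A B (thetas Pev ab) = thetas K ab.
Proof.
rewrite /thetas rmorph_prod; apply: eq_bigr => p _.
by rewrite !mxE; apply: coefmapX.
Qed.

Lemma evP_colprod A B c tp tm : evP A B (KP c * colprod tp tm) =
  c * ((\prod_(t <- tp) rminor A t) * \prod_(t <- tm) rminor B t).
Proof.
rewrite /colprod !rmorphM !rmorph_prod /= evP_C; congr (_ * (_ * _)).
  by apply: eq_bigr => t _; apply: evP_rminor11.
by apply: eq_bigr => t _; apply: evP_rminor22.
Qed.

Lemma ev_gen A B c tp tm ab :
  ev A B (extC _ (KP c * colprod tp tm) * thetas Pev ab) =
  extC _ (c * ((\prod_(t <- tp) rminor A t) * \prod_(t <- tm) rminor B t)) * thetas K ab.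
Proof. by rewrite (rmorphM (ev A B)) evC ev_thetas evP_colprod. Qed.

Lemma prod_rminor_lower r (b A : 'M[K]_r) l t : is_trig_mx b ->
  all (fun s => s <= r)%N l -> perm_eq (map size t) l ->
  \prod_(c <- t) rminor (b *m A) c = chi b l * \prod_(c <- t) rminor A c.
Proof.
move=> tb le_l pt; rewrite /chi -(perm_big _ pt) big_map /= -big_split.
rewrite big_seq [RHS]big_seq; apply: eq_bigr => c tc; rewrite rminor_lower //.
by apply: (allP le_l); rewrite -(perm_mem pt) map_f.
Qed.

(** All minors in Q have the same multiset of sizes, so they contribute the
    same factor in every term; the odd variables are untouched. *)
Lemma floor_lower lp lm k Q A B (b : 'M[K]_m) (b' : 'M[K]_n) :
  is_trig_mx b -> is_trig_mx b' ->
  all (fun s => s <= m)%N lp -> all (fun s => s <= n)%N lm ->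
  floor_poly lp lm k Q ->
  ev (b *m A) (b' *m B) Q = extC _ (chi b lp * chi b' lm) * ev A B Q.
Proof.
move=> tb tb' le_p le_m; elim=> [|Q1 Q2 _ IH1 _ IH2|c tp tm ab h1 h2 h3 h4 h5].
- by rewrite !rmorph0 mulr0.
- by rewrite !rmorphD IH1 IH2 mulrDr.
rewrite !ev_gen mulrA -[extC _ _ * extC _ _](rmorphM (@extCr K (m * n))).
congr (extC _ _ * _).
rewrite (prod_rminor_lower _ tb le_p h1) (prod_rminor_lower _ tb' le_m h2).
rewrite (mulrACA (chi b lp)); exact: mulrCA.
Qed.

Lemma thetasE (R : comNzRingType) ab :
  thetas R ab = \prod_(i <- map (fun p => mxvec_index p.1 p.2) ab) extX R i.
Proof. by rewrite big_map; apply: eq_bigr => p _; rewrite mxE. Qed.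

Lemma floor_homog lp lm k Q A B (S : {set 'I_(m * n)}) : floor_poly lp lm k Q ->
  #|S| != k -> ecoef (ev A B Q) S = 0.
Proof.
move=> hQ neS; elim: hQ => [|Q1 Q2 _ IH1 _ IH2|c tp tm ab h1 h2 h3 h4 h5].
- by rewrite rmorph0 ecoef0.
- by rewrite rmorphD ecoefD IH1 IH2 addr0.
rewrite ev_gen [LHS]ecoef_extCM thetasE ecoef_prod_extX ?mulr0 //.
by rewrite size_map h5.
Qed.

(** * Comparison with the floors *)

Lemma Dplus_phiP c : Dplus K m n c = phiP (rminor X11 c).
Proof. by rewrite -rminor_map phiP_X11. Qed.

Lemma Dminus_phiP c : Dminus K m n c = phiP (rminor X22 c).
Proof. by rewrite -rminor_map phiP_X22. Qed.

(** The part of v with possibly negative exponents, common to all vectors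
    of a floor. *)
Definition Delta (lam : weight m n) : QG :=
  phiP (rminor X11 (iota 0 m)) ^ lam.1`_m.-1
  * phiP (rminor X22 (iota 0 n)) ^ lam.2`_n.-1.

Definition cols (r : nat) (mu : r.-tuple int) : seq nat :=
  [seq collen mu c | c <- iota 0 (ncols mu)].

Lemma QG_scaleE (c : K) (x : QG) : c *: x = ofK m n c * x.
Proof. by []. Qed.

Lemma phiP_centralXz p z x : phiP p ^ z * x = x * phiP p ^ z.
Proof.
apply/esym/commrXz; rewrite /GRing.comm; apply/esym; exact: phiP_central.
Qed.

Lemma Delta_central lam x : Delta lam * x = x * Delta lam.
Proof. by apply/esym/commrM; apply/esym/phiP_centralXz. Qed.

(** The order of the determinants is immaterial, since they are images of
    commuting polynomials. *)
Lemma col_product_ex r (D : seq nat -> QG) (X : 'M[Pev]_r) (mu : r.-tuple int) b :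
  (forall c, D c = phiP (rminor X c)) ->
  col_product D mu b <->
  exists tp, [/\ perm_eq (map size tp) (cols mu), all (all (fun a => a < r)%N) tp
               & b = phiP (\prod_(c <- tp) rminor X c)].
Proof.
move=> DE; split=> [[t [ht ->]]|[tp [htp hall ->]]].
  exists (map t (iota 0 (ncols mu))); split.
  - rewrite -map_comp; apply/permP => P; congr (count P _); apply/eq_in_map => c.
    by rewrite mem_iota => /= /ht[].
  - apply/allP => c /mapP[i]; rewrite mem_iota => /= /ht[_ hi] ->; exact: hi.
  - have -> : iota 0 (ncols mu) = index_iota 0 (ncols mu) by rewrite /index_iota subn0.
    by rewrite rmorph_prod big_map big_mkord; apply: eq_bigr => c _; rewrite DE.
have [tp' ptp stp] := perm_map_lift [::] htp.
have szE : size tp' = ncols mu by rewrite -(size_map size) stp size_map size_iota.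
exists (nth [::] tp'); split.
  move=> c lt_c; split.
    by rewrite -(nth_map _ 0%N) ?szE // stp (nth_map 0%N) ?size_iota // nth_iota.
  by apply: (allP hall); rewrite (perm_mem ptp) mem_nth ?szE.
rewrite (perm_big _ ptp) rmorph_prod (big_nth [::]) big_mkord szE.
by apply: eq_bigr => c _; rewrite DE.
Qed.

Lemma H0_ex lam w : H0 lam w -> exists2 Q,
  floor_poly (cols lam.1) (cols lam.2) 0 Q & w = Delta lam * Psi Q.
Proof.
move: w; apply: in_span_ind => [|x y [Q hQ ->] [Q' hQ' ->]|c w].
- by exists 0; [apply: FloorZero | rewrite rmorph0 mulr0].
- by exists (Q + Q'); [apply: FloorAdd | rewrite rmorphD mulrDr].
case=> bp [bm [/(col_product_ex _ _ Dplus_phiP)[tp [h1 h2 ->]]]].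
case=> /(col_product_ex _ _ Dminus_phiP)[tm [h3 h4 ->]] ->.
exists (extC _ (KP c * colprod tp tm) * thetas Pev [::]); first exact: FloorGen.
rewrite /thetas big_nil mulr1 PsiC !rmorphM /= phiP_C !Dplus_phiP !Dminus_phiP.
rewrite QG_scaleE /Delta -phiP_C.
by apply: mul5_comm; rewrite ?phiP_central // phiP_centralXz.
Qed.

Lemma Psi_thetas ab : Psi (thetas Pev ab) = \prod_(p <- ab) Ymx p.1 p.2.
Proof.
rewrite /thetas rmorph_prod; apply: eq_bigr => p _.
by have /matrixP/(_ p.1 p.2) := Psi_Theta m n char0; rewrite [LHS]mxE.
Qed.

(** The definition of the floor carried through Psi. A product of the Y
    with a repeated factor is zero, so sequences of distinct pairs span as
    much as all sequences. *)
Lemma floorH0P lam k x : floorH0 lam k x <->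
  exists2 Q, floor_poly (cols lam.1) (cols lam.2) k Q & x = Delta lam * Psi Q.
Proof.
split.
  move: x; apply: in_span_ind => [|x y [Q hQ ->] [Q' hQ' ->]|c x].
  - by exists 0; [apply: FloorZero | rewrite rmorph0 mulr0].
  - by exists (Q + Q'); [apply: FloorAdd | rewrite (rmorphD Psi) mulrDr].
  case=> w [ab [/H0_ex[Q hQ ->] _ ->]].
  exists (extC _ (KP c) * (Q * thetas Pev ab)).
    apply: floor_scale; have := floor_mul hQ (floor_thetas ab).
    by rewrite !cats0 size_tuple.
  rewrite !rmorphM /= PsiC phiP_C Psi_thetas QG_scaleE.
  by apply: mul3_comm; rewrite Delta_central.
case=> Q hQ ->; elim: hQ => [|Q1 Q2 _ IH1 _ IH2|c tp tm ab h1 h2 h3 h4 h5].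
- by rewrite rmorph0 mulr0; apply: in_span0.
- by rewrite (rmorphD Psi) mulrDr; apply: (in_spanD IH1 IH2).
have -> : Delta lam * Psi (extC _ (KP c * colprod tp tm) * thetas Pev ab) =
    c *: (Delta lam * phiP (colprod tp tm) * \prod_(p <- ab) Ymx p.1 p.2).
  rewrite (rmorphM Psi) Psi_thetas PsiC (rmorphM phiP) /= phiP_C.
  rewrite QG_scaleE (mul3_comm _ _ (esym (Delta_central lam (ofK m n c)))).
  by rewrite (mulrA (ofK m n c)).
case: (boolP (uniq ab)) => uab; last first.
  have -> : \prod_(p <- ab) Ymx p.1 p.2 = 0.
    rewrite -Psi_thetas thetasE; have [b ->] := prod_extX_seq Pev
       (map (fun p => mxvec_index p.1 p.2) ab).
    by rewrite (map_inj_uniq (@mxvec_index_inj m n)) (negbTE uab) rmorph0.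
  by rewrite mulr0 scaler0; apply: in_span0.
apply: in_spanZ_gen; have sab : size ab == k by rewrite h5.
exists (Delta lam * phiP (colprod tp tm)), (Tuple sab); split=> //.
rewrite -[X in H0 _ X]scale1r; apply: in_spanZ_gen.
exists (phiP (\prod_(c <- tp) rminor X11 c)), (phiP (\prod_(c <- tm) rminor X22 c)).
split; first by apply/(col_product_ex _ _ Dplus_phiP); exists tp.
split; first by apply/(col_product_ex _ _ Dminus_phiP); exists tm.
rewrite /Delta /colprod rmorphM /= Dplus_phiP Dminus_phiP.
by apply: mul4_comm'; rewrite phiP_centralXz.
Qed.

End Floor.

(** * Column lengths of a Young diagram *)

Section ColumnLengths.

Lemma count_lt_iota d N : count (fun c => c < d)%N (iota 0 N) = minn d N.
Proof.
elim: N => [|N IH]; first by rewrite minn0.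
by rewrite -addn1 iotaD count_cat IH /= add0n; case: ltnP => h; lia.
Qed.

(** In a decreasing list an upward closed property holds exactly on a
    prefix. *)
Lemma count_prefix (P : int -> bool) (s : seq int) a :
  (forall x y, y <= x -> P y -> P x) -> sorted (fun x y => y <= x) s ->
  (a < size s)%N -> (a < count P s)%N = P s`_a.
Proof.
move=> up; have tr : transitive (fun x y : int => y <= x).
  by move=> y x z yx zy; apply: le_trans zy yx.
elim: s a => [|x s IH] a //= ss lt_a.
have [Px|nPx] := boolP (P x).
  case: a lt_a => [|a] lt_a /=; first by rewrite Px.
  by rewrite add1n ltnS IH // (path_sorted ss).
have all_nP y : y \in s -> ~~ P y.
  move=> sy; apply: contra nPx; apply: up.
  by move: ss; rewrite path_sortedE // => /andP[/allP/(_ _ sy)].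
rewrite add0n (eq_in_count (a2 := pred0)); last by move=> y /all_nP/negbTE->.
rewrite count_pred0; case: a lt_a => [|a] lt_a /=; first by rewrite (negbTE nPx).
by apply/esym/negbTE/all_nP/mem_nth.
Qed.

Definition gap_lengths (g : nat -> nat) (N : nat) : seq nat :=
  flatten [seq nseq (g a) a.+1 | a <- iota 0 N].

Lemma count_gap_lengths g N x :
  count_mem x (gap_lengths g N) = if (0 < x <= N)%N then g x.-1 else 0%N.
Proof.
rewrite /gap_lengths; elim: N => [|N IH]; first by case: x.
rewrite -addn1 iotaD map_cat flatten_cat count_cat IH /= cats0 count_nseq add0n /=.
case: x {IH} => [|x] //=; rewrite eqSS; case: (N =P x) => [<-|ne]; rewrite ?mul1n ?mul0n.
  by rewrite ltnn addn1 leqnn.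
rewrite addn0; have -> // : (x < N)%N = (x < N + 1)%N by lia.
Qed.

Lemma perm_count (s t : seq nat) : (forall x, count_mem x s = count_mem x t) ->
  perm_eq s t.
Proof. by move=> e; apply/allP => x _; apply/eqP. Qed.

Lemma count_flatten_map (T : Type) (f : T -> seq nat) (s : seq T) x :
  count_mem x (flatten (map f s)) = \sum_(p <- s) count_mem x (f p).
Proof. by elim: s => [|p s IH]; rewrite ?big_nil //= count_cat big_cons IH. Qed.

Lemma sum_count (T : Type) (P : pred T) (s : seq T) :
  \sum_(p <- s) (P p : nat) = count P s.
Proof. by elim: s => [|p s IH]; rewrite ?big_nil //= big_cons IH. Qed.

Variables (r : nat) (mu : r.-tuple int).
Hypothesis r_gt0 : (0 < r)%N.
Hypothesis mu_dec : sorted (fun x y : int => y <= x) mu.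

(** The number of columns of length a + 1 in the diagram of mu. *)
Definition gap (a : nat) : nat := absz (mu`_a - mu`_a.+1)%R.

Lemma mu_le a b : (a <= b < r)%N -> mu`_b <= mu`_a.
Proof.
case/andP=> le_ab lt_b; have tr : transitive (fun x y : int => y <= x).
  by move=> y x z yx zy; apply: le_trans zy yx.
apply: (sorted_leq_nth tr _ _ mu_dec) => //; try by move=> x; apply: lexx.
all: by rewrite inE size_tuple; lia.
Qed.

Lemma lt_collen a c : (a < r)%N -> (a < collen mu c)%N = (c%:Z < mu`_a - mu`_r.-1).
Proof.
move=> lt_ar; rewrite /collen count_prefix ?size_tuple //.
by move=> x y le_yx lt_c; lia.
Qed.

Lemma collen_le c : (collen mu c <= r)%N.
Proof. by rewrite -[X in (_ <= X)%N](size_tuple mu) count_size. Qed.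

(** Conjugate partitions: column c has length a + 1 exactly when c lies
    between the two row lengths mu_(a+1) and mu_a, relative to the last
    row. *)
Lemma count_cols x :
  count_mem x (cols mu) = if (0 < x <= r.-1)%N then gap x.-1 else 0%N.
Proof.
rewrite /cols count_map.
pose d a := absz (mu`_a - mu`_r.-1)%R.
have dE a : (a < r)%N -> mu`_a - mu`_r.-1 = d a :> int.
  by move=> lt_ar; rewrite /d; have := @mu_le a r.-1; lia.
have ltE a c : (a < r)%N -> (a < collen mu c)%N = (c < d a)%N.
  by move=> lt_ar; rewrite lt_collen // dE.
have NE : ncols mu = d 0%N by [].
case: x => [|a] /=.
  rewrite (eq_in_count (a2 := pred0)) ?count_pred0 // => c.
  rewrite mem_iota NE add0n /= => lt_c; have := ltE 0%N c r_gt0; lia.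
case: ifP => lt_a; last first.
  rewrite (eq_in_count (a2 := pred0)) ?count_pred0 // => c _ /=.
  have := collen_le c; have := @ltE a c; rewrite /d.
  have [ea|] := eqVneq a r.-1; first by rewrite ea; lia.
  by move=> ?; lia.
have le_d : (d a.+1 <= d a)%N.
  by have := @mu_le a a.+1; have := dE a; have := dE a.+1; lia.
have le_dN : (d a <= ncols mu)%N.
  by rewrite NE; have := @mu_le 0%N a; have := dE 0%N r_gt0; have := dE a; lia.
have : (count (fun c => c < d a) (iota 0 (ncols mu)) =
  count (fun c => c < d a.+1) (iota 0 (ncols mu)) +
  count (preim (collen mu) (pred1 a.+1)) (iota 0 (ncols mu)))%N.
  rewrite -count_predUI.
  rewrite [X in (_ + X)%N](eq_count (a2 := pred0)) ?count_pred0 ?addn0; last first.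
    by move=> c /=; have := @ltE a.+1 c; lia.
  apply: eq_count => c /=; have := @ltE a c; have := @ltE a.+1 c; lia.
rewrite !count_lt_iota /gap.
have -> : mu`_a - mu`_a.+1 = (d a)%:Z - (d a.+1)%:Z.
  by rewrite -!dE ?opprB ?addrA ?subrK; lia.
move: (count _ _) => N'; move: (ncols mu) le_dN => N le_dN; move: le_d.
clear - le_dN; move: (d a) (d a.+1) le_dN => u v; lia.
Qed.

Lemma cols_size_le : all (fun s => s <= r)%N (cols mu).
Proof. by apply/allP => s /mapP[c _ ->]; apply: collen_le. Qed.

End ColumnLengths.

Lemma prod_count (R : comNzRingType) (T : Type) (f : T -> nat) (F : nat -> R) N (s : seq T) :
  \prod_(p <- s) (if (f p < N)%N then F (f p) else 1) =
  \prod_(a < N) F a ^+ count (fun p => f p == a) s.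
Proof.
elim: s => [|p s IH].
  by rewrite big_nil big1.
rewrite big_cons IH /=.
under [RHS]eq_bigr do rewrite exprD.
rewrite big_split /=; congr (_ * _).
case: ifP => lt_f.
  rewrite (bigD1 (Ordinal lt_f)) //= eqxx expr1 big1 ?mulr1 // => a.
  by rewrite -val_eqE /= eq_sym => /negbTE->.
rewrite big1 // => a _; case: eqP => // e.
by move: lt_f; rewrite e ltn_ord.
Qed.

Lemma prod_last (R : pzRingType) r (F : nat -> R) : (0 < r)%N ->
  \prod_(a < r) F a = (\prod_(a < r.-1) F a) * F r.-1.
Proof. by case: r => // r _; rewrite big_ord_recr. Qed.

(** * Semi-invariants and the factorization of rho *)

(** The cancellation in N Theta W: the transforms of N and Theta meet in G
    G' = 1, and that of W absorbs H. *)
Lemma mulmx_transport (R : pzRingType) r s (D N G G' : 'M[R]_r) (T : 'M[R]_(r, s))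
    (H W W' D' : 'M[R]_s) :
  G *m G' = 1%:M -> H *m W = W' *m D' ->
  (D *m (N *m G)) *m (G' *m T *m H) *m W = D *m (N *m T *m W') *m D'.
Proof.
by move=> GG HW; rewrite -!mulmxA HW (mulmxA G) GG mul1mx; congr (_ *m _).
Qed.

Section SemiInvariants.
Variables (K : fieldType) (A : unitAlgType K) (f : {rmorphism A -> A}).
Implicit Types (c d : K) (x y : A).

(** Eigenvectors of a ring endomorphism; eigenvalues multiply, so only the
    factors of pi have to be examined. *)
Definition semi c x : Prop := f x = c *: x.

Lemma semiM c d x y : semi c x -> semi d y -> semi (c * d) (x * y).
Proof.
by rewrite /semi rmorphM => -> ->; rewrite -scalerAl -scalerAr scalerA.
Qed.

Lemma semi1 : semi 1 1.
Proof. by rewrite /semi rmorph1 scale1r. Qed.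

Lemma semi_prod (I : Type) (r : seq I) (c : I -> K) (F : I -> A) :
  (forall i, semi (c i) (F i)) -> semi (\prod_(i <- r) c i) (\prod_(i <- r) F i).
Proof.
move=> h; elim: r => [|i r IH]; first by rewrite !big_nil; apply: semi1.
by rewrite !big_cons; apply: semiM.
Qed.

Lemma semiV c x : x \is a GRing.unit -> c != 0 -> semi c x -> semi c^-1 x^-1.
Proof. by move=> ux c0; rewrite /semi rmorphV // => ->; rewrite invrZ ?unitfE. Qed.

Lemma semiXn c x k : semi c x -> semi (c ^+ k) (x ^+ k).
Proof.
move=> h; elim: k => [|k IH]; first exact: semi1.
by rewrite !exprS; apply: semiM.
Qed.

Lemma semiXz c x (z : int) : x \is a GRing.unit -> c != 0 -> semi c x ->
  semi (c ^ z) (x ^ z).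
Proof.
move=> ux c0 h; case: z => k; first exact: semiXn.
by apply: semiV; rewrite ?unitrX ?expf_neq0 //; apply: semiXn.
Qed.

Lemma semi_combination (I : finType) (P : pred I) (c : K) (d : I -> K) (F : I -> A) :
  (forall a : K, f a%:A = a%:A) -> (forall i, P i -> semi c (F i)) ->
  semi c (\sum_(i | P i) d i *: F i).
Proof.
rewrite /semi => fA fF; rewrite rmorph_sum scaler_sumr; apply: eq_bigr => i Pi.
by rewrite -[d i *: F i]mulr_algl rmorphM fA fF // !mulr_algl !scalerA mulrC.
Qed.

End SemiInvariants.

Section Pi.
Variables (K : fieldType) (m n : nat).
Hypothesis char0 : [pchar K] =i pred0.

Local Notation Pev := {mpoly K[m * m + n * n]}.
Local Notation L R := (extalg R (m * n)).
Local Notation X11 := (X11 K m n).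
Local Notation X22 := (X22 K m n).
Local Notation Ymx := (Ymx K m n).
Local Notation KP := (@mpolyC (m * m + n * n) K).
Local Notation Psi := (Psi m n char0).
Local Notation Theta R := (Theta m n R).
Local Notation phiP := (@phiP K m n).
Local Notation H := (H char0).
Local Notation Gev := (Gev K m n).
Local Notation CM R := (map_mx (@extCr R (m * n))).
Local Notation Lp s := (rminor X11 (iota 0 s)).
Local Notation Lm s := (rminor X22 (iota 0 s)).

(** For the last i the factor D^+(1,...,m) of rho_{i|j} is not a column of
    the diagram, as full columns are collected in Delta; it is split off
    here and cancels against the denominator of pi. *)
Definition dlead (i : nat) : Pev := if (i.+1 < m)%N then 1 else Lp m.
(** The last row of the triangular matrix Nmx X11 is det X11 times a unit
    vector. *)
Definition Nred (i r : 'I_m) : Pev :=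
  if (i.+1 < m)%N then Nmx X11 i r else (r == i)%:R.

Lemma dlead_Nred (i r : 'I_m) : dlead i * Nred i r = Nmx X11 i r.
Proof.
rewrite /dlead /Nred; case: ltnP => [|le_mi]; first by rewrite mul1r.
have ei : i.+1 = m by apply/eqP; rewrite eqn_leq le_mi ltn_ord.
have [->|ne_ri] := eqVneq r i; first by rewrite mulr1 Nmx_diag ei.
rewrite mulr0 Nmx_upper // ltn_neqAle val_eqE ne_ri /= -ltnS ei.
exact: ltn_ord.
Qed.

(** The polynomial model of rho_{i|j} without its factor dlead; rhoF keeps
    it. *)
Definition rhoP (i : 'I_m) (j : 'I_n) : L Pev :=
  \sum_r \sum_s extC _ (Nred i r * Wmx X22 s j) * Theta Pev r s.
Definition rhoF (i : 'I_m) (j : 'I_n) : L Pev :=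
  (CM Pev (Nmx X11) *m Theta Pev *m CM Pev (Wmx X22)) i j.

Lemma rhoF_sum i j :
  rhoF i j = \sum_r \sum_s extC _ (Nmx X11 i r * Wmx X22 s j) * Theta Pev r s.
Proof.
rewrite /rhoF mxE exchange_big; apply: eq_bigr => s _ /=.
rewrite mxE mulr_suml; apply: eq_bigr => r _.
rewrite !map_mx1E -mulrA -extC_commE mulrA; congr (_ * _).
exact/esym/(rmorphM (@extCr Pev (m * n))).
Qed.

Lemma rhoFE i j : rhoF i j = extC _ (dlead i) * rhoP i j.
Proof.
rewrite rhoF_sum /rhoP mulr_sumr; apply: eq_bigr => r _.
rewrite mulr_sumr; apply: eq_bigr => s _; rewrite mulrA; congr (_ * _).
rewrite -dlead_Nred -mulrA; exact: (rmorphM (@extCr Pev (m * n))).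
Qed.

Lemma rho_Psi i j : rho K i j = Psi (rhoF i j).
Proof.
rewrite rhoF_sum rmorph_sum /rho [LHS]big_mkcond; apply: eq_bigr => r _ /=.
rewrite rmorph_sum; case: leqP => [le_ir|lt_ri]; last first.
  apply/esym/big1 => s _; rewrite (Nmx_upper _ lt_ri) mul0r rmorphM /= PsiC.
  by rewrite rmorph0 mul0r.
rewrite mulr_sumr [LHS]big_mkcond; apply: eq_bigr => s _ /=.
have YE : Psi (Theta Pev r s) = Ymx r s.
  by have /matrixP/(_ r s) := Psi_Theta m n char0; rewrite [LHS]mxE.
rewrite (rmorphM Psi) PsiC YE (rmorphM phiP) /=.
rewrite [Wmx X22 s j]mxE; case: ifP => le_sj; last by rewrite rmorph0 mulr0 mul0r.
rewrite [Nmx X11 i r]mxE -Dplus_phiP (rmorphM phiP) /= rmorph_sign -Dminus_phiP.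
by rewrite -!mulrA.
Qed.

(** * Semi-invariance of rho *)

(** The eigenvalue of an upper triangular g on the initial minor of size s. *)
Definition tau r (g : 'M[K]_r) (s : nat) : K := \prod_(l < s) natent g l l.

Lemma natent_KP r (g : 'M[K]_r) s :
  \prod_(l < s) natent (map_mx KP g) l l = KP (tau g s).
Proof. by rewrite /tau rmorph_prod; apply: eq_bigr => l _; apply: natent_map. Qed.

Definition in_BorelP (g : Gev) : Prop :=
  [/\ in_Gev g, is_trig_mx g.1^T & is_trig_mx g.2^T].

Lemma utrig_unit r (g : 'M[K]_r) s : g \in unitmx -> is_trig_mx g^T -> (s <= r)%N ->
  tau g s != 0.
Proof.
rewrite unitmxE -det_tr unitfE => dg tg le_sr; move: dg; rewrite det_trig //.
apply: contra => /eqP t0; apply/eqP; have := t0; rewrite /tau => {}t0.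
have -> : \prod_(i < r) g^T i i = \prod_(l < r) natent g l l.
  by apply: eq_bigr => l _; rewrite natentE mxE.
move/eqP: t0 => /prodf_eq0[l _ /eqP l0].
by rewrite (bigD1 (widen_ord le_sr l)) //= l0 mul0r.
Qed.

Lemma utrig_map r (g : 'M[K]_r) : is_trig_mx g^T -> is_trig_mx (map_mx KP g)^T.
Proof.
move/is_trig_mxP => tg; apply/is_trig_mxP => i j /tg.
by rewrite !mxE => ->; rewrite mpolyC0.
Qed.

Section OneBorel.
Variable g : Gev.
Hypothesis gB : in_BorelP g.

Lemma gB_unit : in_Gev g. Proof. by case: gB. Qed.

Lemma actP_Lp s : (s <= m)%N -> actP g (Lp s) = KP (tau g.1 s) * Lp s.
Proof.
case: gB => _ t1 _ le_sm; rewrite -rminor_map actP_X11.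
by rewrite rminor_iota_upper ?utrig_map // natent_KP mulrC.
Qed.

Lemma actP_Lm s : (s <= n)%N -> actP g (Lm s) = KP (tau g.2 s) * Lm s.
Proof.
case: gB => _ _ t2 le_sn; rewrite -rminor_map actP_X22.
by rewrite rminor_iota_upper ?utrig_map // natent_KP mulrC.
Qed.

Lemma H_CM r s (A : 'M[Pev]_(r, s)) :
  map_mx (H g) (CM Pev A) = CM Pev (map_mx (actP g) A).
Proof. by apply/matrixP => i j; rewrite !mxE; apply: HC. Qed.

Lemma diag_entry (d1 : 'rV[Pev]_m) (d2 : 'rV[Pev]_n) (M : 'M[L Pev]_(m, n)) i j :
  (CM Pev (diag_mx d1) *m M *m CM Pev (diag_mx d2)) i j =
  extC _ (d1 0 i) * extC _ (d2 0 j) * M i j.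
Proof.
rewrite !map_diag_mx mul_mx_diag [LHS]mxE mul_diag_mx [X in X * _]mxE.
rewrite [X in X * _ * _]mxE [X in _ * X]mxE -[LHS]mulrA -[RHS]mulrA.
by congr (_ * _); apply/esym/extC_commE.
Qed.

(** Equivariance of N and of W: N becomes D1 N g1, Theta becomes g1^-1
    Theta g2 and g2 W becomes W D2. *)
Lemma H_rhoF i j : H g (rhoF i j) = extC _ (KP (tau g.1 i * tau g.2 j.+1)) * rhoF i j.
Proof.
case: gB => /andP[u1 u2] t1 t2.
pose D1 : 'M[Pev]_m := diag_mx (\row_i KP (tau g.1 i)).
pose D2 : 'M[Pev]_n := diag_mx (\row_j KP (tau g.2 j.+1)).
have HN : map_mx (H g) (CM Pev (Nmx X11)) =
    CM Pev D1 *m (CM Pev (Nmx X11) *m CM Pev (map_mx KP g.1)).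
  rewrite H_CM -(Nmx_map (@actP K m n g)) actP_X11.
  rewrite -(map_mxM (@extCr Pev (m * n))) -(map_mxM (@extCr Pev (m * n))).
  congr (map_mx _ _); apply/matrixP => i' j'.
  rewrite Nmx_mul_upper ?utrig_map ?lead_X11_neq0 ?natent_KP //.
    by rewrite mul_diag_mx [RHS]mxE; congr (_ * _); rewrite mxE.
  by rewrite mpolyC_eq0; apply: utrig_unit.
have HW : CM Pev (map_mx KP g.2) *m map_mx (H g) (CM Pev (Wmx X22)) =
    CM Pev (Wmx X22) *m CM Pev D2.
  have -> : map_mx (H g) (CM Pev (Wmx X22)) = CM Pev (Wmx (X22 *m map_mx KP g.2)).
    by rewrite H_CM -(Wmx_map (@actP K m n g)) actP_X22.
  rewrite -(map_mxM (@extCr Pev (m * n))) -(map_mxM (@extCr Pev (m * n))).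
  congr (map_mx _ _); apply/matrixP => i' j'.
  rewrite Wmx_mul_upper ?utrig_map ?lead_X22_neq0 ?natent_KP //.
  by rewrite mul_mx_diag [RHS]mxE mulrC; congr (_ * _); rewrite mxE.
have GG : CM Pev (map_mx KP g.1) *m CM Pev (map_mx KP (invmx g.1)) = 1%:M.
  by rewrite -CMKP_mul (mulmxV u1) (map_mx1 KP) (map_mx1 (@extCr Pev (m * n))).
have e : map_mx (H g) (CM Pev (Nmx X11) *m Theta Pev *m CM Pev (Wmx X22)) =
    CM Pev D1 *m (CM Pev (Nmx X11) *m Theta Pev *m CM Pev (Wmx X22)) *m CM Pev D2.
  apply: etrans (map_mxM (H g) _ _) _.
  apply: etrans (congr1 (mulmx^~ _) (map_mxM (H g) _ _)) _.
  by rewrite HN H_Theta; apply: mulmx_transport GG HW.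
have := congr1 (fun M : 'M_(m, n) => M i j) e; rewrite map_mx1E => eij.
apply: etrans eij _; apply: etrans (diag_entry _ _ _ _ _) _.
apply: (congr1 ( *%R^~ (rhoF i j))).
by rewrite 2!mxE mpolyCM; apply/esym/(rmorphM (@extCr Pev (m * n))).
Qed.

Local Notation semi := (semi (actr char0 gB_unit)).

Lemma semi_Lp s : (s <= m)%N -> semi (tau g.1 s) (phiP (Lp s)).
Proof.
move=> le_sm; rewrite /semi actrE -(PsiC char0) act_Psi ?gB_unit //.
by rewrite HC actP_Lp // !PsiC (rmorphM phiP) /= phiP_C.
Qed.

Lemma semi_Lm s : (s <= n)%N -> semi (tau g.2 s) (phiP (Lm s)).
Proof.
move=> le_sn; rewrite /semi actrE -(PsiC char0) act_Psi ?gB_unit //.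
by rewrite HC actP_Lm // !PsiC (rmorphM phiP) /= phiP_C.
Qed.

Lemma semi_rho (i : 'I_m) (j : 'I_n) : semi (tau g.1 i * tau g.2 j.+1) (rho K i j).
Proof.
rewrite /semi actrE rho_Psi act_Psi ?gB_unit // H_rhoF (rmorphM Psi) PsiC phiP_C.
by rewrite -QG_scaleE.
Qed.

Lemma tau1_neq0 s : (s <= m)%N -> tau g.1 s != 0.
Proof. by case: gB => /andP[u1 _] t1 _; apply: utrig_unit. Qed.

Lemma tau2_neq0 s : (s <= n)%N -> tau g.2 s != 0.
Proof. by case: gB => /andP[_ u2] _ t2; apply: utrig_unit. Qed.

End OneBorel.
End Pi.

(** * The weight of pi *)

(** The division in pi: D is the denominator, d the common factor of the
    rho, and D divides M * d with quotient M'. *)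
Lemma cancel_den (R : unitRingType) (Dl M D d M' x : R) :
  D \is a GRing.unit -> M * D = D * M -> M * d = D * M' ->
  Dl * M / D * (d * x) = Dl * (M' * x).
Proof.
move=> uD cMD e; have cMV : M * D^-1 = D^-1 * M.
  by apply: (mulrI uD); rewrite mulrA -cMD -mulrA mulrV // mulr1 mulrA mulrV // mul1r.
by rewrite -!mulrA (mulrA M) cMV -!mulrA (mulrA M) e -!mulrA (mulrA D^-1) mulVr // mul1r.
Qed.

Lemma prod_central (R : nzRingType) (I : Type) (s : seq I) (a x : I -> R) :
  (forall i y, a i * y = y * a i) ->
  \prod_(i <- s) (a i * x i) = (\prod_(i <- s) a i) * \prod_(i <- s) x i.
Proof.
move=> ca; elim: s => [|i s IH]; first by rewrite !big_nil mulr1.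
rewrite !big_cons IH; apply: mul4_comm; elim: s {IH} => [|j s IH].
  by rewrite big_nil mulr1 mul1r.
by rewrite big_cons mulrA -ca -mulrA IH mulrA.
Qed.

Section Torus.
Variables (K : fieldType).

(** Abel summation of exponents: passes from the exponents of the initial
    minors in v to the weight lambda. *)
Lemma telescope_tau (t : nat -> K) (mu : nat -> int) r :
  (forall a, (a < r)%N -> t a != 0) ->
  \prod_(a < r) (\prod_(l < a.+1) t l) ^ (mu a - mu a.+1) =
  (\prod_(a < r) t a ^ mu a) * (\prod_(l < r) t l) ^ (- mu r).
Proof.
elim: r => [|r IH] t0; first by rewrite !big_ord0 exp1rz mulr1.
have P0 : \prod_(l < r) t l != 0.
  by apply/prodf_neq0 => l _; apply: t0; rewrite ltnW // ltnS.
rewrite big_ord_recr /= IH => [|a lt_a]; last by apply: t0; rewrite ltnW.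
rewrite [in RHS]big_ord_recr /= -!mulrA; congr (_ * _).
set P := \prod_(l < r) t l in P0 *.
rewrite big_ord_recr /= -/P; have tr0 := t0 r (ltnSn r).
have Pt0 : P * t r != 0 by rewrite mulf_neq0.
rewrite expfzDr // [LHS]mulrA; congr (_ * _).
by rewrite expfzMl mulrA -expfzDr // addNr expr0z mul1r.
Qed.

(** The contribution to the weight of the symbols of I (with e = -1) or of
    J (with e = 1). *)
Lemma prod_shift r (t : 'I_r -> K) (mu : 'I_r -> int) (T : Type) (f : T -> 'I_r) (s : seq T)
    (e : int) :
  (forall i, t i != 0) ->
  \prod_(i < r) t i ^ (mu i + e * \sum_(p <- s) (f p == i)%:Z) =
  (\prod_(i < r) t i ^ mu i) * \prod_(p <- s) t (f p) ^ e.
Proof.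
move=> t0; elim: s => [|p s IH].
  by rewrite big_nil mulr1; apply: eq_bigr => i _; rewrite big_nil mulr0 addr0.
rewrite [in RHS]big_cons mulrCA -IH (bigD1 (f p)) //= [in RHS](bigD1 (f p)) //= mulrA.
congr (_ * _).
  rewrite big_cons eqxx -expfzDr //; congr (_ ^ _).
  by rewrite mulrDr mulr1 addrCA.
apply: eq_bigr => i ne; rewrite big_cons eq_sym (negbTE ne).
by rewrite add0r.
Qed.

End Torus.

Section PiVectors.
Variables (K : fieldType) (m n : nat).
Hypothesis char0 : [pchar K] =i pred0.

Local Notation X11 := (X11 K m n).
Local Notation X22 := (X22 K m n).
Local Notation phiP := (@phiP K m n).
Local Notation pairs := (seq ('I_m * 'I_n)).
Local Notation Gev := (Gev K m n).
Local Notation Lp s := (rminor X11 (iota 0 s)).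
Local Notation Lm s := (rminor X22 (iota 0 s)).
Implicit Types (lam sigma : weight m n) (KL : pairs).

(** The character of the Borel subgroup attached to the weight sigma. *)
Definition wt (g : Gev) sigma : K :=
  (\prod_(i < m) g.1 i i ^ sigma.1`_i) * \prod_(j < n) g.2 j j ^ sigma.2`_j.

Lemma phiP_Lp_unit s : (s <= m)%N -> phiP (Lp s) \is a GRing.unit.
Proof. by move=> le_sm; apply/phiP_unit/lead_X11_neq0. Qed.

Lemma phiP_Lm_unit s : (s <= n)%N -> phiP (Lm s) \is a GRing.unit.
Proof. by move=> le_sm; apply/phiP_unit/lead_X22_neq0. Qed.

Section OneBorel.
Variable g : Gev.
Hypothesis gB : in_BorelP g.
Local Notation semi := (semi (actr char0 (gB_unit gB))).

Lemma diag1_neq0 i : g.1 i i != 0.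
Proof.
have := tau1_neq0 gB (ltn_ord i); rewrite /tau big_ord_recr mulf_eq0 negb_or /=.
by rewrite natentE => /andP[].
Qed.

Lemma diag2_neq0 j : g.2 j j != 0.
Proof.
have := tau2_neq0 gB (ltn_ord j); rewrite /tau big_ord_recr mulf_eq0 negb_or /=.
by rewrite natentE => /andP[].
Qed.

Lemma semi_vhigh lam : semi
  ((\prod_(a < m) tau g.1 a.+1 ^ (lam.1`_a - lam.1`_a.+1))
   * \prod_(b < n) tau g.2 b.+1 ^ (lam.2`_b - lam.2`_b.+1)) (vhigh K lam).
Proof.
apply: semiM; apply: semi_prod => a; apply: semiXz.
- by rewrite Dplus_phiP; apply: phiP_Lp_unit.
- exact: tau1_neq0.
- by rewrite Dplus_phiP; apply: semi_Lp.
- by rewrite Dminus_phiP; apply: phiP_Lm_unit.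
- exact: tau2_neq0.
- by rewrite Dminus_phiP; apply: semi_Lm.
Qed.

Lemma den_phiP KL :
  (\prod_(p <- KL) Dplus K m n (iota 0 p.1.+1)) * \prod_(p <- KL) Dminus K m n (iota 0 p.2) =
  phiP ((\prod_(p <- KL) Lp p.1.+1) * \prod_(p <- KL) Lm p.2).
Proof.
rewrite rmorphM !rmorph_prod; congr (_ * _); apply: eq_bigr => p _.
  exact: Dplus_phiP.
exact: Dminus_phiP.
Qed.

Lemma den_neq0 KL : (\prod_(p <- KL) Lp p.1.+1) * \prod_(p <- KL) Lm p.2 != 0.
Proof.
apply: mulf_neq0; rewrite prodf_seq_neq0; apply/allP => p _ /=.
  exact: (lead_X11_neq0 K n (ltn_ord p.1)).
exact: (lead_X22_neq0 K m (ltnW (ltn_ord p.2))).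
Qed.

(** The eigenvalues of v, of the minors in the denominator and of the rho
    multiply to the weight lambda_{K|L}: for p = (i, j) in K|L the
    denominator and rho leave the quotient of the j-th diagonal entry of
    g.2 by the i-th diagonal entry of g.1. *)
Lemma semi_piv lam KL : semi (wt g (shift lam KL)) (piv K lam KL).
Proof.
have -> : wt g (shift lam KL) =
  ((\prod_(a < m) tau g.1 a.+1 ^ (lam.1`_a - lam.1`_a.+1))
   * \prod_(b < n) tau g.2 b.+1 ^ (lam.2`_b - lam.2`_b.+1)) *
  ((\prod_(p <- KL) tau g.1 p.1.+1) * \prod_(p <- KL) tau g.2 p.2)^-1 *
  \prod_(p <- KL) (tau g.1 p.1 * tau g.2 p.2.+1).
  have d1 a : (a < m)%N -> natent g.1 a a != 0.
    by move=> lt_a; rewrite -[a]/(val (Ordinal lt_a)) natentE diag1_neq0.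
  have d2 a : (a < n)%N -> natent g.2 a a != 0.
    by move=> lt_a; rewrite -[a]/(val (Ordinal lt_a)) natentE diag2_neq0.
  rewrite /wt (telescope_tau (fun a => lam.1`_a) d1) (telescope_tau (fun a => lam.2`_a) d2).
  rewrite [lam.1`_m]nth_default ?size_tuple // [lam.2`_n]nth_default ?size_tuple //.
  rewrite oppr0 !expr0z !mulr1 big_split /=.
  have -> : \prod_(i < m) g.1 i i ^ (shift lam KL).1`_i =
     (\prod_(a < m) natent g.1 a a ^ lam.1`_a) / \prod_(p <- KL) g.1 p.1 p.1.
    rewrite -prodfV.
    have -> : \prod_(a < m) natent g.1 a a ^ lam.1`_a = \prod_(i < m) g.1 i i ^ lam.1`_i.
      by apply: eq_bigr => i _; rewrite natentE.
    apply: etrans; last exact: (prod_shift (fun i : 'I_m => lam.1`_i)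
       (fun p : 'I_m * 'I_n => p.1) KL (-1) diag1_neq0).
    apply: eq_bigr => i _; congr (_ ^ _).
    by rewrite (nth_mktuple _ _ i) mulN1r.
  have -> : \prod_(j < n) g.2 j j ^ (shift lam KL).2`_j =
     (\prod_(a < n) natent g.2 a a ^ lam.2`_a) * \prod_(p <- KL) g.2 p.2 p.2.
    have -> : \prod_(a < n) natent g.2 a a ^ lam.2`_a = \prod_(i < n) g.2 i i ^ lam.2`_i.
      by apply: eq_bigr => i _; rewrite natentE.
    apply: etrans; last exact: (prod_shift (fun i : 'I_n => lam.2`_i)
       (fun p : 'I_m * 'I_n => p.2) KL 1 diag2_neq0).
    apply: eq_bigr => i _; congr (_ ^ _).
    by rewrite (nth_mktuple _ _ i) mul1r.
  have -> : \prod_(p <- KL) tau g.1 p.1.+1 =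
      (\prod_(p <- KL) tau g.1 p.1) * \prod_(p <- KL) g.1 p.1 p.1.
    by rewrite -big_split; apply: eq_bigr => p _; rewrite /tau big_ord_recr /= natentE.
  have -> : \prod_(p <- KL) tau g.2 p.2.+1 =
      (\prod_(p <- KL) tau g.2 p.2) * \prod_(p <- KL) g.2 p.2 p.2.
    by rewrite -big_split; apply: eq_bigr => p _; rewrite /tau big_ord_recr /= natentE.
  have : \prod_(p <- KL) tau g.1 p.1 != 0.
    by rewrite prodf_seq_neq0; apply/allP => p _; apply: (tau1_neq0 gB); apply: ltnW.
  have : \prod_(p <- KL) tau g.2 p.2 != 0.
    by rewrite prodf_seq_neq0; apply/allP => p _; apply: (tau2_neq0 gB); apply: ltnW.
  have : \prod_(p <- KL) g.1 p.1 p.1 != 0.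
    by rewrite prodf_seq_neq0; apply/allP => p _; apply: diag1_neq0.
  move: (\prod_(a < m) _) (\prod_(a < n) _) (\prod_(p <- KL) g.1 p.1 p.1)
    (\prod_(p <- KL) g.2 p.2 p.2) (\prod_(p <- KL) tau g.1 p.1) (\prod_(p <- KL) tau g.2 p.2).
  by move=> A A' b d a c b0 c0 a0; field; rewrite a0 b0 c0.
rewrite /piv; apply: semiM; last first.
  by apply: semi_prod => p; apply: semi_rho.
apply: semiM; first exact: semi_vhigh.
apply: semiV.
- by rewrite den_phiP; apply/phiP_unit/den_neq0.
- apply: mulf_neq0; rewrite prodf_seq_neq0; apply/allP => p _ /=.
    exact: tau1_neq0.
  by apply: tau2_neq0 => //; apply/ltnW.
- apply: semiM; apply: semi_prod => p.
    by rewrite Dplus_phiP; apply: semi_Lp.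
  by rewrite Dminus_phiP; apply: semi_Lm => //; apply/ltnW.
Qed.

End OneBorel.
End PiVectors.

Lemma mul4_central (R : pzRingType) (A x B y : R) :
  (forall z, A * z = z * A) -> (forall z, B * z = z * B) ->
  A * x * (B * y) = x * y * (A * B).
Proof. by move=> cA cB; rewrite (cB y) (cA x) -!mulrA (mulrA A) (cA y) -!mulrA. Qed.

Section PiInFloor.
Variables (K : fieldType) (m n : nat).
Hypothesis char0 : [pchar K] =i pred0.
Hypothesis m_gt0 : (0 < m)%N.
Hypothesis n_gt0 : (0 < n)%N.

Local Notation Pev := {mpoly K[m * m + n * n]}.
Local Notation L R := (extalg R (m * n)).
Local Notation X11 := (X11 K m n).
Local Notation X22 := (X22 K m n).
Local Notation KP := (@mpolyC (m * m + n * n) K).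
Local Notation Psi := (Psi m n char0).
Local Notation Theta R := (Theta m n R).
Local Notation phiP := (@phiP K m n).
Local Notation pairs := (seq ('I_m * 'I_n)).
Local Notation CM R := (map_mx (@extCr R (m * n))).
Local Notation Lp s := (rminor X11 (iota 0 s)).
Local Notation Lm s := (rminor X22 (iota 0 s)).
Local Notation floor_poly := (@floor_poly K m n).
Local Notation rhoP := (@rhoP K m n).
Local Notation rhoF := (@rhoF K m n).
Local Notation dlead := (@dlead K m n).
Local Notation Nred := (@Nred K m n).
Local Notation Delta := (@Delta K m n).
Local Notation thetas R := (@thetas m n R).
Implicit Types (lam : weight m n) (KL : pairs).

(** The two full minors are left to Delta. *)
Definition monoE (gp gm : nat -> nat) : Pev :=
  (\prod_(a < m.-1) Lp a.+1 ^+ gp a) * \prod_(b < n.-1) Lm b.+1 ^+ gm b.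

Definition cnt1 KL (a : nat) := count (fun p : 'I_m * 'I_n => p.1 == a :> nat) KL.
Definition cnt2 KL (b : nat) := count (fun p : 'I_m * 'I_n => p.2 == b :> nat) KL.

(** The polynomial model of pi: each symbol a of K uses one minor of size a
    + 1 from v, each symbol b + 1 of L one of size b + 1. For robust
    weights the truncated differences are true ones. *)
Definition Qpi lam KL : L Pev :=
  extC _ (monoE (fun a => gap lam.1 a - cnt1 KL a)%N
                (fun b => gap lam.2 b - cnt2 KL b.+1)%N)
  * \prod_(p <- KL) rhoP p.1 p.2.

(** * The vectors pi as values of Psi *)

Lemma prod_leads r (X : 'M[Pev]_r) (mu : r.-tuple int) : (0 < r)%N ->
  sorted (fun x y : int => y <= x) mu ->
  \prod_(a < r) phiP (rminor X (iota 0 a.+1)) ^ (mu`_a - mu`_a.+1) =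
  phiP (\prod_(a < r.-1) rminor X (iota 0 a.+1) ^+ gap mu a)
  * phiP (rminor X (iota 0 r)) ^ mu`_r.-1.
Proof.
move=> r_gt0 mu_dec.
have mu_r : mu`_r = 0 by rewrite nth_default ?size_tuple.
rewrite (prod_last (fun a => phiP (rminor X (iota 0 a.+1)) ^ (mu`_a - mu`_a.+1)) r_gt0).
rewrite (prednK r_gt0) mu_r subr0; apply: (congr1 ( *%R^~ _)).
rewrite rmorph_prod; apply: eq_bigr => a _; rewrite rmorphXn /= /gap.
have le_mu : mu`_a.+1 <= mu`_a.
  by apply: mu_le => //; rewrite leqnSn /= -ltn_predRL.
by rewrite -[mu`_a - mu`_a.+1]gez0_abs ?subr_ge0.
Qed.

Lemma dominantP lam : dominant lam ->
  sorted (fun x y : int => y <= x) lam.1 /\ sorted (fun x y : int => y <= x) lam.2.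
Proof. by case/andP. Qed.

Lemma vhigh_Delta lam : dominant lam ->
  vhigh K lam = Delta lam * phiP (monoE (gap lam.1) (gap lam.2)).
Proof.
move=> /dominantP[dom1 dom2]; rewrite /vhigh /monoE rmorphM.
have -> : \prod_(a < m) Dplus K m n (iota 0 a.+1) ^ (lam.1`_a - lam.1`_a.+1) =
    \prod_(a < m) phiP (Lp a.+1) ^ (lam.1`_a - lam.1`_a.+1).
  by apply: eq_bigr => a _; rewrite Dplus_phiP.
have -> : \prod_(b < n) Dminus K m n (iota 0 b.+1) ^ (lam.2`_b - lam.2`_b.+1) =
    \prod_(b < n) phiP (Lm b.+1) ^ (lam.2`_b - lam.2`_b.+1).
  by apply: eq_bigr => b _; rewrite Dminus_phiP.
rewrite (prod_leads X11 m_gt0 dom1) (prod_leads X22 n_gt0 dom2) /Delta /=.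
by apply: mul4_central => z; apply: phiP_central.
Qed.

Lemma prod_rho KL : \prod_(p <- KL) rho K p.1 p.2 =
  phiP (\prod_(p <- KL) dlead p.1) * Psi (\prod_(p <- KL) rhoP p.1 p.2).
Proof.
rewrite !rmorph_prod.
rewrite -(prod_central _ _ (fun (p : 'I_m * 'I_n) y => phiP_central (dlead p.1) y)).
apply: eq_bigr => p _; rewrite (rho_Psi char0) rhoFE (rmorphM Psi) PsiC.
by [].
Qed.

(** The exponents of each initial minor on both sides are compared; for the
    last symbol of K the factor dlead stands for the missing full minor. *)
Lemma mono_den lam KL :
  (forall a, (a < m.-1)%N -> (cnt1 KL a <= gap lam.1 a)%N) ->
  (forall b, (b < n.-1)%N -> (cnt2 KL b.+1 <= gap lam.2 b)%N) ->
  monoE (gap lam.1) (gap lam.2) * \prod_(p <- KL) dlead p.1 =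
  ((\prod_(p <- KL) Lp p.1.+1) * \prod_(p <- KL) Lm p.2) *
  monoE (fun a => gap lam.1 a - cnt1 KL a)%N (fun b => gap lam.2 b - cnt2 KL b.+1)%N.
Proof.
move=> le1 le2; rewrite /monoE.
have e1 : \prod_(a < m.-1) Lp a.+1 ^+ gap lam.1 a =
   (\prod_(a < m.-1) Lp a.+1 ^+ cnt1 KL a) *
   \prod_(a < m.-1) Lp a.+1 ^+ (gap lam.1 a - cnt1 KL a).
  rewrite -big_split; apply: eq_bigr => a _ /=.
  by rewrite -exprD subnKC // le1.
have e2 : \prod_(b < n.-1) Lm b.+1 ^+ gap lam.2 b =
   (\prod_(b < n.-1) Lm b.+1 ^+ cnt2 KL b.+1) *
   \prod_(b < n.-1) Lm b.+1 ^+ (gap lam.2 b - cnt2 KL b.+1).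
  rewrite -big_split; apply: eq_bigr => a _ /=.
  by rewrite -exprD subnKC // le2.
have e3 : \prod_(p <- KL) Lp p.1.+1 =
    (\prod_(a < m.-1) Lp a.+1 ^+ cnt1 KL a) * \prod_(p <- KL) dlead p.1.
  rewrite -(prod_count (fun p : 'I_m * 'I_n => p.1 : nat) (fun a => Lp a.+1)).
  rewrite -big_split; apply: eq_bigr => p _ /=; rewrite /dlead -ltn_predRL.
  case: ltnP => le_m; first by rewrite mulr1.
  rewrite -[0%N :: iota 1 p.1]/(iota 0 p.1.+1).
  have -> : p.1.+1 = m by apply/eqP; rewrite eqn_leq ltn_ord /=; move: m_gt0 le_m; clear; lia.
  by rewrite mul1r.
have e4 : \prod_(p <- KL) Lm p.2 = \prod_(b < n.-1) Lm b.+1 ^+ cnt2 KL b.+1.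
  transitivity (\prod_(p <- KL) (if (p.2 < n)%N then Lm p.2 else 1)).
    by apply: eq_bigr => p _; rewrite ltn_ord.
  rewrite (prod_count (fun p : 'I_m * 'I_n => p.2 : nat) (fun b => Lm b)).
  have -> : \prod_(a < n) Lm a ^+ count (fun p : 'I_m * 'I_n => p.2 == a :> nat) KL =
     \prod_(a < n.-1.+1) Lm a ^+ count (fun p : 'I_m * 'I_n => p.2 == a :> nat) KL.
    by rewrite prednK.
  by rewrite big_ord_recl rminor_nil expr1n mul1r.
rewrite e1 e2 e3 e4.
by rewrite mulrACA [LHS]mulrAC [X in X * _ = _]mulrAC.
Qed.

(** By mono_den the division in the definition of pi can be carried out
    among polynomials. *)
Lemma piv_Psi lam KL : dominant lam ->
  (forall a, (a < m.-1)%N -> (cnt1 KL a <= gap lam.1 a)%N) ->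
  (forall b, (b < n.-1)%N -> (cnt2 KL b.+1 <= gap lam.2 b)%N) ->
  piv K lam KL = Delta lam * Psi (Qpi lam KL).
Proof.
move=> dom le1 le2; rewrite /piv den_phiP (vhigh_Delta dom) prod_rho.
rewrite /Qpi (rmorphM Psi) PsiC; apply: cancel_den.
- exact/phiP_unit/den_neq0.
- exact: phiP_central.
- apply: etrans (esym (rmorphM phiP _ _)) _; rewrite (mono_den le1 le2).
  exact: (rmorphM phiP).
Qed.

(** * The vectors pi belong to the floor *)

Lemma floor_mono gp gm :
  floor_poly (gap_lengths gp m.-1) (gap_lengths gm n.-1) 0 (extC _ (monoE gp gm)).
Proof.
pose lst (g : nat -> nat) N := flatten [seq nseq (g a) (iota 0 a.+1) | a <- iota 0 N].
have szL g N : map size (lst g N) = gap_lengths g N.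
  rewrite /lst /gap_lengths map_flatten -map_comp; congr flatten; apply: eq_map => a /=.
  by rewrite map_nseq /= size_iota.
have allL g N r : (N <= r)%N -> all (all (fun a => a < r)%N) (lst g N).
  move=> le_Nr; apply/allP => c /flattenP[s /mapP[a]]; rewrite mem_iota => /= lt_a ->.
  rewrite mem_nseq => /andP[_ /eqP->]; apply/allP => x; rewrite -[0 :: _]/(iota 0 a.+1).
  by rewrite mem_iota /= => lt_x; lia.
have prodL (r : nat) (X : 'M[Pev]_r) g N :
    \prod_(c <- lst g N) rminor X c = \prod_(a < N) rminor X (iota 0 a.+1) ^+ g a.
  rewrite /lst big_flatten big_map -(big_mkord xpredT (fun a => rminor X (iota 0 a.+1) ^+ g a)).
  rewrite /index_iota subn0; apply: eq_bigr => a _.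
  by rewrite big_nseq iter_mulr_1.
rewrite -(szL gp) -(szL gm) /monoE -!prodL; apply: floor_colprod; apply: allL; exact: leq_pred.
Qed.

(** The sizes of the minors in rhoP: one minor of X11 and one of X22, each
    absent in an extreme case. *)
Definition len1 (i : nat) : seq nat := if (i.+1 < m)%N then [:: i.+1] else [::].
Definition len2 (j : nat) : seq nat := if j == 0%N then [::] else [:: j].

Lemma Nred_minors i r : exists c tp, [/\ Nred i r = KP c * \prod_(t <- tp) rminor X11 t,
  map size tp = len1 i \/ c = 0 & all (all (fun a => a < m)%N) tp].
Proof.
rewrite /Nred /len1; case: ifP => lt_i.
  exists 1, [:: rcons (iota 0 i) r]; rewrite big_seq1 mpolyC1 mul1r mxE; split=> //.
    by left; rewrite /= size_rcons size_iota.
  rewrite /= andbT; apply/allP => x; rewrite mem_rcons inE mem_iota => /orP[/eqP->|/= lt_x].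
    exact: ltn_ord.
  by have := ltn_ord i; move: lt_x; clear; lia.
exists (r == i)%:R, [::]; rewrite big_nil mulr1; split=> //; last by left.
by case: eqP => _; rewrite ?mpolyC1 ?mpolyC0.
Qed.

Lemma Wmx_minors s j : exists c tm, [/\ Wmx X22 s j = KP c * \prod_(t <- tm) rminor X22 t,
  map size tm = len2 j \/ c = 0 & all (all (fun a => a < n)%N) tm].
Proof.
rewrite mxE /len2; case: ifP => le_sj; last first.
  by exists 0, [::]; rewrite mpolyC0 mul0r; split=> //; right.
case: eqP => [j0|/eqP j0].
  have s0 : s = 0%N :> nat by apply/eqP; rewrite -leqn0 -j0.
  exists 1, [::]; rewrite big_nil mpolyC1 mulr1 j0 s0 /= rminor_nil mul1r.
  by split=> //; left.
exists ((-1) ^+ (s + j)), [:: [seq t <- iota 0 j.+1 | t != s :> nat]].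
rewrite big_seq1 rmorph_sign; split=> //.
  by left; congr (_ :: _); rewrite filter_iota_neq // size_cat !size_iota subnKC.
rewrite all_seq1; apply/allP => x; rewrite mem_filter mem_iota => /andP[_ /= lt_x].
exact: leq_trans lt_x (ltn_ord j).
Qed.

Lemma floor_rhoP (i : 'I_m) (j : 'I_n) : floor_poly (len1 i) (len2 j) 1 (rhoP i j).
Proof.
apply: floor_sum => r _; apply: floor_sum => s _.
have [c [tp [-> h1 h2]]] := Nred_minors i r.
have [d [tm [-> h3 h4]]] := Wmx_minors s j.
have -> : KP c * \prod_(t <- tp) rminor X11 t * (KP d * \prod_(t <- tm) rminor X22 t) =
    KP (c * d) * colprod K m n tp tm by rewrite mpolyCM mulrACA.
have zero : c * d = 0 -> floor_poly (len1 i) (len2 j) 1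
    (extC _ (KP (c * d) * colprod K m n tp tm) * Theta Pev r s).
  move=> ->; rewrite mpolyC0 mul0r -[extC _ 0]/(@extCr Pev (m * n) 0) rmorph0 mul0r.
  exact: FloorZero.
case: h1 => [h1|c0]; last by apply: zero; rewrite c0 mul0r.
case: h3 => [h3|d0]; last by apply: zero; rewrite d0 mulr0.
have -> : Theta Pev r s = thetas Pev [:: (r, s)] by rewrite [RHS]big_seq1.
by apply: FloorGen; rewrite ?h1 ?h3.
Qed.

Lemma floor_prod_rhoP KL : floor_poly (flatten [seq len1 p.1 | p : 'I_m * 'I_n <- KL])
  (flatten [seq len2 p.2 | p : 'I_m * 'I_n <- KL]) (size KL) (\prod_(p <- KL) rhoP p.1 p.2).
Proof.
elim: KL => [|p KL IH].
  have e : thetas Pev [::] = 1 by apply: big_nil.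
  by rewrite big_nil -e; apply: (@floor_thetas K m n [::]).
by rewrite big_cons; have := floor_mul (floor_rhoP p.1 p.2) IH; rewrite add1n.
Qed.

(** The minors of the rho replace those removed from v, size by size, so
    that the column lengths are again those of the diagram of lambda. *)
Lemma floor_Qpi lam KL : dominant lam ->
  (forall a, (a < m.-1)%N -> (cnt1 KL a <= gap lam.1 a)%N) ->
  (forall b, (b < n.-1)%N -> (cnt2 KL b.+1 <= gap lam.2 b)%N) ->
  floor_poly (cols lam.1) (cols lam.2) (size KL) (Qpi lam KL).
Proof.
move=> /dominantP[dom1 dom2] le1 le2.
have := floor_mul (floor_mono (fun a => gap lam.1 a - cnt1 KL a)%N
  (fun b => gap lam.2 b - cnt2 KL b.+1)%N) (floor_prod_rhoP KL).
rewrite add0n; apply: floor_perm.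
  apply: perm_count => x; rewrite count_cat count_gap_lengths count_cols //.
  rewrite count_flatten_map.
  have -> : (\sum_(p <- KL) count_mem x (len1 p.1) =
      if (0 < x <= m.-1)%N then cnt1 KL x.-1 else 0)%N.
    rewrite /cnt1 -sum_count; case: ifP => lt_x.
      apply: eq_bigr => p _; rewrite /len1; case: ifP => /= lt_p; last first.
        by case: eqP => // e; move: lt_x lt_p e; clear; lia.
      by rewrite addn0; case: x lt_x => // x _; rewrite eqSS.
    rewrite big1 // => p _; rewrite /len1; case: ifP => //= lt_p.
    by rewrite addn0; case: eqP => // e; move: lt_x lt_p e; clear; lia.
  case: ifP => lt_x //; rewrite subnK // le1 //.
  by move: lt_x; clear -m_gt0; case: x => // x; lia.
apply: perm_count => x; rewrite count_cat count_gap_lengths count_cols //.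
rewrite count_flatten_map.
have -> : (\sum_(p <- KL) count_mem x (len2 p.2) =
    if (0 < x <= n.-1)%N then cnt2 KL x.-1.+1 else 0)%N.
  rewrite /cnt2 -sum_count; case: ifP => lt_x.
    apply: eq_bigr => p _; rewrite /len2; case: x lt_x => // x _ /=.
    by case: ifP => /= [/eqP->//|_]; rewrite addn0.
  rewrite big1 // => p _; rewrite /len2; case: eqP => //= /eqP p0.
  rewrite addn0; case: eqP => // e; move: lt_x p0 e.
  by have := ltn_ord p.2; clear; lia.
case: ifP => lt_x //; rewrite subnK // le2 //.
by move: lt_x; clear -n_gt0; case: x => // x; lia.
Qed.

(** * The value of pi at the identity *)

Lemma ev1_extC p : evP 1%:M 1%:M p = 1 -> ev (1%:M : 'M[K]_m) (1%:M : 'M[K]_n) (extC _ p) = 1.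
Proof. by move=> e; rewrite evC e. Qed.

Lemma evP1_Lp s : (s <= m)%N -> evP 1%:M 1%:M (Lp s) = 1.
Proof. by move=> le_s; rewrite evP_rminor11 rminor_iota1. Qed.

Lemma evP1_Lm s : (s <= n)%N -> evP 1%:M 1%:M (Lm s) = 1.
Proof. by move=> le_s; rewrite evP_rminor22 rminor_iota1. Qed.

(** At the identity N and W are the identity. *)
Lemma ev1_rhoP (i : 'I_m) (j : 'I_n) : ev 1%:M 1%:M (rhoP i j) = Theta K i j.
Proof.
have eF : ev 1%:M 1%:M (rhoF i j) = Theta K i j.
  have e : map_mx (ev (1%:M : 'M[K]_m) (1%:M : 'M[K]_n))
     (CM Pev (Nmx X11) *m Theta Pev *m CM Pev (Wmx X22)) = Theta K.
    have eCM r (A : 'M[Pev]_r) : map_mx (ev (1%:M : 'M[K]_m) (1%:M : 'M[K]_n)) (CM Pev A) =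
        CM K (map_mx (evP 1%:M 1%:M) A).
      by apply/matrixP => x y; rewrite !mxE; apply: evC.
    rewrite !(map_mxM (ev _ _)) !eCM -Nmx_map -Wmx_map evP_X11 evP_X22 Nmx1 Wmx1 ev_Theta.
    by rewrite !map_mx1 mul1mx mulmx1.
  by have := congr1 (fun M : 'M_(m, n) => M i j) e; rewrite map_mx1E.
rewrite -eF rhoFE (rmorphM (ev _ _)) /= ev1_extC ?mul1r // /dlead.
by case: ifP => _; rewrite ?rmorph1 ?evP1_Lp.
Qed.

Lemma ev1_Qpi lam KL : ev 1%:M 1%:M (Qpi lam KL) = thetas K KL.
Proof.
rewrite /Qpi (rmorphM (ev _ _)) /= ev1_extC ?mul1r.
  by rewrite rmorph_prod; apply: eq_bigr => p _; apply: ev1_rhoP.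
rewrite /monoE rmorphM !rmorph_prod [X in X * _]big1 ?mul1r => [|a _].
  apply: big1 => b _; rewrite rmorphXn.
  apply: etrans (congr1 (fun z => z ^+ _) (evP1_Lm _)) (expr1n _ _).
  by have := ltn_ord b; clear; lia.
rewrite rmorphXn; apply: etrans (congr1 (fun z => z ^+ _) (evP1_Lp _)) (expr1n _ _).
by have := ltn_ord a; clear; lia.
Qed.

End PiInFloor.

(** * Diagonalizing upper triangular matrices *)

Section Triangular.
Variables (K : fieldType).

Lemma utrig_block n (d : K) (w : 'M[K]_(1, n)) (T : 'M[K]_n) :
  is_trig_mx (block_mx d%:M w 0 T : 'M_(1 + n))^T = is_trig_mx T^T.
Proof.
rewrite tr_block_mx trmx0 tr_scalar_mx; apply/is_trig_mxP/is_trig_mxP => h i j lt_ij.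
  have := h (rshift 1 i) (rshift 1 j); rewrite block_mxEdr; apply.
  by rewrite /= ltn_add2l.
case: (split_ordP i) lt_ij => i' ->; case: (split_ordP j) => j' -> lt_ij.
- by move: lt_ij; rewrite !ord1 ltnn.
- by rewrite block_mxEur mxE.
- by move: lt_ij; rewrite /= ord1.
- by rewrite block_mxEdr h //; move: lt_ij; rewrite /= ltn_add2l.
Qed.

(** Peeling off the first row and column leaves a row vector y with y_j
    (T_jj - d) prescribed, which can be solved because the diagonal entries
    differ. *)
Lemma utrig_diag n (T : 'M[K]_n) : is_trig_mx T^T ->
  injective (fun i => T i i) ->
  exists2 h : 'M[K]_n, h \in unitmx /\ is_trig_mx h^T &
    T *m h = h *m diag_mx (\row_i T i i).
Proof.
elim: n T => [|n IH] T tT injT.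
  exists 1%:M; first by rewrite unitmx1 trmx1 scalar_mx_is_trig.
  by apply/matrixP; case.
pose d := T 0 0; pose w := ursubmx (T : 'M_(1 + n)).
pose T' := drsubmx (T : 'M_(1 + n)).
have TE : T = block_mx d%:M w 0 T' :> 'M_(1 + n).
  rewrite -[LHS](submxK (T : 'M_(1 + n))); congr block_mx.
    by apply/matrixP => i j; rewrite !ord1 !mxE eqxx /d; congr (T _ _); apply: val_inj.
  apply/matrixP => i j; rewrite !mxE; have /is_trig_mxP := tT => /(_ (lshift n j) (rshift 1 i)).
  rewrite mxE; apply; rewrite /= ord1; exact: ltn_addr.
have tT' : is_trig_mx T'^T by move: tT; rewrite {1}TE utrig_block.
have injT' : injective (fun i => T' i i).
  by move=> i j; rewrite !mxE => /injT e; apply: (@rshift_inj 1 n).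
have [h' [uh th] Th'] := IH T' tT' injT'.
pose y : 'M[K]_(1, n) := \row_j ((w *m h') 0 j / (T' j j - d)).
exists (block_mx 1%:M y 0 h' : 'M_(1 + n)).
  split; last by rewrite utrig_block.
  have : block_mx 1%:M y 0 h' \in unitmx by rewrite unitmxE det_ublock det1 mul1r -unitmxE.
  by [].
have dE : diag_mx (\row_i T i i) =
    block_mx d%:M 0 0 (diag_mx (\row_i T' i i)) :> 'M_(1 + n).
  apply/matrixP => i j; case: (split_ordP i) => i' ->; case: (split_ordP j) => j' ->.
  - by rewrite block_mxEul !mxE !ord1 /d; congr (T _ _ *+ _); apply: val_inj.
  - by rewrite block_mxEur !mxE -val_eqE /= ord1.
  - by rewrite block_mxEdl !mxE -val_eqE /= ord1.
  - by rewrite block_mxEdr !mxE -val_eqE /= eqn_add2l.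
have e : (block_mx d%:M w 0 T' : 'M_(1 + n)) *m block_mx 1%:M y 0 h' =
    block_mx 1%:M y 0 h' *m block_mx d%:M 0 0 (diag_mx (\row_i T' i i)).
  rewrite !mulmx_block !mulmx0 !mul0mx !mul1mx !addr0 !add0r mulmx1 Th'.
  congr block_mx; apply/matrixP => i j; rewrite ord1 mxE mul_scalar_mx mul_mx_diag.
  rewrite [in RHS]mxE [X in _ = _ * X]mxE [X in X + _]mxE [in RHS]mxE [y 0 j]mxE.
  have nz : T' j j - d != 0.
    rewrite subr_eq0 /T' /d !mxE; apply/eqP => e.
    by have := injT _ _ e => /(congr1 val).
  set z := (w *m h') 0 j; rewrite -[X in _ + X](divfK nz) mulrBr addrC mulrC.
  by rewrite [d * _]mulrC subrK.
by rewrite dE {1}TE; exact: e.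
Qed.

End Triangular.

Section Characters.
Variables (K : fieldType) (m n : nat).
Hypothesis char0 : [pchar K] =i pred0.

Local Notation Pev := {mpoly K[m * m + n * n]}.
Local Notation L R := (extalg R (m * n)).
Local Notation KP := (@mpolyC (m * m + n * n) K).
Local Notation Gev := (Gev K m n).
Local Notation H := (H char0).
Implicit Types (lam sigma : weight m n) (g h : Gev) (Q : L Pev) (c d : K).

(** Scalar multiplication on the polynomial models. *)
Definition kmul c Q : L Pev := extC _ (KP c) * Q.

Lemma kmulM c d Q : kmul c (kmul d Q) = kmul (c * d) Q.
Proof.
rewrite /kmul mulrA mpolyCM; apply: (congr1 ( *%R^~ Q)).
exact/esym/(rmorphM (@extCr Pev (m * n))).
Qed.

Lemma kmul1 Q : kmul 1 Q = Q. Proof. exact: mul1r. Qed.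

Lemma ecoef_kmul c Q S : ecoef (kmul c Q) S = KP c * ecoef Q S.
Proof. exact: ecoef_extCM. Qed.

Lemma kmul_inj c d Q : Q <> 0 -> kmul c Q = kmul d Q -> c = d.
Proof.
move=> Q0 e; apply/eqP; rewrite -subr_eq0; apply/negP => ncd; apply: Q0.
apply: ecoefP => S; rewrite ecoef0; apply/eqP.
have eS : KP c * ecoef Q S = KP d * ecoef Q S.
  have e1 := ecoef_kmul c Q S; have e2 := ecoef_kmul d Q S.
  by rewrite e in e1; rewrite -e1 -e2.
move/eqP: eS; rewrite -subr_eq0 -mulrBl -mpolyCB mulf_eq0 mpolyC_eq0 => /orP[cd|//].
by rewrite cd in ncd.
Qed.

Lemma H_kmul g c Q : H g (kmul c Q) = kmul c (H g Q).
Proof.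
rewrite /kmul (rmorphM (H g)); apply: (congr1 ( *%R^~ _)); apply: etrans (HC _ _ _) _.
by rewrite actP_C.
Qed.

Lemma H_kmul_eigen g c Q : H g Q = kmul c Q ->
  forall d, H g (kmul d Q) = kmul (d * c) Q.
Proof.
move=> e d; apply: etrans (H_kmul g d Q) _.
apply: etrans (congr1 (kmul d) e) _; exact: kmulM.
Qed.

Definition gmul g h : Gev := (g.1 *m h.1, g.2 *m h.2).

Lemma gmul_unit g h : in_Gev g -> in_Gev h -> in_Gev (gmul g h).
Proof.
by case/andP=> g1 g2 /andP[h1 h2]; apply/andP; rewrite /= !unitmx_mul g1 g2 h1 h2.
Qed.

Lemma H_gmul g h Q : in_Gev g -> in_Gev h -> H g (H h Q) = H (gmul g h) Q.
Proof. exact: H_mul. Qed.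

Lemma ev_kmul (A : 'M[K]_m) (B : 'M[K]_n) c Q :
  ev A B (kmul c Q) = extC _ c * ev A B Q.
Proof. by rewrite /kmul (rmorphM (ev A B)) evC evP_C. Qed.

Lemma ev_eq0 Q : (forall (A : 'M[K]_m) (B : 'M[K]_n), ev A B Q = 0) -> Q = 0.
Proof.
move=> ev0; apply: ecoefP => S; rewrite ecoef0; apply: (evP_eq0 char0) => A B.
by rewrite -(ecoef_coefmap (evP A B)) -[coefmap _ _]/(ev A B) ev0 ecoef0.
Qed.

Lemma H_inj g Q : in_Gev g -> H g Q = 0 -> Q = 0.
Proof.
move=> ug HQ; have /andP[u1 u2] := ug; apply: ev_eq0 => A B.
apply: (sub_inj (char0 := char0) ug).
have := ev_H char0 g (A *m invmx g.1) (B *m invmx g.2) Q.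
rewrite HQ (rmorph0 (ev _ _)) (mulmxKV u1) (mulmxKV u2); exact: esym.
Qed.

(** * Characters of the Borel subgroup *)

Lemma diag_utrig r (d : 'rV[K]_r) : is_trig_mx (diag_mx d)^T.
Proof. by rewrite tr_diag_mx; apply: diag_mx_is_trig. Qed.

Lemma diag_unit r (d : 'rV[K]_r) : (forall i, d 0 i != 0) -> diag_mx d \in unitmx.
Proof.
move=> d0; rewrite unitmxE det_diag unitfE; apply/prodf_neq0 => i _; exact: d0.
Qed.

Lemma utrig_mul r (A B : 'M[K]_r) : is_trig_mx A^T -> is_trig_mx B^T ->
  is_trig_mx (A *m B)^T.
Proof.
move=> /is_trig_mxP tA /is_trig_mxP tB; apply/is_trig_mxP => i j lt_ij.
rewrite !mxE big1 // => l _; have [lt_il|le_li] := ltnP i l.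
  by have := tB i l lt_il; rewrite mxE => ->; rewrite mulr0.
by have := tA l j (leq_ltn_trans le_li lt_ij); rewrite mxE => ->; rewrite mul0r.
Qed.

Lemma diag_utrig_mul r (A B : 'M[K]_r) i : is_trig_mx A^T -> is_trig_mx B^T ->
  (A *m B) i i = A i i * B i i.
Proof.
move=> /is_trig_mxP tA /is_trig_mxP tB; rewrite mxE (bigD1 i) //= big1 ?addr0 // => l ne.
have [lt_il|lt_li|/val_inj e] := ltngtP i l; last by rewrite e eqxx in ne.
  by have := tB i l lt_il; rewrite mxE => ->; rewrite mulr0.
by have := tA l i lt_li; rewrite mxE => ->; rewrite mul0r.
Qed.

Definition gdiag g : Gev := (diag_mx (\row_i g.1 i i), diag_mx (\row_j g.2 j j)).

Lemma gdiag_Borel g : in_BorelP g -> in_BorelP (gdiag g).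
Proof.
move=> gB; split; [apply/andP; split; apply: diag_unit => i | exact: diag_utrig..].
  by rewrite mxE; apply: diag1_neq0 gB i.
by rewrite mxE; apply: diag2_neq0 gB i.
Qed.

(** The diagonal of D g is 1, 2, ..., r, whose entries are distinct in
    characteristic 0. *)
Lemma borel_diag r (g : 'M[K]_r) : g \in unitmx -> is_trig_mx g^T ->
  (forall i, g i i != 0) ->
  exists D h : 'M[K]_r, [/\ D \in unitmx, is_trig_mx D^T, h \in unitmx, is_trig_mx h^T
    & D *m g *m h = h *m (D *m diag_mx (\row_i g i i))].
Proof.
move=> ug tg d0; (* The torus element that makes the diagonal of D g equal to 1, 2, ..., r. *)
pose D := diag_mx (\row_i (i.+1%:R / g i i)) : 'M[K]_r.
have n0 k : k.+1%:R != 0 :> K by rewrite (natr_eq0_char0 char0).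
have uD : D \in unitmx by apply: diag_unit => i; rewrite mxE mulf_neq0 ?invr_eq0.
have tD : is_trig_mx D^T by apply: diag_utrig.
have dDg i : (D *m g) i i = i.+1%:R.
  by rewrite diag_utrig_mul // !mxE eqxx mulr1n divfK.
have inj : injective (fun i => (D *m g) i i).
  by move=> i j; rewrite !dDg => /(natr_inj_char0 char0) [] /val_inj.
have [h [uh th] e] := utrig_diag (utrig_mul tD tg) inj.
exists D, h; split=> //; rewrite e; congr (_ *m _).
rewrite mulmx_diag; congr diag_mx; apply/rowP => i.
by rewrite [LHS]mxE dDg !mxE divfK.
Qed.

(** Comparing the eigenvalues on both sides of (D g) h = h (D d), where d
    is the diagonal of g, those of D and h cancel. *)
Lemma borel_char Q : Q <> 0 ->
  (forall g, in_BorelP g -> exists c, H g Q = kmul c Q) ->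
  forall g, in_BorelP g -> H g Q = H (gdiag g) Q.
Proof.
move=> Q0 semiQ g gB; have [/andP[u1 u2] t1 t2] := gB.
have [D1 [h1 [uD1 tD1 uh1 th1 e1]]] := borel_diag u1 t1 (diag1_neq0 gB).
have [D2 [h2 [uD2 tD2 uh2 th2 e2]]] := borel_diag u2 t2 (diag2_neq0 gB).
pose D : Gev := (D1, D2); pose h : Gev := (h1, h2).
have DB : in_BorelP D by split=> //; apply/andP.
have hB : in_BorelP h by split=> //; apply/andP.
have dB := gdiag_Borel gB.
have nz g' c : in_BorelP g' -> H g' Q = kmul c Q -> c != 0.
  case=> ug' _ _ e; apply/eqP => c0; apply: Q0; apply: (H_inj ug').
  by rewrite e c0 /kmul mpolyC0 -[extC _ 0]/(@extCr Pev (m * n) 0) rmorph0 mul0r.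
have [cD eD] := semiQ D DB; have [ch eh] := semiQ h hB.
have [cg eg] := semiQ g gB; have [cd ed] := semiQ (gdiag g) dB.
have [uD _ _] := DB; have [uh _ _] := hB; have [ug _ _] := gB; have [ud _ _] := dB.
have uDg := gmul_unit uD ug; have uDd := gmul_unit uD ud.
have eL : H D (H g (H h Q)) = H (gmul (gmul D g) h) Q.
  apply: etrans (H_gmul (H h Q) uD ug) _; exact: (H_gmul Q uDg uh).
have eR : H h (H D (H (gdiag g) Q)) = H (gmul h (gmul D (gdiag g))) Q.
  apply: etrans (congr1 (H h) (H_gmul Q uD ud)) _; exact: (H_gmul Q uh uDd).
have eg2 : gmul (gmul D g) h = gmul h (gmul D (gdiag g)).
  by congr (_, _); [exact: e1 | exact: e2].
have cL : H D (H g (H h Q)) = kmul (ch * cg * cD) Q.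
  apply: etrans (congr1 (H D \o H g) eh) _.
  exact: etrans (congr1 (H D) (H_kmul_eigen eg _)) (H_kmul_eigen eD _).
have cR : H h (H D (H (gdiag g) Q)) = kmul (cd * cD * ch) Q.
  apply: etrans (congr1 (H h \o H D) ed) _.
  exact: etrans (congr1 (H h) (H_kmul_eigen eD _)) (H_kmul_eigen eh _).
have ec : ch * cg * cD = cd * cD * ch.
  apply: (kmul_inj Q0); apply: etrans (esym cL) _; apply: etrans _ cR.
  by apply: etrans eL _; apply: etrans _ (esym eR); rewrite eg2.
apply: etrans eg _; apply: etrans _ (esym ed).
have chD : ch * cD != 0 by rewrite mulf_neq0 ?(nz _ _ hB eh) ?(nz _ _ DB eD).
have ecd : cg = cd by apply: (mulfI chD); rewrite mulrAC ec mulrC mulrA mulrAC.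
exact: (congr1 (kmul^~ Q) ecd).
Qed.

End Characters.

(** * Eigenvectors of the Borel subgroup *)

Section DiagonalSubstitution.
Variables (R : comNzRingType) (p : nat) (f : {rmorphism extalg R p -> extalg R p}).
Variable w : 'I_p -> R.
Hypothesis fC : forall a, f (extC p a) = extC p a.
Hypothesis fX : forall i, f (extX R i) = extC p (w i) * extX R i.

(** Scaling the odd generators scales each monomial. *)
Lemma ecoef_diag_subst x S : ecoef (f x) S = (\prod_(i in S) w i) * ecoef x S.
Proof.
have fW (T : {set 'I_p}) : f (\prod_(i in T) extX R i) = 
    extC p (\prod_(i in T) w i) * \prod_(i in T) extX R i.
  elim/set_min_ind: T => [|i T min_i IH]; first by rewrite !big_set0 rmorph1 mulr1.
  have niT : i \notin T by apply/negP => /min_i; rewrite ltnn.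
  rewrite (oprod_min _ min_i) rmorphM IH fX (big_setU1 _ niT) /=.
  rewrite [extC p (w i * _)](rmorphM (@extCr R p)).
  by apply: mul4_comm; exact/esym/extC_commE.
rewrite {1}[x]ext_expand rmorph_sum ecoef_sum (bigD1 S) //= [X in _ + X]big1 ?addr0.
  rewrite rmorphM fW fC [LHS]ecoef_extCM [X in _ * X]ecoef_extCM ecoef_wedge eqxx mulr1.
  exact: mulrC.
move=> T nT; rewrite rmorphM fW fC [LHS]ecoef_extCM [X in _ * X]ecoef_extCM ecoef_wedge.
by rewrite eq_sym (negbTE nT) !mulr0.
Qed.

End DiagonalSubstitution.

Section Weights.
Variables (K : fieldType) (m n : nat).
Hypothesis char0 : [pchar K] =i pred0.

Local Notation Pev := {mpoly K[m * m + n * n]}.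
Local Notation L R := (extalg R (m * n)).
Local Notation Psi := (Psi m n char0).
Local Notation Gev := (Gev K m n).
Local Notation Delta := (@Delta K m n).
Local Notation kmul := (@kmul K m n).
Local Notation pairs := (seq ('I_m * 'I_n)).
Implicit Types (lam sigma : weight m n) (g h : Gev) (Q : L Pev) (c d : K) (KL : pairs).

(** The eigenvalue of g on Delta. *)
Definition delta lam g : K := tau g.1 m ^ lam.1`_m.-1 * tau g.2 n ^ lam.2`_n.-1.

Lemma delta_neq0 lam g : in_BorelP g -> delta lam g != 0.
Proof.
by move=> gB; rewrite mulf_neq0 // expfz_neq0 ?(tau1_neq0 gB) ?(tau2_neq0 gB).
Qed.

Lemma Delta_unit lam : Delta lam \is a GRing.unit.
Proof.
rewrite unitrM_comm; last exact/commrXz/commr_sym/commrXz/phiP_central.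
by apply/andP; split; apply: unitrXz; [exact: phiP_Lp_unit | exact: phiP_Lm_unit].
Qed.

Lemma semi_Delta lam g (gB : in_BorelP g) :
  semi (actr char0 (gB_unit gB)) (delta lam g) (Delta lam).
Proof.
apply: semiM; apply: semiXz.
- exact: phiP_Lp_unit.
- exact: (tau1_neq0 gB).
- exact: semi_Lp.
- exact: phiP_Lm_unit.
- exact: (tau2_neq0 gB).
- exact: semi_Lm.
Qed.

Lemma Psi_kmul c Q : Psi (kmul c Q) = c *: Psi Q.
Proof. by rewrite (rmorphM Psi) PsiC phiP_C. Qed.

Lemma Psi_eq Q Q' : Psi Q = Psi Q' -> Q = Q'.
Proof.
move=> e; apply/eqP; rewrite -subr_eq0; apply/eqP; apply: (@Psi_inj _ _ _ char0).
by rewrite (rmorphB Psi) e subrr.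
Qed.

End Weights.

Lemma scaler_swap (K : pzRingType) (A : algType K) (c : K) (x y : A) :
  (c *: x) * y = x * (c *: y).
Proof. by rewrite -scalerAl -scalerAr. Qed.

Section Weights.
Variables (K : fieldType) (m n : nat).
Hypothesis char0 : [pchar K] =i pred0.

Local Notation Pev := {mpoly K[m * m + n * n]}.
Local Notation QG := (QG K m n).
Local Notation L R := (extalg R (m * n)).
Local Notation X11 := (X11 K m n).
Local Notation X22 := (X22 K m n).
Local Notation Psi := (Psi m n char0).
Local Notation Gev := (Gev K m n).
Local Notation H := (H char0).
Local Notation sub := (sub char0).
Local Notation floor_poly := (@floor_poly K m n).
Local Notation Delta := (@Delta K m n).
Local Notation Lp s := (rminor X11 (iota 0 s)).
Local Notation Lm s := (rminor X22 (iota 0 s)).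
Local Notation kmul := (@kmul K m n).
Local Notation pairs := (seq ('I_m * 'I_n)).
Implicit Types (lam sigma : weight m n) (g h : Gev) (Q : L Pev) (c d : K) (KL : pairs).

Local Notation delta := (@delta K m n).

Lemma Delta_cancel lam (x y : QG) : Delta lam * x = Delta lam * y -> x = y.
Proof. exact: (mulrI (Delta_unit K lam)). Qed.

Lemma kmulK c Q : c != 0 -> kmul c^-1 (kmul c Q) = Q.
Proof. by move=> c0; rewrite kmulM (mulVf c0); apply: kmul1. Qed.

(** Delta is an invertible eigenvector and Psi is injective, so that an
    eigenvector of act is one of H, with the eigenvalue of Delta divided
    out. *)
Lemma act_H lam g c Q : in_BorelP g ->
  act g (Delta lam * Psi Q) = c *: (Delta lam * Psi Q) ->
  H g Q = kmul (c / delta lam g) Q.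
Proof.
move=> gB e; have ug := gB_unit gB; have d0 := delta_neq0 lam gB.
have e1 : Psi (kmul (delta lam g) (H g Q)) = Psi (kmul c Q).
  have a1 : act g (Delta lam * Psi Q) = Delta lam * Psi (kmul (delta lam g) (H g Q)).
    have sD : actr char0 (gB_unit gB) (Delta lam) = delta lam g *: Delta lam.
      exact: semi_Delta.
    rewrite Psi_kmul -(actrE char0 (gB_unit gB)) (rmorphM (actr char0 (gB_unit gB))).
    by rewrite sD actrE (act_Psi _ _ ug); apply: scaler_swap.
  have a2 : Delta lam * Psi (kmul c Q) = c *: (Delta lam * Psi Q).
    by rewrite Psi_kmul -scalerAr.
  by apply: (@Delta_cancel lam); exact: etrans (esym a1) (etrans e (esym a2)).
have e2 := Psi_eq e1.
have e3 : kmul (delta lam g)^-1 (kmul (delta lam g) (H g Q)) = kmul (c / delta lam g) Q.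
  apply: etrans (congr1 (kmul _) e2) _; apply: etrans (kmulM _ _ _) _.
  exact: (congr1 (kmul^~ Q) (mulrC _ _)).
by apply: etrans _ e3; apply/esym/kmulK.
Qed.

(** If the initial minors of A and B do not vanish, then g = (W A, W B) is
    in the Borel subgroup and A g1, B g2 are lower triangular; the value of
    Q at (A, B) is thus proportional, up to a change of odd variables, to
    its value at the identity. Such points are dense. *)
Lemma eigen_vanish lp lm k Q : all (fun s => s <= m)%N lp -> all (fun s => s <= n)%N lm ->
  floor_poly lp lm k Q ->
  (forall g, in_BorelP g -> exists2 c, c != 0 & H g Q = kmul c Q) ->
  ev (1%:M : 'M[K]_m) (1%:M : 'M[K]_n) Q = 0 -> Q = 0.
Proof.
move=> le_p le_m hQ eQ Q1.
have ev0 (A : 'M[K]_m) (B : 'M[K]_n) : \prod_(s < m) rminor A (iota 0 s) != 0 ->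
    \prod_(s < n) rminor B (iota 0 s) != 0 -> ev A B Q = 0.
  move=> dA dB; pose g : Gev := (Wmx A, Wmx B).
  have detW r (C : 'M[K]_r) : \det (Wmx C) = \prod_(s < r) rminor C (iota 0 s).
    rewrite -det_tr det_trig ?Wmx_utrig //.
    by apply: eq_bigr => i _; rewrite mxE Wmx_diag.
  have gB : in_BorelP g.
    split; [apply/andP; split; rewrite unitmxE unitfE detW //|exact: Wmx_utrig..].
  have [c c0 e] := eQ g gB.
  have e0 : ev (A *m Wmx A) (B *m Wmx B) Q = 0.
    have := floor_lower (1%:M : 'M[K]_m) (1%:M : 'M[K]_n) (mul_Wmx_trig A)
      (mul_Wmx_trig B) le_p le_m hQ.
    by rewrite !mulmx1 Q1 mulr0.
  (* With the value at (A g1, B g2) zero, the eigenvalue equation forces the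
     value at (A, B) to vanish. *)
  have := ev_H char0 g A B Q; rewrite e ev_kmul e0 (rmorph0 (sub g)) => cev.
  apply: ecoefP => S; rewrite ecoef0; apply: (mulfI c0); rewrite mulr0.
  by rewrite -(ecoef_extCM (p := m * n)) -[ext_mul _ _]/(extC _ c * ev A B Q) cev ecoef0.
apply: ecoefP => S; rewrite ecoef0; apply/eqP.
(* Q * M vanishes at all points: where M does not, ev0 applies. *)
pose M : Pev := (\prod_(s < m) Lp s) * \prod_(s < n) Lm s.
have M0 : M != 0.
  by rewrite mulf_neq0 //; apply/prodf_neq0 => s _;
    [apply: lead_X11_neq0 | apply: lead_X22_neq0]; apply: ltnW.
have : ecoef Q S * M = 0.
  apply: (evP_eq0 char0) => A B; rewrite /M !rmorphM !rmorph_prod /=.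
  under eq_bigr do rewrite evP_rminor11.
  under [X in _ * (_ * X)]eq_bigr do rewrite evP_rminor22.
  rewrite -(ecoef_coefmap (evP A B)) -[coefmap _ _]/(ev A B).
  have [->|dA] := eqVneq (\prod_(s < m) rminor A (iota 0 s)) 0; first by rewrite mul0r mulr0.
  have [->|dB] := eqVneq (\prod_(s < n) rminor B (iota 0 s)) 0; first by rewrite !mulr0.
  by rewrite ev0 // ecoef0 mul0r.
by move/eqP; rewrite mulf_eq0 (negbTE M0) orbF.
Qed.

(** * Torus weights *)

Definition torus (t1 : 'rV[K]_m) (t2 : 'rV[K]_n) : Gev := (diag_mx t1, diag_mx t2).

Section OneTorus.
Variables (t1 : 'rV[K]_m) (t2 : 'rV[K]_n).
Hypothesis t1_neq0 : forall i, t1 0 i != 0.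
Hypothesis t2_neq0 : forall j, t2 0 j != 0.
Local Notation t := (torus t1 t2).

Lemma torus_Borel : in_BorelP t.
Proof. by split; [apply/andP; split; apply: diag_unit | exact: diag_utrig..]. Qed.

Lemma invmx_diag r (d : 'rV[K]_r) : (forall i, d 0 i != 0) ->
  invmx (diag_mx d) = diag_mx (\row_i (d 0 i)^-1).
Proof.
move=> d0; have ud := diag_unit d0; apply: (can_inj (mulKmx ud)).
rewrite mulmxV // mulmx_diag; apply/matrixP => i j; rewrite !mxE.
by case: eqP => [->|//]; rewrite mulfV.
Qed.

(** The weight of the odd variable Theta_ij under the torus is t2_j / t1_i. *)
Definition twt : 'I_(m * n) -> K := fun k => mxvec (\matrix_(i, j) ((t1 0 i)^-1 * t2 0 j)) 0 k.

Lemma sub_torus k : sub t (extX K k) = extC _ (twt k) * extX K k.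
Proof.
case/mxvec_indexP: k => i j; rewrite /twt mxvecE mxE.
have /matrixP/(_ i j) := sub_Theta char0 t; rewrite map_Theta => ->.
rewrite /sub_mx /= (invmx_diag t1_neq0) !map_diag_mx mul_mx_diag [LHS]mxE mul_diag_mx.
rewrite !mxE -mulrA -extC_commE mulrA; congr (_ * _).
exact/esym/(rmorphM (@extCr K (m * n))).
Qed.

(** For a diagonal matrix t, multiplying the identity by t on the left or
    on the right is the same: the first is computed by floor_lower, the
    second is the action. So every monomial in the value of Q at the
    identity satisfies this equation, in which chi does not depend on the
    monomial. *)
Lemma floor_weight lp lm k Q s S :
  all (fun s => s <= m)%N lp -> all (fun s => s <= n)%N lm ->
  floor_poly lp lm k Q -> H t Q = kmul s Q ->
  ecoef (ev (1%:M : 'M[K]_m) (1%:M : 'M[K]_n) Q) S != 0 ->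
  chi t.1 lp * chi t.2 lm * \prod_(k in S) twt k = s.
Proof.
move=> le_p le_m hQ e; set q := ev _ _ Q => qS.
have tt r (d : 'rV[K]_r) : is_trig_mx (diag_mx d) by apply: diag_mx_is_trig.
have := ev_H char0 t (1%:M : 'M[K]_m) (1%:M : 'M[K]_n) Q.
have := floor_lower (1%:M : 'M[K]_m) (1%:M : 'M[K]_n) (tt _ t1) (tt _ t2) le_p le_m hQ.
rewrite !mulmx1 !mul1mx => -> ; rewrite e ev_kmul (rmorphM (sub t)) subC -/q => eq.
have := congr1 (fun x => ecoef x S) eq.
rewrite [LHS]ecoef_extCM [RHS]ecoef_extCM.
rewrite (ecoef_diag_subst (subC char0 t) sub_torus) mulrA => /(mulIf qS).
exact: esym.
Qed.

End OneTorus.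
End Weights.

(** * Admissible sequences and sets of odd variables *)

Section StrictLex.
Variables (m n : nat).
Local Notation pair := ('I_m * 'I_n)%type.
Implicit Types (p q : pair) (s t : seq pair) (S : {set 'I_(m * n)}).

Definition idx p : 'I_(m * n) := mxvec_index p.1 p.2.
Definition idx_set s : {set 'I_(m * n)} := [set k in map idx s].
(** The order that admissibility imposes on the pairs: strict and
    lexicographic. *)
Definition slex : rel pair := fun p q =>
  (p.1 <= q.1)%N && ((p.1 == q.1) ==> (p.2 < q.2)%N).

Lemma idx_inj : injective idx.
Proof. exact: mxvec_index_inj. Qed.

Lemma slex_irr : irreflexive slex.
Proof. by move=> p; rewrite /slex leqnn eqxx /= ltnn. Qed.

Lemma slex_trans : transitive slex.
Proof.
move=> q p r; rewrite /slex -!val_eqE /= => /andP[le1 h1] /andP[le2 h2].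
rewrite (leq_trans le1 le2) /=; apply/implyP => /eqP e.
have e1 : p.1 = q.1 :> nat by apply/eqP; rewrite eqn_leq le1 e le2.
have e2 : q.1 = r.1 :> nat by rewrite -e1.
by move: h1 h2; rewrite e1 e2 !eqxx /=; apply: ltn_trans.
Qed.

Lemma slex_uniq s : sorted slex s -> uniq s.
Proof. exact: (sorted_uniq slex_trans slex_irr). Qed.

Lemma mem_idx_set s p : (idx p \in idx_set s) = (p \in s).
Proof. by rewrite inE mem_map //; apply: idx_inj. Qed.

Lemma slex_eq s t : sorted slex s -> sorted slex t -> idx_set s = idx_set t -> s = t.
Proof.
move=> ss st e; apply: (irr_sorted_eq slex_trans slex_irr ss st) => p.
by rewrite -!mem_idx_set e.
Qed.

Lemma card_idx_set s : uniq s -> #|idx_set s| = size s.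
Proof.
move=> us; rewrite cardsE (card_uniqP _) ?size_map // map_inj_uniq //.
exact: idx_inj.
Qed.

(** Together with slex_eq: strictly sorted sequences of pairs are the same
    as sets of odd variables. *)
Lemma slex_ex S : exists2 s, sorted slex s & idx_set s = S.
Proof.
(* Sorting needs a total order; on a duplicate-free sequence it is strict. *)
pose wlex : rel pair := fun p q => (p.1 < q.1)%N || ((p.1 == q.1) && (p.2 <= q.2)%N).
have wtot : total wlex.
  move=> p q; rewrite /wlex -!val_eqE /=; case: ltngtP => //= _; exact: leq_total.
have wtr : transitive wlex.
  move=> q p r; rewrite /wlex -!val_eqE /= => h1 h2; lia.
pose s0 := [seq p <- enum {: pair} | idx p \in S].
exists (sort wlex s0).
  have us : uniq (sort wlex s0) by rewrite sort_uniq filter_uniq // enum_uniq.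
  have ss := sort_sorted wtot s0.
  rewrite (sorted_pairwise slex_trans).
  have : pairwise [rel x y : pair | (x != y) && wlex x y] (sort wlex s0).
    by rewrite pairwise_relI -uniq_pairwise us -(sorted_pairwise wtr).
  apply: sub_pairwise => p q /= /andP[ne]; rewrite /wlex /slex.
  case: p q ne => i j [i' j'] /=; rewrite xpair_eqE -!val_eqE /=; lia.
apply/setP => k; case/mxvec_indexP: k => i j.
rewrite -[mxvec_index i j]/(idx (i, j)) mem_idx_set mem_sort mem_filter mem_enum.
by rewrite andbT.
Qed.

Lemma sum_countZ (T : Type) (P : pred T) (l : seq T) :
  \sum_(p <- l) (P p)%:Z = (count P l)%:Z.
Proof. by elim: l => [|p l IH]; rewrite ?big_nil //= big_cons IH PoszD. Qed.

Lemma contentP s t : content s = content t <->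
  (forall i : 'I_m, count (fun p => p.1 == i) s = count (fun p => p.1 == i) t) /\
  (forall j : 'I_n, count (fun p => p.2 == j) s = count (fun p => p.2 == j) t).
Proof.
split=> [e|[e1 e2]].
  split=> [i|j].
    have := congr1 (fun w : weight m n => tnth w.1 i) e.
    by rewrite !tnth_mktuple => /oppr_inj[].
  have := congr1 (fun w : weight m n => tnth w.2 j) e.
  by rewrite !tnth_mktuple => -[].
by congr (_, _); apply: eq_from_tnth => i; rewrite !tnth_mktuple ?e1 ?e2.
Qed.

Lemma shift_content (lam : weight m n) s t : content s = content t ->
  shift lam s = shift lam t.
Proof.
case/contentP => e1 e2; congr (_, _); apply: eq_from_tnth => i; rewrite !tnth_mktuple.
  by congr (_ - _); rewrite !sum_countZ e1.
by congr (_ + _); rewrite !sum_countZ e2.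
Qed.

Lemma admissibleE (lam : weight m n) s :
  admissible lam s = dominant (shift lam s) && sorted slex s.
Proof. by []. Qed.

End StrictLex.

Section ThetaCoefficients.
Variables (R : comNzRingType) (m n : nat).

Lemma thetas_sign (s : seq ('I_m * 'I_n)) : uniq s -> exists b : bool,
  forall S, ecoef (thetas R s) S = (-1) ^+ b * (S == idx_set s)%:R.
Proof.
move=> us; have [b e] := prod_extX_seq R (map (@idx m n) s); exists b => S.
rewrite thetasE e map_inj_uniq ?us; last exact: idx_inj.
by rewrite ecoef_signM ecoef_wedge.
Qed.

End ThetaCoefficients.

Section TwoPowers.
Variables (K : fieldType) (m n : nat).
Hypothesis char0 : [pchar K] =i pred0.
Implicit Types (s : seq ('I_m * 'I_n)).

Lemma pow2_inj : injective (fun a : nat => (2%:R : K) ^+ a).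
Proof.
by move=> a b /=; rewrite -!natrX => /(natr_inj_char0 char0)/eqP; rewrite eqn_exp2l // => /eqP.
Qed.

Lemma prod_if_count (T : Type) (P : pred T) (l : seq T) (x : K) :
  \prod_(p <- l) (if P p then x else 1) = x ^+ count P l.
Proof.
elim: l => [|p l IH]; first by rewrite big_nil.
by rewrite big_cons IH /=; case: (P p); rewrite ?mul1r // add1n exprS.
Qed.

Lemma twt_set (t1 : 'rV[K]_m) (t2 : 'rV[K]_n) s : uniq s ->
  \prod_(k in idx_set s) twt t1 t2 k = \prod_(p <- s) ((t1 0 p.1)^-1 * t2 0 p.2).
Proof.
move=> us; have ui : uniq (map (@idx m n) s) by rewrite map_inj_uniq //; apply: idx_inj.
transitivity (\prod_(k in map (@idx m n) s) twt t1 t2 k).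
  by apply: eq_bigl => k; rewrite inE.
rewrite -big_uniq //= big_map; apply: eq_bigr => p _.
by rewrite /twt mxvecE mxE.
Qed.

(** Weights detect contents: at a torus element with one entry 2 and all
    others 1, the weight is a power of 2 whose exponent is one entry of the
    content. *)
Lemma weights_content s t : uniq s -> uniq t ->
  (forall (t1 : 'rV[K]_m) (t2 : 'rV[K]_n), (forall i, t1 0 i != 0) ->
     (forall j, t2 0 j != 0) ->
     \prod_(k in idx_set s) twt t1 t2 k = \prod_(k in idx_set t) twt t1 t2 k) ->
  content s = content t.
Proof.
move=> us ut e; have n2 : (2%:R : K) != 0 by rewrite (natr_eq0_char0 char0).
pose one r : 'rV[K]_r := const_mx 1.
pose two r (i : 'I_r) : 'rV[K]_r := \row_j (if j == i then 2%:R else 1).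
have one0 r i : one r 0 i != 0 by rewrite mxE oner_eq0.
have two0 r (i : 'I_r) j : two r i 0 j != 0 by rewrite mxE; case: ifP; rewrite ?oner_eq0.
apply/contentP; split=> i.
  have := e _ _ (two0 m i) (one0 n); rewrite !twt_set //.
  have E l : \prod_(p <- l) ((two m i 0 p.1)^-1 * one n 0 p.2) =
      (2%:R : K)^-1 ^+ count (fun p : 'I_m * 'I_n => p.1 == i) l.
    rewrite -prod_if_count; apply: eq_bigr => p _; rewrite !mxE mulr1.
    by case: ifP; rewrite ?invr1.
  by rewrite !E !exprVn => /invr_inj/pow2_inj.
have := e _ _ (one0 m) (two0 n i); rewrite !twt_set //.
have E l : \prod_(p <- l) ((one m 0 p.1)^-1 * two n i 0 p.2) =
    (2%:R : K) ^+ count (fun p : 'I_m * 'I_n => p.2 == i) l.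
  by rewrite -prod_if_count; apply: eq_bigr => p _; rewrite !mxE invr1 mul1r.
by rewrite !E => /pow2_inj.
Qed.

End TwoPowers.

(** * The basis of primitive vectors *)

Section Basis.
Variables (K : fieldType) (m n k : nat).
Hypothesis char0 : [pchar K] =i pred0.
Hypothesis m_gt0 : (0 < m)%N.
Hypothesis n_gt0 : (0 < n)%N.
Variables (lam : weight m n) (IJ : k.-tuple ('I_m * 'I_n)).
Hypothesis lam_dom : dominant lam.
Hypothesis IJ_adm : admissible lam IJ.
Hypothesis lam_rob : robust lam IJ.

Local Notation Pev := {mpoly K[m * m + n * n]}.
Local Notation QG := (QG K m n).
Local Notation L R := (extalg R (m * n)).
Local Notation Psi := (Psi m n char0).
Local Notation Gev := (Gev K m n).
Local Notation H := (H char0).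
Local Notation floor_poly := (@floor_poly K m n).
Local Notation Delta := (@Delta K m n).
Local Notation kmul := (@kmul K m n).
Local Notation pairs := (seq ('I_m * 'I_n)).
Local Notation thetas R := (@thetas m n R).
Local Notation delta := (@delta K m n).
Local Notation Qpi := (@Qpi K m n).
Local Notation sigma := (shift lam IJ).
Local Notation slex := (@slex m n).
Local Notation ev1 := (ev (1%:M : 'M[K]_m) (1%:M : 'M[K]_n)).
Local Notation is_cols := (floor_poly (cols lam.1) (cols lam.2) k).
Local Notation good := (fun KL : k.-tuple ('I_m * 'I_n) =>
  admissible lam KL && (content KL == content IJ)).
Implicit Types (g h : Gev) (Q : L Pev) (c d : K) (KL : pairs) (x : QG).

(** Robustness depends on (I|J) through its content only. *)
Lemma robust_cnt KL : content KL = content IJ ->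
  (forall a, (a < m.-1)%N -> (cnt1 KL a <= gap lam.1 a)%N) /\
  (forall b, (b < n.-1)%N -> (cnt2 KL b.+1 <= gap lam.2 b)%N).
Proof.
case/contentP => e1 e2; case: lam_rob => r1 r2; split=> a lt_a.
  have lt_am : (a < m)%N by lia.
  have -> : cnt1 KL a = count (fun p => p.1 == Ordinal lt_am) KL by [].
  by rewrite e1; have := r1 (Ordinal lt_am); rewrite /gap /=; lia.
have lt_an : (a.+1 < n)%N by lia.
have -> : cnt2 KL a.+1 = count (fun p => p.2 == Ordinal lt_an) KL by [].
by rewrite e2; have := r2 (Ordinal lt_an) isT; rewrite /gap /=; lia.
Qed.

(** The eigenvalue on Q when Delta * Psi Q has weight sigma. *)
Definition bchar g : K := wt g sigma / delta lam g.

Lemma piv_content KL : content KL = content IJ ->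
  piv K lam KL = Delta lam * Psi (Qpi lam KL).
Proof. by move=> /robust_cnt[le1 le2]; apply: piv_Psi. Qed.

Lemma act_piv g KL : in_BorelP g -> content KL = content IJ ->
  act g (piv K lam KL) = wt g sigma *: piv K lam KL.
Proof.
move=> gB /(shift_content lam) <-.
by have := semi_piv char0 gB lam KL; rewrite /semi actrE.
Qed.

Lemma H_Qpi g KL : in_BorelP g -> content KL = content IJ ->
  H g (Qpi lam KL) = kmul (bchar g) (Qpi lam KL).
Proof.
move=> gB e; apply: act_H => //.
have := act_piv gB e; rewrite (piv_content e); exact.
Qed.

Lemma floor_Qpi_content (KL : k.-tuple ('I_m * 'I_n)) :
  content KL = content IJ -> is_cols (Qpi lam KL).
Proof.
move=> /robust_cnt[le1 le2].
by have := floor_Qpi K m_gt0 n_gt0 lam_dom le1 le2; rewrite size_tuple.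
Qed.

Lemma wt_gdiag g s : wt (gdiag g) s = wt g s.
Proof.
by congr (_ * _); apply: eq_bigr => i _; rewrite !mxE eqxx.
Qed.

Lemma natent_diag r (A : 'M[K]_r) l :
  natent (diag_mx (\row_i A i i)) l l = natent A l l.
Proof.
have [lt_l|le_l] := ltnP l r.
  by rewrite -[l]/(val (Ordinal lt_l)) !natentE !mxE eqxx.
by rewrite /natent; case: insubP => // i; rewrite ltnNge le_l.
Qed.

Lemma delta_gdiag g : delta lam (gdiag g) = delta lam g.
Proof.
by congr (_ ^ _ * _ ^ _); apply: eq_bigr => l _; apply: natent_diag.
Qed.

Lemma wt_torus t1 t2 s : wt (torus t1 t2 : Gev) s =
  (\prod_(i < m) t1 0 i ^ s.1`_i) * \prod_(j < n) t2 0 j ^ s.2`_j.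
Proof. by congr (_ * _); apply: eq_bigr => i _; rewrite mxE eqxx. Qed.

Lemma wt_neq0 g s : in_BorelP g -> wt g s != 0.
Proof.
move=> gB; apply: mulf_neq0; apply/prodf_neq0 => i _; apply: expfz_neq0.
  exact: diag1_neq0.
exact: diag2_neq0.
Qed.

Lemma bchar_neq0 g : in_BorelP g -> bchar g != 0.
Proof. by move=> gB; rewrite mulf_neq0 ?invr_eq0 ?wt_neq0 ?delta_neq0. Qed.

(** The weight gives the character on the torus only; borel_char extends
    the equality to the Borel subgroup. *)
Lemma H_primitive Q : primitive (Delta lam * Psi Q) ->
  has_weight sigma (Delta lam * Psi Q) ->
  forall g, in_BorelP g -> H g Q = kmul (bchar g) Q.
Proof.
move=> [x0 xprim] xwt g gB.
have Q0 : Q <> 0 by move=> Q0; apply: x0; rewrite Q0 (rmorph0 Psi) mulr0.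
have semiQ h : in_BorelP h -> exists c, H h Q = kmul c Q.
  move=> hB; have [|c e] := xprim h; first by case: hB => *; apply/and3P.
  by exists (c / delta lam h); apply: act_H.
apply: etrans (borel_char Q0 semiQ gB) _.
have dB := gdiag_Borel gB; have [ud _ _] := dB.
have := act_H dB (etrans (xwt _ _ ud) (esym (congr1 ( *:%R^~ _) (wt_torus _ _ _)))).
rewrite -[torus _ _]/(gdiag g) wt_gdiag delta_gdiag; exact.
Qed.

Lemma ev1_Qpi_coef KL S :
  ecoef (ev1 (Qpi lam KL)) S = ecoef (thetas K KL) S.
Proof. by rewrite ev1_Qpi. Qed.

Lemma thetas_coef S KL : uniq KL ->
  ecoef (thetas K KL) S = ecoef (thetas K KL) (idx_set KL) * (S == idx_set KL)%:R.
Proof.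
by move=> /(thetas_sign K)[b e]; rewrite !e eqxx mulr1.
Qed.

Lemma thetas_sq KL : uniq KL ->
  ecoef (thetas K KL) (idx_set KL) * ecoef (thetas K KL) (idx_set KL) = 1.
Proof.
by move=> /(thetas_sign K)[b e]; rewrite !e eqxx mulr1 -expr2 sqrr_sign.
Qed.

Lemma adm_slex KL : admissible lam KL -> sorted slex KL.
Proof. by rewrite admissibleE => /andP[]. Qed.

(** By floor_weight the weight of a monomial occurring at the identity is
    bchar divided by a factor common to the whole floor. The value of
    pi_{I|J} is a monomial to compare with, and weights_content turns
    equality of weights into equality of contents. *)
Lemma support_ev1 Q (S : {set 'I_(m * n)}) : is_cols Q ->
  (forall g, in_BorelP g -> H g Q = kmul (bchar g) Q) ->
  ecoef (ev1 Q) S != 0 -> exists2 KL, good KL & idx_set KL = S.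
Proof.
move=> hQ eQ QS; have [s ss eS] := slex_ex S.
have le_m : all (fun a => a <= m)%N (cols lam.1) by apply: cols_size_le.
have le_n : all (fun a => a <= n)%N (cols lam.2) by apply: cols_size_le.
have us := slex_uniq ss; have uIJ := slex_uniq (adm_slex IJ_adm).
have szs : size s == k.
  rewrite -(card_idx_set us) eS; apply: contraNT QS => nk.
  by rewrite (floor_homog _ _ hQ nk).
have cs : content s = content IJ.
  apply: (weights_content char0 us uIJ) => t1 t2 n1 n2.
  have tB := torus_Borel n1 n2.
  have w1 := floor_weight n1 le_m le_n hQ (eQ _ tB) QS.
  have q0 : ecoef (ev1 (Qpi lam IJ)) (idx_set IJ) != 0.
    rewrite ev1_Qpi_coef; apply/eqP => z; have := thetas_sq uIJ.
    by rewrite z mul0r => /esym/eqP; rewrite oner_eq0.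
  have w2 := floor_weight n1 le_m le_n (floor_Qpi_content (erefl _))
    (H_Qpi tB (erefl _)) q0.
  rewrite eS; have b0 := bchar_neq0 tB; rewrite -w2 in b0.
  have chi0 : chi (torus t1 t2).1 (cols lam.1) * chi (torus t1 t2).2 (cols lam.2) != 0.
    by apply: contraNneq b0 => ->; rewrite mul0r.
  by apply: (mulfI chi0); rewrite w1 w2.
exists (Tuple szs) => //=; rewrite cs eqxx andbT admissibleE ss andbT.
by rewrite (shift_content lam cs); case/andP: IJ_adm.
Qed.

(** Each monomial that occurs is up to sign the value of exactly one
    admissible pi, and the sign appears twice in the coefficient. *)
Lemma ev1_expand Q : is_cols Q ->
  (forall g, in_BorelP g -> H g Q = kmul (bchar g) Q) ->
  ev1 Q = \sum_(KL | good KL)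
    extC _ (ecoef (ev1 Q) (idx_set KL) * ecoef (thetas K KL) (idx_set KL)) * thetas K KL.
Proof.
move=> hQ eQ; apply: ecoefP => S; rewrite ecoef_sum.
have term (KL : k.-tuple ('I_m * 'I_n)) : good KL ->
    ecoef (extC _ (ecoef (ev1 Q) (idx_set KL) * ecoef (thetas K KL) (idx_set KL))
       * thetas K KL) S = ecoef (ev1 Q) S * (S == idx_set KL)%:R.
  move=> /andP[/adm_slex/slex_uniq uKL _]; rewrite [LHS]ecoef_extCM (thetas_coef S uKL).
  rewrite mulrA -[X in X * _]mulrA (thetas_sq uKL) mulr1.
  by case: (S =P _) => [->|]; rewrite ?mulr0.
rewrite (eq_bigr _ term).
have [z|QS] := eqVneq (ecoef (ev1 Q) S) 0.
  by rewrite big1 // => KL _; rewrite z mul0r.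
have [KL gKL eS] := support_ev1 hQ eQ QS.
rewrite (bigD1 KL) //= eS eqxx mulr1 big1 ?addr0 // => KL' /andP[gKL' ne].
case: eqP => [e|_]; last by rewrite mulr0.
case/eqP: ne; apply: val_inj; move: gKL gKL' => /andP[/adm_slex s1 _] /andP[/adm_slex s2 _].
by apply: (slex_eq s2 s1); rewrite -e.
Qed.

Lemma Psi_combination (c : k.-tuple ('I_m * 'I_n) -> K) :
  \sum_(KL | good KL) c KL *: piv K lam KL =
  Delta lam * Psi (\sum_(KL | good KL) kmul (c KL) (Qpi lam KL)).
Proof.
rewrite (rmorph_sum Psi) mulr_sumr; apply: eq_bigr => KL /andP[_ /eqP e].
by rewrite Psi_kmul -scalerAr (piv_content e).
Qed.

Lemma ev1_combination (c : k.-tuple ('I_m * 'I_n) -> K) :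
  ev1 (\sum_(KL | good KL) kmul (c KL) (Qpi lam KL)) =
  \sum_(KL | good KL) extC _ (c KL) * thetas K KL.
Proof.
rewrite (rmorph_sum ev1); apply: eq_bigr => KL _.
by rewrite ev_kmul ev1_Qpi.
Qed.

(** The values at the identity are independent. *)
Lemma piv_free (c : k.-tuple ('I_m * 'I_n) -> K) :
  \sum_(KL | good KL) c KL *: piv K lam KL = 0 ->
  forall KL : k.-tuple ('I_m * 'I_n), good KL -> c KL = 0.
Proof.
rewrite Psi_combination => e KL gKL.
have e0 : \sum_(KL | good KL) kmul (c KL) (Qpi lam KL) = 0.
  apply: (@Psi_eq _ _ _ char0); apply: (@Delta_cancel K m n lam).
  by rewrite e (rmorph0 Psi) mulr0.
have := ev1_combination c; rewrite e0 (rmorph0 ev1).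
move/esym/(congr1 (fun q => ecoef q (idx_set KL))).
rewrite ecoef0 ecoef_sum (bigD1 KL) //= [X in _ + X]big1 ?addr0.
  rewrite [LHS]ecoef_extCM; have /andP[/adm_slex/slex_uniq uKL _] := gKL.
  move/(congr1 ( *%R^~ (ecoef (thetas K KL) (idx_set KL)))).
  by rewrite -mulrA thetas_sq // mulr1 mul0r.
move=> KL' /andP[gKL' ne]; have /andP[/adm_slex s' _] := gKL'.
rewrite [LHS]ecoef_extCM (thetas_coef _ (slex_uniq s')).
case: eqP => [e'|_]; last by rewrite !mulr0.
case/eqP: ne; apply: val_inj; have /andP[/adm_slex s1 _] := gKL.
by apply: (slex_eq s' s1); rewrite -e'.
Qed.

Lemma combination_primitive (c : k.-tuple ('I_m * 'I_n) -> K) :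
  primitive_space lam k sigma (\sum_(KL | good KL) c KL *: piv K lam KL).
Proof.
have actx g : in_BorelP g -> act g (\sum_(KL | good KL) c KL *: piv K lam KL) =
    wt g sigma *: \sum_(KL | good KL) c KL *: piv K lam KL.
  move=> gB; have ug := gB_unit gB; rewrite -(actrE char0 ug).
  apply: semi_combination => [a|KL /andP[_ /eqP e]].
    by rewrite actrE QG_scaleE mulr1 act_extC // actF_tofrac // actP_C.
  by rewrite /semi actrE; apply: act_piv.
split.
  apply/(floorH0P char0); exists (\sum_(KL | good KL) kmul (c KL) (Qpi lam KL)).
    by apply: floor_sum => KL /andP[_ /eqP e]; apply/floor_scale/floor_Qpi_content.
  exact: Psi_combination.
set x := \sum_(KL | _) _ in actx *.
have [->|/eqP x0] := eqVneq x 0; first by left.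
right; split.
  by split=> // g /and3P[h1 h2 h3]; exists (wt g sigma); apply: actx.
move=> t1 t2 ut; rewrite actx; first by rewrite (wt_torus t1 t2).
by split; [exact: ut | exact: diag_utrig..].
Qed.

(** The combination of the pi with the same value at the identity has the
    same Borel character, so eigen_vanish applies to the difference. *)
Lemma primitive_combination x : primitive_space lam k sigma x ->
  exists c : k.-tuple ('I_m * 'I_n) -> K,
    x = \sum_(KL | good KL) c KL *: piv K lam KL.
Proof.
case=> /(floorH0P char0)[Q hQ ->] [->|[xprim xwt]].
  by exists (fun=> 0); rewrite big1 // => KL _; rewrite scale0r.
have eQ := H_primitive xprim xwt.
pose c (KL : k.-tuple ('I_m * 'I_n)) :=
  ecoef (ev1 Q) (idx_set KL) * ecoef (thetas K KL) (idx_set KL).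
pose Q' := \sum_(KL | good KL) kmul (c KL) (Qpi lam KL).
have hQ' : is_cols Q'.
  by apply: floor_sum => KL /andP[_ /eqP e]; apply/floor_scale/floor_Qpi_content.
have eQ' g : in_BorelP g -> H g Q' = kmul (bchar g) Q'.
  move=> gB; rewrite (rmorph_sum (H g)) /kmul mulr_sumr.
  apply: eq_bigr => KL /andP[_ /eqP e].
  apply: etrans (H_kmul_eigen (H_Qpi gB e) (c KL)) _; rewrite mulrC.
  exact/esym/kmulM.
have e1 : ev1 Q' = ev1 Q.
  by apply: etrans (ev1_combination c) (esym (ev1_expand hQ eQ)).
exists c; rewrite Psi_combination -/Q'; apply: (congr1 (fun q => Delta lam * Psi q)).
apply/eqP; rewrite -subr_eq0; apply/eqP.
have -> : Q - Q' = Q + kmul (-1) Q'.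
  rewrite /kmul mpolyCN mpolyC1 (rmorphN (@extCr Pev (m * n))).
  by rewrite (rmorph1 (@extCr Pev (m * n))) mulN1r.
apply: (eigen_vanish (char0 := char0) (lp := cols lam.1) (lm := cols lam.2) (k := k)).
- exact: cols_size_le.
- exact: cols_size_le.
- exact/FloorAdd/floor_scale.
- move=> g gB; exists (bchar g); first exact: bchar_neq0.
  rewrite (rmorphD (H g)) [in RHS]/kmul mulrDr; congr (_ + _); first exact: eQ.
  apply: etrans (H_kmul_eigen (eQ' g gB) (-1)) _; rewrite mulrC.
  exact/esym/kmulM.
- rewrite (rmorphD ev1) ev_kmul e1 (rmorphN (@extCr K (m * n))).
  by rewrite (rmorph1 (@extCr K (m * n))) mulN1r subrr.
Qed.

Lemma piv_basis : is_basis good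
  (fun KL : k.-tuple ('I_m * 'I_n) => piv K lam KL) (primitive_space (K := K) lam k sigma).
Proof.
split; first exact: piv_free.
move=> x; split; first exact: primitive_combination.
by case=> c ->; apply: combination_primitive.
Qed.

End Basis.

Theorem theorem4p4 (K : closedFieldType) (m n k : nat) (lam : weight m n)
    (IJ : k.-tuple ('I_m * 'I_n)) (char0 : [pchar K] =i pred0)
    (m_gt0 : (0 < m)%N) (n_gt0 : (0 < n)%N) (lam_dom : dominant lam)
    (IJ_adm : admissible lam IJ) (lam_rob : robust lam IJ)
    (sigma_m : n%:Z <= (shift lam IJ).1`_m.-1) :
  is_basis
    (fun KL : k.-tuple ('I_m * 'I_n) =>
       admissible lam KL && (content KL == content IJ))
    (fun KL => piv K lam KL)
    (primitive_space (K := K) lam k (shift lam IJ)).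
Proof. exact: piv_basis. Qed.
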